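(* If $T$ is a ($0$-framed) bottom knot, then its universal $sl_2$ invariant $J_T$ is uniquely expressed as $$J_T=\sum_{p\ge0}a_p(T)\,\sigma_p,$$ where $a_p(T)\in\mathbb Z[q,q^{-1}]$ for $p\ge0$.
   Context: Quantum group: let $h$ be an indeterminate, $v=\exp(h/2)$, $q=v^2=\exp h$ in $\mathbb Q[[h]]$; $[i]=(v^i-v^{-i})/(v-v^{-1})$, $[n]!=[n]\cdots[1]$. $U_h=U_h(sl_2)$ is the $h$-adically complete $\mathbb Q[[h]]$-algebra topologically generated by $H,E,F$ with $HE-EH=2E$, $HF-FH=-2F$, $EF-FE=(K-K^{-1})/(v-v^{-1})$, $K=v^H=\exp(hH/2)$, and Hopf structure $\Delta(H)=H\otimes1+1\otimes H$, $\Delta(E)=E\otimes1+K\otimes E$, $\Delta(F)=F\otimes K^{-1}+1\otimes F$, $S(H)=-H$, $S(E)=-K^{-1}E$, $S(F)=-FK$, $\epsilon(H)=\epsilon(E)=\epsilon(F)=0$. Universal $R$-matrix $R=\sum\alpha\otimes\beta=\exp(\frac h4H\otimes H)\sum_{n\ge0}v^{n(n-1)/2}\frac{(v-v^{-1})^n}{[n]!}F^n\otimes E^n$, $R^{-1}=\sum\bar\alpha\otimes\bar\beta$, grouplike element $\kappa=K^{-1}$. Bottom knot: a $0$-framed arc $T$ in a cube with both endpoints on a line in the bottom, oriented from the right endpoint to the left endpoint (a 1-component bottom tangle). Its framing is that of its closure, the knot obtained by joining the endpoints by a simple $\cup$-shaped arc below the cube. Universal invariant $J_T\in U_h$: take a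 blackboard-framed diagram of $T$ made of vertical lines, crossings, local minima and maxima. At a crossing that is positive when both strings are oriented downward, put $S'(\alpha)$ on the string joining upper left to lower right and $S'(\beta)$ on the other string; at a crossing of the opposite type put $S'(\bar\alpha)$ on the string joining upper right to lower left and $S'(\bar\beta)$ on the other; for each string $S'=\mathrm{id}$ if it is oriented downward and $S'=S$ if upward. On a local minimum oriented from left to right put $\kappa$; on a local maximum oriented from left to right put $\kappa^{-1}$; on other minima/maxima put $1$. $J_T$ is the (sum of) product of the elements met along $T$ in the direction of its orientation, written from right to left. Central elements: $C=(v-v^{-1})^2FE+vK+v^{-1}K^{-1}$, which is central in $U_h$, and $\sigma_p=\prod_{i=1}^p(C^2-(q^i+2+q^{-i}))$ for $p\ge0$. The infinite sum is an $h$-adically convergent sum in $U_h$. *)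

(* Defs.v *)
From HB Require Import structures.
From mathcomp Require Import all_boot all_algebra.
From mathcomp Require Import boolp.
From mathcomp Require Import finmap monalg.

Set Implicit Arguments.
Unset Strict Implicit.
Unset Printing Implicit Defensive.

Import GRing.Theory Num.Theory.
Local Open Scope ring_scope.
Local Open Scope quotient_scope.

Record fps (A : Type) := Fps { fps_coef :> nat -> A }.

Notation "{ 'fps' A }" := (fps A) (at level 0, format "{ 'fps'  A }").

HB.instance Definition _ (A : Type) := gen_eqMixin {fps A}.
HB.instance Definition _ (A : Type) := gen_choiceMixin {fps A}.

Lemma fpsP (A : Type) (x y : {fps A}) : x =1 y -> x = y.
Proof. by case: x y => [x] [y] /= /funext ->. Qed.

Section FpsZmod.
Variable A : zmodType.
Implicit Types x y : {fps A}.

Definition fps_zero : {fps A} := Fps (fun=> 0).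
Definition fps_opp x := Fps (fun n => - x n).
Definition fps_add x y := Fps (fun n => x n + y n).

Fact fps_addA : associative fps_add.
Proof. by move=> x y z; apply: fpsP => n /=; rewrite addrA. Qed.
Fact fps_addC : commutative fps_add.
Proof. by move=> x y; apply: fpsP => n /=; rewrite addrC. Qed.
Fact fps_add0 : left_id fps_zero fps_add.
Proof. by move=> x; apply: fpsP => n /=; rewrite add0r. Qed.
Fact fps_addN : left_inverse fps_zero fps_opp fps_add.
Proof. by move=> x; apply: fpsP => n /=; rewrite addNr. Qed.

HB.instance Definition _ :=
  GRing.isZmodule.Build {fps A} fps_addA fps_addC fps_add0 fps_addN.

Lemma fpsE0 n : (0 : {fps A}) n = 0. Proof. by []. Qed.
Lemma fpsED x y n : (x + y) n = x n + y n. Proof. by []. Qed.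
Lemma fpsEN x n : (- x) n = - x n. Proof. by []. Qed.

(* The h-adic sum of the f n; only meaningful when h^n divides f n. *)
Definition fps_sum (f : nat -> {fps A}) : {fps A} :=
  Fps (fun k => \sum_(n < k.+1) f n k).
End FpsZmod.

Section FpsRing.
Variable A : nzRingType.
Implicit Types x y z : {fps A}.

Definition fps_const (a : A) : {fps A} := Fps (fun n => if n is 0 then a else 0).
Definition fps_mul x y : {fps A} :=
  Fps (fun n => \sum_(i < n.+1) x i * y (n - i)%N).

Let trunc n x : {poly A} := \poly_(i < n) x i.

Let coef_truncM n k x y :
  (k < n)%N -> (trunc n x * trunc n y)`_k = fps_mul x y k.
Proof.
move=> kn; rewrite coefM; apply: eq_bigr => i _; rewrite !coef_poly.
by rewrite (leq_ltn_trans _ kn) 1?(leq_ltn_trans _ kn) ?leq_subr // -ltnS.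
Qed.

Fact fps_mulA : associative fps_mul.
Proof.
move=> x y z; apply: fpsP => k; rewrite -!(@coef_truncM k.+1) //.
have -> : (trunc k.+1 x * trunc k.+1 (fps_mul y z))`_k =
    (trunc k.+1 x * (trunc k.+1 y * trunc k.+1 z))`_k.
  rewrite !coefM; apply: eq_bigr => i _; congr (_ * _).
  by rewrite [LHS]coef_poly ltnS leq_subr coef_truncM // ltnS leq_subr.
rewrite mulrA !coefM; apply: eq_bigr => i _; congr (_ * _).
by rewrite [RHS]coef_poly ltn_ord coef_truncM.
Qed.

Fact fps_mul1 : left_id (fps_const 1) fps_mul.
Proof.
move=> x; apply: fpsP => n /=; rewrite big_ord_recl /= mul1r subn0.
by rewrite big1 ?addr0 // => i _; rewrite mul0r.
Qed.

Fact fps_mulr1 : right_id (fps_const 1) fps_mul.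
Proof.
move=> x; apply: fpsP => n /=; rewrite big_ord_recr /= subnn mulr1.
by rewrite big1 ?add0r // => i _; rewrite -subnSK // mulr0.
Qed.

Fact fps_mulDl : left_distributive fps_mul +%R.
Proof.
move=> x y z; apply: fpsP => n; rewrite fpsED /= -big_split /=.
by apply: eq_bigr => i _; rewrite mulrDl.
Qed.

Fact fps_mulDr : right_distributive fps_mul +%R.
Proof.
move=> x y z; apply: fpsP => n; rewrite fpsED /= -big_split /=.
by apply: eq_bigr => i _; rewrite mulrDr.
Qed.

Fact fps_one_neq0 : fps_const 1 != 0.
Proof. by apply/eqP => /(congr1 (fun x : {fps A} => x 0%N)) /eqP; rewrite /= oner_eq0. Qed.

HB.instance Definition _ := GRing.Zmodule_isNzRing.Build {fps A}
  fps_mulA fps_mul1 fps_mulr1 fps_mulDl fps_mulDr fps_one_neq0.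

Lemma fpsE1 n : (1 : {fps A}) n = (n == 0%N)%:R. Proof. by case: n. Qed.
Lemma fpsEM x y n : (x * y) n = \sum_(i < n.+1) x i * y (n - i)%N.
Proof. by []. Qed.

Definition fps_h : {fps A} := Fps (fun n => (n == 1%N)%:R).

Definition fps_unit : {pred {fps A}} :=
  fun x => `[< exists y, y * x = 1 /\ x * y = 1 >].
Definition fps_inv x : {fps A} :=
  if pselect (exists y, y * x = 1 /\ x * y = 1) is left ex
  then projT1 (cid ex) else x.

Fact fps_mulVr : {in fps_unit, left_inverse 1 fps_inv *%R}.
Proof.
by move=> x /asboolP ex; rewrite /fps_inv; case: pselect => // ?; case: cid => ? [].
Qed.
Fact fps_mulrV : {in fps_unit, right_inverse 1 fps_inv *%R}.
Proof.
by move=> x /asboolP ex; rewrite /fps_inv; case: pselect => // ?; case: cid => ? [].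
Qed.
Fact fps_unitP x y : y * x = 1 /\ x * y = 1 -> x \in fps_unit.
Proof. by move=> yx; apply/asboolP; exists y. Qed.
Fact fps_inv_out : {in [predC fps_unit], fps_inv =1 id}.
Proof.
by move=> x /asboolP nex; rewrite /fps_inv; case: pselect => // ex; case: nex.
Qed.

HB.instance Definition _ := GRing.NzRing_hasMulInverse.Build {fps A}
  fps_mulVr fps_mulrV fps_unitP fps_inv_out.
End FpsRing.

Arguments fps_h {A}.

Section FpsComRing.
Variable A : comNzRingType.

Fact fps_mulC : @commutative {fps A} _ *%R.
Proof.
move=> x y; apply: fpsP => n /=; rewrite [LHS](reindex_inj rev_ord_inj) /=.
by apply: eq_bigr => i _; rewrite subSS mulrC subKn // -ltnS.
Qed.

HB.instance Definition _ := GRing.PzRing_hasCommutativeMul.Build {fps A} fps_mulC.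
End FpsComRing.

Section FpsUnits.
Variable A : nzRingType.
Implicit Types (x u : {fps A}) (a b : A).

Lemma fps_coef0M x y : (x * y) 0%N = x 0%N * y 0%N.
Proof. by rewrite fpsEM big_ord1. Qed.

Lemma fps_expr_lt u n k : u 0%N = 0 -> (k < n)%N -> (u ^+ n) k = 0.
Proof.
move=> u0; elim: n k => // n IH k; rewrite ltnS => kn.
rewrite exprS fpsEM big_ord_recl u0 mul0r add0r big1 // => i _.
by rewrite IH ?mulr0 // lift0 (leq_trans _ kn) // ltn_subrL (leq_ltn_trans _ (ltn_ord i)).
Qed.

Lemma fps_unit1 x : x 0%N = 1 -> x \is a GRing.unit.
Proof.
move=> x0; pose u := 1 - x; have u0 : u 0%N = 0 by rewrite fpsED fpsEN x0 subrr.
pose y := fps_sum (fun n => u ^+ n); have xE : x = 1 - u by rewrite subKr.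
have yE N k : (k < N)%N -> y k = (\sum_(n < N) u ^+ n) k.
  move=> kN; have -> : (\sum_(n < N) u ^+ n) k = \sum_(n < N) (u ^+ n) k.
    by elim/big_rec2: _ => // i a b _ <-.
  rewrite -(subnKC kN) big_split_ord /= [X in _ = _ + X]big1 ?addr0 //.
  by move=> i _; rewrite fps_expr_lt // ltn_addr.
have one_k N k : (k < N)%N -> (1 - u ^+ N) k = (1 : {fps A}) k.
  by move=> kN; rewrite fpsED fpsEN fps_expr_lt // oppr0 addr0.
apply/asboolP; exists y; split; apply: fpsP => k.
  rewrite -(one_k k.+1) // -opprB subrX1 -mulNr opprB -xE.
  have -> : x * \sum_(i < k.+1) u ^+ i = (\sum_(i < k.+1) u ^+ i) * x.
    rewrite mulr_sumr mulr_suml; apply: eq_bigr => i _.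
    by rewrite xE mulrBl mulrBr mul1r mulr1 -exprS -exprSr.
  by rewrite !fpsEM; apply: eq_bigr => i _; rewrite (yE k.+1).
rewrite -(one_k k.+1) // -opprB subrX1 -mulNr opprB -xE !fpsEM.
by apply: eq_bigr => i _; rewrite (yE k.+1) // ltnS leq_subr.
Qed.
End FpsUnits.

Section FpsLalg.
Variables (R : comNzRingType) (A : lalgType R).

Definition fps_scale (s : {fps R}) (x : {fps A}) : {fps A} :=
  Fps (fun n => \sum_(i < n.+1) s i *: x (n - i)%N).

Let emb (s : {fps R}) : {fps A} := Fps (fun n => (s n)%:A).

Let scaleE s x : fps_scale s x = emb s * x.
Proof. by apply: fpsP => n; apply: eq_bigr => i _; rewrite /= mulr_algl. Qed.

Let embM s t : emb (s * t) = emb s * emb t.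
Proof.
apply: fpsP => n; rewrite /= scaler_suml; apply: eq_bigr => i _.
by rewrite mulr_algl scalerA.
Qed.

Fact fps_scaleA s t x : fps_scale s (fps_scale t x) = fps_scale (s * t) x.
Proof. by rewrite !scaleE embM mulrA. Qed.
Fact fps_scale1 : left_id 1 fps_scale.
Proof.
move=> x; rewrite scaleE [emb 1](_ : _ = 1) ?mul1r //.
by apply: fpsP => -[|n]; [apply: scale1r|apply: scale0r].
Qed.
Fact fps_scaleDr : right_distributive fps_scale +%R.
Proof. by move=> s x y; rewrite !scaleE mulrDr. Qed.
Fact fps_scaleDl x : {morph fps_scale^~ x : s t / s + t}.
Proof.
move=> s t; rewrite !scaleE -mulrDl; congr (_ * _).
by apply: fpsP => n; apply: scalerDl.
Qed.
HB.instance Definition _ := GRing.Zmodule_isLmodule.Build {fps R} {fps A}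
  fps_scaleA fps_scale1 fps_scaleDr fps_scaleDl.

Fact fps_scaleAl s (x y : {fps A}) : s *: (x * y) = (s *: x) * y.
Proof. by rewrite ![_ *: _]scaleE mulrA. Qed.
HB.instance Definition _ := GRing.Lmodule_isLalgebra.Build {fps R} {fps A}
  fps_scaleAl.

Lemma fpsEZ s (x : {fps A}) n : (s *: x) n = \sum_(i < n.+1) s i *: x (n - i)%N.
Proof. by []. Qed.
End FpsLalg.

Section FpsAlg.
Variables (R : comNzRingType) (A : algType R).

Fact fps_scaleAr (s : {fps R}) (x y : {fps A}) : s *: (x * y) = x * (s *: y).
Proof.
have coef_in n : (s%:A : {fps A}) n = (s n)%:A.
  rewrite fpsEZ big_ord_recr /= subnn big1 ?add0r // => i _.
  by rewrite -subnSK // scaler0.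
have sC : s%:A * x = x * s%:A.
  apply: fpsP => n; rewrite !fpsEM [RHS](reindex_inj rev_ord_inj).
  apply: eq_bigr => i _; have le_in : (i <= n)%N by rewrite -ltnS.
  have -> : (rev_ord i : nat) = (n - i)%N by rewrite /= subSS.
  by rewrite subKn // !coef_in mulr_algl mulr_algr.
by rewrite -[s *: (x * y)]mulr_algl mulrA sC -mulrA mulr_algl.
Qed.
HB.instance Definition _ := GRing.Lalgebra_isAlgebra.Build {fps R} {fps A}
  fps_scaleAr.
End FpsAlg.

(* An alias of {malg rat[M]}, which for a noncommutative M is declared as a
   left algebra only; here it becomes an algebra. *)
Definition malgQ (M : monomType) := {malg rat[M]}.
HB.instance Definition _ (M : monomType) := GRing.Lalgebra.on (malgQ M).

Fact malgQ_scaleAr (M : monomType) c (x y : malgQ M) : c *: (x * y) = x * (c *: y).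
Proof.
have cC (z : {malg rat[M]}) : c%:MP * z = z * c%:MP.
  rewrite malgM_def fgmulUg malgM_def fgmulgU; apply: eq_bigr => k _.
  by rewrite mul1m mulm1 mulrC.
have E (z t : {malg rat[M]}) : c *: (z * t) = z * (c *: t).
  by rewrite -!mul_malgC mulrA cC mulrA.
exact: E.
Qed.
HB.instance Definition _ (M : monomType) :=
  GRing.Lalgebra_isAlgebra.Build rat (malgQ M) (@malgQ_scaleAr M).

Definition hlim (R : comNzRingType) (V : lmodType {fps R}) (u : nat -> V) (x : V) :=
  forall k, exists N, forall n, (N <= n)%N -> exists y, u n - x = fps_h ^+ k *: y.

(* [presented rel] is the quotient of A[[h]] by the h-adic closure of the
   two-sided ideal generated by rel; this closure is needed for the quotient
   to be h-adically separated (hence complete). *)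
Section Presented.
Variables (R : comNzRingType) (A : algType R) (rel : {fps A} -> Prop).
Implicit Types x y z : {fps A}.

Inductive gen_ideal : {fps A} -> Prop :=
| gen_ideal_rel x of rel x : gen_ideal x
| gen_ideal0 : gen_ideal 0
| gen_idealB x y of gen_ideal x & gen_ideal y : gen_ideal (x - y)
| gen_idealMl a x of gen_ideal x : gen_ideal (a * x)
| gen_idealMr a x of gen_ideal x : gen_ideal (x * a).

Definition closed_ideal : {pred {fps A}} :=
  fun x => `[< forall n, exists y z, gen_ideal y /\ x = y + fps_h ^+ n *: z >].

Fact closed_ideal_zmod : zmod_closed closed_ideal.
Proof.
split=> [|x y /asboolP xI /asboolP yI]; apply/asboolP => n.
  by exists 0, 0; split; [exact: gen_ideal0|rewrite scaler0 addr0].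
have [[x1 [x2 [x1I ->]]] [y1 [y2 [y1I ->]]]] := (xI n, yI n).
exists (x1 - y1), (x2 - y2); split; first exact: gen_idealB.
by rewrite scalerBr opprD addrACA.
Qed.
HB.instance Definition _ := GRing.isZmodClosed.Build {fps A} closed_ideal
  closed_ideal_zmod.

Lemma closed_idealMl a x : x \in closed_ideal -> a * x \in closed_ideal.
Proof.
move=> /asboolP xI; apply/asboolP => n; have [y [z [yI ->]]] := xI n.
exists (a * y), (a * z); split; first exact: gen_idealMl.
by rewrite mulrDr scalerAr.
Qed.

Lemma closed_idealMr a x : x \in closed_ideal -> x * a \in closed_ideal.
Proof.
move=> /asboolP xI; apply/asboolP => n; have [y [z [yI ->]]] := xI n.
exists (y * a), (z * a); split; first exact: gen_idealMr.
by rewrite mulrDl scalerAl.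
Qed.

Definition presented := Quotient.quot (closed_ideal : zmodClosed {fps A}).
HB.instance Definition _ := GRing.Zmodule.on presented.
HB.instance Definition _ := EqQuotient.on presented.

Definition class (x : {fps A}) : presented := \pi_presented x.

Lemma class_eq x y : (class x == class y) = (x - y \in closed_ideal).
Proof. by rewrite Quotient.idealrBE. Qed.

Lemma classP x y : x - y \in closed_ideal -> class x = class y.
Proof. by rewrite -class_eq => /eqP. Qed.

Lemma class_repr (a : presented) : class (repr a) = a.
Proof. exact: reprK. Qed.

Lemma repr_class x : repr (class x) - x \in closed_ideal.
Proof. by rewrite -class_eq class_repr. Qed.

Lemma class_surj (a : presented) : exists x, a = class x.
Proof. by exists (repr a); rewrite class_repr. Qed.

Fact class_zmod : zmod_morphism class.
Proof. exact: raddfB. Qed.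
HB.instance Definition _ := GRing.isZmodMorphism.Build _ _ class class_zmod.

Definition presented_mul (a b : presented) := class (repr a * repr b).
Definition presented_scale (s : {fps R}) (a : presented) := class (s *: repr a).

Lemma class_mul x y : presented_mul (class x) (class y) = class (x * y).
Proof.
apply: classP; rewrite -[_ * _](subrK (x * repr (class y))) -mulrBl -addrA -mulrBr.
apply: rpredD; [exact/closed_idealMr/repr_class|exact/closed_idealMl/repr_class].
Qed.

Lemma class_scale s x : presented_scale s (class x) = class (s *: x).
Proof.
by apply: classP; rewrite -scalerBr -mulr_algl closed_idealMl ?repr_class.
Qed.

Lemma class_ind (P : presented -> Prop) : (forall x, P (class x)) -> forall a, P a.
Proof. by move=> Pclass a; rewrite -(class_repr a). Qed.

Fact presented_mulA : associative presented_mul.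
Proof.
elim/class_ind=> x; elim/class_ind=> y; elim/class_ind=> z.
by rewrite !class_mul mulrA.
Qed.
Fact presented_mul1 : left_id (class 1) presented_mul.
Proof. by elim/class_ind=> x; rewrite class_mul mul1r. Qed.
Fact presented_mulr1 : right_id (class 1) presented_mul.
Proof. by elim/class_ind=> x; rewrite class_mul mulr1. Qed.
Fact presented_mulDl : left_distributive presented_mul +%R.
Proof.
elim/class_ind=> x; elim/class_ind=> y; elim/class_ind=> z.
by rewrite -raddfD !class_mul mulrDl raddfD.
Qed.
Fact presented_mulDr : right_distributive presented_mul +%R.
Proof.
elim/class_ind=> x; elim/class_ind=> y; elim/class_ind=> z.
by rewrite -raddfD !class_mul mulrDr raddfD.
Qed.
HB.instance Definition _ := GRing.Zmodule_isPzRing.Build presented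
  presented_mulA presented_mul1 presented_mulr1 presented_mulDl presented_mulDr.

Fact class_monoid : monoid_morphism class.
Proof. by split=> // x y; rewrite -class_mul. Qed.
HB.instance Definition _ := GRing.isMonoidMorphism.Build _ _ class class_monoid.

Fact presented_scaleA s t a :
  presented_scale s (presented_scale t a) = presented_scale (s * t) a.
Proof. by elim/class_ind: a => x; rewrite !class_scale scalerA. Qed.
Fact presented_scale1 : left_id 1 presented_scale.
Proof. by elim/class_ind=> x; rewrite class_scale scale1r. Qed.
Fact presented_scaleDr : right_distributive presented_scale +%R.
Proof.
move=> s; elim/class_ind=> x; elim/class_ind=> y.
by rewrite -raddfD !class_scale scalerDr raddfD.
Qed.
Fact presented_scaleDl a : {morph presented_scale^~ a : s t / s + t}.
Proof.
by elim/class_ind: a => x s t; rewrite !class_scale scalerDl raddfD.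
Qed.
HB.instance Definition _ := GRing.Zmodule_isLmodule.Build {fps R} presented
  presented_scaleA presented_scale1 presented_scaleDr presented_scaleDl.

Fact class_scalable : scalable class.
Proof. by move=> s x; rewrite -class_scale. Qed.
HB.instance Definition _ := GRing.isScalable.Build _ _ _ _ class class_scalable.

Lemma classZ s x : class (s *: x) = s *: class x.
Proof. exact: linearZ. Qed.

Fact presented_scaleAl s (a b : presented) : s *: (a * b) = (s *: a) * b.
Proof.
elim/class_ind: a => x; elim/class_ind: b => y.
by rewrite -classZ -!rmorphM -classZ -scalerAl.
Qed.
Fact presented_scaleAr s (a b : presented) : s *: (a * b) = a * (s *: b).
Proof.
elim/class_ind: a => x; elim/class_ind: b => y.
by rewrite -classZ -!rmorphM -classZ -scalerAr.
Qed.

Lemma presented_neq0 (B : nzRingType) (f : {rmorphism A -> B}) :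
  (forall x, rel x -> f (x 0%N) = 0) -> (1 : presented) != 0.
Proof.
move=> f_rel; have f_ideal x : gen_ideal x -> f (x 0%N) = 0.
  elim=> {x} [x /f_rel -> //||x y _ x0 _ y0|a x _ x0|a x _ x0].
  - exact: rmorph0.
  - by rewrite fpsED fpsEN rmorphB x0 y0 subr0.
  - by rewrite fps_coef0M rmorphM x0 mulr0.
  - by rewrite fps_coef0M rmorphM x0 mul0r.
rewrite -(rmorph1 class) -(rmorph0 class) class_eq subr0.
apply/asboolP => /(_ 1%N) [y [z [/f_ideal y0 /(congr1 (fun x : {fps A} => f (x 0%N)))]]].
rewrite fpsED rmorphD y0 add0r expr1 fpsEZ big_ord1 scale0r rmorph0 fpsE1.
by rewrite rmorph1 => /eqP; rewrite oner_eq0.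
Qed.
End Presented.

Definition fps_exp (A : nzRingType) (x : {fps A}) : {fps A} :=
  fps_sum (fun n => (n`!%:R)^-1 * x ^+ n).

(* The z with s z = x (0 if there is none), used when s is not invertible. *)
Definition exquot (T : pzRingType) (x s : T) : T :=
  if pselect (exists z, s * z = x) is left ex then projT1 (cid ex) else 0.

Notation Qh := {fps rat}.

Definition v : Qh := fps_exp (fps_h / 2%:R).
Definition q : Qh := v ^+ 2.
Definition qint (i : nat) : Qh := exquot (v ^+ i - v ^- i) (v - v^-1).
Definition qfact (n : nat) : Qh := \prod_(1 <= i < n.+1) qint i.

Inductive gen := GenH | GenE | GenF.

Definition gen_code (g : gen) : option bool :=
  match g with GenH => None | GenE => Some true | GenF => Some false end.
Definition gen_decode (c : option bool) : gen :=
  match c with None => GenH | Some true => GenE | Some false => GenF end.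
Fact gen_codeK : cancel gen_code gen_decode. Proof. by case. Qed.
HB.instance Definition _ := Equality.copy gen (can_type gen_codeK).
HB.instance Definition _ := Choice.copy gen (can_type gen_codeK).

Notation word := {fmonom gen}.

(* Q<H,E,F>[[h]], of which U_h is a quotient. *)
Notation free := {fps malgQ word}.

Definition letter (g : gen) : free := fps_const << fmu g >>.
Definition wH := letter GenH.
Definition wE := letter GenE.
Definition wF := letter GenF.
Definition wK : free := fps_exp ((fps_h / 2%:R : Qh) *: wH).

Inductive sl2_rel : free -> Prop :=
| rel_HE : sl2_rel (wH * wE - wE * wH - wE *+ 2)
| rel_HF : sl2_rel (wH * wF - wF * wH + wF *+ 2)
| rel_EF : sl2_rel (wE * wF - wF * wE - exquot (wK - wK^-1) (v - v^-1)%:A).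

Definition Uh := presented sl2_rel.
HB.instance Definition _ := GRing.PzRing.on Uh.
HB.instance Definition _ := GRing.Lmodule.on Uh.

Lemma fps_exp_coef0 (A : nzRingType) (x : {fps A}) : fps_exp x 0%N = 1.
Proof. by rewrite [LHS]big_ord1 fact0 expr0 invr1 mul1r. Qed.

Lemma sum2 (A : zmodType) (F : nat -> A) : \sum_(i < 2) F i = F 0%N + F 1%N.
Proof. by rewrite big_ord_recl big_ord1. Qed.

Lemma fps_exp_coef1 (A : nzRingType) (x : {fps A}) : fps_exp x 1%N = x 1%N.
Proof.
rewrite [LHS](sum2 (fun n => ((n`!%:R)^-1 * x ^+ n) 1%N)).
by rewrite fact0 expr0 expr1 invr1 !mul1r fpsE1 add0r.
Qed.

Lemma v_unit : v \is a GRing.unit.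
Proof. exact/fps_unit1/fps_exp_coef0. Qed.

Lemma v_coef1 : v 1%N != 0.
Proof.
have two_unit : (2%:R : Qh) \is a GRing.unit.
  apply/unitrP; exists (fps_const 2%:R^-1).
  suff E : (2%:R : Qh) * fps_const 2%:R^-1 = 1 by rewrite [_ * 2%:R]mulrC E.
  by rewrite mulr_natl; apply: fpsP => -[|n].
rewrite fps_exp_coef1; apply/eqP => h1.
have /(congr1 (fun x : Qh => x 1%N)) := divrK two_unit (fps_h : Qh).
by rewrite mulr_natr mulr2n fpsED h1.
Qed.

Lemma inv_coef1 (A : nzRingType) (x : {fps A}) :
  x 0%N = 1 -> (x^-1) 0%N = 1 /\ (x^-1) 1%N = - x 1%N.
Proof.
move=> x0; have xV := divrr (fps_unit1 x0).
have V0 : (x^-1) 0%N = 1.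
  by have := congr1 (fun y : {fps A} => y 0%N) xV; rewrite fps_coef0M x0 mul1r.
split=> //; have := congr1 (fun y : {fps A} => y 1%N) xV.
rewrite fpsEM (sum2 (fun i => x i * x^-1 (1 - i)%N)) x0 mul1r V0 mulr1 => /eqP.
by rewrite addr_eq0 => /eqP.
Qed.

Lemma v_sub_coef0 : (v - v^-1) 0%N = 0.
Proof.
have [V0 _] := inv_coef1 (fps_exp_coef0 (fps_h / 2%:R : Qh)).
by rewrite fpsED fpsEN V0 fps_exp_coef0 subrr.
Qed.

Lemma v_sub_coef1 : (v - v^-1) 1%N != 0.
Proof.
have [_ V1] := inv_coef1 (fps_exp_coef0 (fps_h / 2%:R : Qh)).
by rewrite fpsED fpsEN V1 opprK -mulr2n mulrn_eq0 v_coef1.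
Qed.

Lemma fps_h_mul (A : nzRingType) (x : {fps A}) :
  x 0%N = 0 -> x = fps_h * Fps (fun n => x n.+1).
Proof.
move=> x0; apply: fpsP => -[|n]; first by rewrite fpsEM big_ord1 mul0r.
rewrite fpsEM 2!big_ord_recl mul0r add0r /= mul1r subn1 big1 ?addr0 //.
by move=> i _; rewrite mul0r.
Qed.

(* The quotients by v - v^-1 used here are genuine. *)
Lemma exquot_v (A : algType rat) (x : {fps A}) :
  x 0%N = 0 -> (v - v^-1)%:A * exquot x (v - v^-1)%:A = x.
Proof.
move=> x0; rewrite /exquot; case: pselect => [ex|]; first by case: cid.
case; pose u : Qh := Fps (fun n => (v - v^-1) n.+1).
have uE : v - v^-1 = fps_h * u by apply: fps_h_mul v_sub_coef0.
have u_unit : u \is a GRing.unit.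
  have c_unit : fps_const (u 0%N)^-1 * u \is a GRing.unit.
    by apply: fps_unit1; rewrite fps_coef0M mulVf ?v_sub_coef1.
  by move: c_unit; rewrite unitrM => /andP[].
have hE (y : {fps A}) : (fps_h : Qh) *: y = fps_h * y.
  by apply: fpsP => n; rewrite fpsEZ fpsEM; apply: eq_bigr => i _; rewrite scaler_nat mulr_natl.
exists (u^-1 *: Fps (fun n => x n.+1)).
by rewrite mulr_algl scalerA uE mulrK // hE -fps_h_mul.
Qed.

Lemma qintE i : (v - v^-1) * qint i = v ^+ i - v ^- i.
Proof.
rewrite /qint /exquot; case: pselect => [ex|]; first by case: cid.
by case; rewrite -exprVn subrXX; eexists.
Qed.

Section Counit.
Variables (A : algType rat) (f : {rmorphism A -> rat}).
Hypothesis fZ : forall c x, f (c *: x) = c * f x.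
Implicit Types x y z : {fps A}.

Lemma counit_scale (s : Qh) x n : (forall k, f (x k) = 0) -> f ((s *: x) n) = 0.
Proof.
move=> x0; rewrite fpsEZ raddf_sum big1 // => i _.
by apply: (etrans (fZ _ _)); rewrite x0 mulr0.
Qed.

Lemma counit_rel x y z : f (x 0%N) = 0 -> f (y 0%N) = 0 -> f (z 0%N) = 0 ->
  f ((x * y - y * x - z) 0%N) = 0.
Proof.
move=> x0 y0 z0; rewrite !fpsED !fpsEN !fps_coef0M !raddfB /= !rmorphM x0 y0 z0.
by rewrite !mul0r !subr0.
Qed.

Lemma counit_opp x : f (x 0%N) = 0 -> f ((- x) 0%N) = 0.
Proof. by move=> x0; rewrite fpsEN rmorphN x0 oppr0. Qed.

Lemma counit_double x : f (x 0%N) = 0 -> f ((x *+ 2) 0%N) = 0.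
Proof. by move=> x0; rewrite mulr2n fpsED rmorphD x0 addr0. Qed.

Lemma counit_quot x : x 0%N = 1 -> f (x 1%N) = 0 ->
  f (exquot (x - x^-1) (v - v^-1)%:A 0%N) = 0.
Proof.
move=> x0 x1; rewrite /exquot; case: pselect => [ex|_]; last exact: rmorph0.
case: cid => z /= /(congr1 (fun y : {fps A} => f (y 1%N))).
have [_ KV1] := inv_coef1 x0; have [V0 V1] := inv_coef1 (fps_exp_coef0 (fps_h / 2%:R : Qh)).
rewrite [in RHS]fpsED fpsEN KV1 opprK rmorphD x1 addr0 mulr_algl fpsEZ.
rewrite (sum2 (fun i => (v - v^-1) i *: z (1 - i)%N)).
rewrite !fpsED !fpsEN V0 V1 fps_exp_coef0 subrr scale0r add0r opprK.
rewrite fZ => /eqP; rewrite mulf_eq0 -mulr2n mulrn_eq0 /=.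
by rewrite (negPf v_coef1) => /eqP.
Qed.
End Counit.

Fact Uh_neq0 : (1 : Uh) != 0.
Proof.
have [f fZ f0] : exists2 f : {rmorphism malgQ word -> rat},
    (forall c x, f (c *: x) = c * f x) & forall g n, f (letter g n) = 0.
  exists [the {rmorphism malgQ word -> rat} of mcoeff (mone : word)].
    by move=> c x; apply: mcoeffZ.
  move=> g [|n]; last exact: raddf0.
  by rewrite /= mcoeffU; case: eqP => // /(congr1 (@fdeg _)); rewrite fdegU fdeg1.
apply: (presented_neq0 (f := f)) => x [].
- by apply: counit_rel; rewrite ?f0 //; apply: counit_double; apply: f0.
- rewrite -[X in _ + X]opprK; apply: counit_rel; rewrite ?f0 //.
  by apply: counit_opp; apply: counit_double; apply: f0.
- apply: counit_rel; rewrite ?f0 //; apply: counit_quot => //.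
    exact: fps_exp_coef0.
  by rewrite fps_exp_coef1; apply: counit_scale => // k; apply: f0.
Qed.

HB.instance Definition _ := GRing.PzSemiRing_isNonZero.Build Uh Uh_neq0.
HB.instance Definition _ := GRing.Lmodule_isLalgebra.Build Qh Uh
  (@presented_scaleAl _ _ sl2_rel).
HB.instance Definition _ := GRing.Lalgebra_isAlgebra.Build Qh Uh
  (@presented_scaleAr _ _ sl2_rel).

Definition toUh : free -> Uh := class sl2_rel.
Definition UE : Uh := toUh wE.
Definition UF : Uh := toUh wF.
Definition UK : Uh := toUh wK.
Definition UKinv : Uh := toUh wK^-1.

Definition casimir : Uh :=
  (v - v^-1) ^+ 2 *: (UF * UE) + v *: UK + v^-1 *: UKinv.

Definition sigma (p : nat) : Uh :=
  \prod_(1 <= i < p.+1) (casimir ^+ 2 - (q ^+ i + 2%:R + q ^- i)%:A).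

(* The continuous Q[[h]]-linear extension of a map defined on monomials. *)
Definition fps_lin (M : monomType) (B : lmodType rat) (phi : M -> {fps B})
    (x : {fps malgQ M}) : {fps B} :=
  Fps (fun k => \sum_(d < k.+1) \sum_(m <- msupp (x d))
                  (x d)@_m *: phi m (k - d)%N).

Definition monomial (w : word) : free := fps_const << w >>.

(* The antipode of U_h, lifted to a continuous anti-endomorphism of free. *)
Definition antipode_gen (g : gen) : free :=
  match g with
  | GenH => - wH
  | GenE => - (wK^-1 * wE)
  | GenF => - (wF * wK)
  end.
Definition antipode : free -> free :=
  fps_lin (fun w : word => \prod_(g <- rev (w : seq gen)) antipode_gen g).

Section ProdMonom.
Variables M N : monomType.
Definition pair_mul (a b : M * N) : M * N := (mmul a.1 b.1, mmul a.2 b.2).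
Fact pair_mulA : associative pair_mul.
Proof. by move=> a b c; rewrite /pair_mul /= !mulmA. Qed.
Fact pair_mul1 : left_id (mone, mone) pair_mul.
Proof. by case=> a b; rewrite /pair_mul /= !mul1m. Qed.
Fact pair_mulr1 : right_id (mone, mone) pair_mul.
Proof. by case=> a b; rewrite /pair_mul /= !mulm1. Qed.
Fact pair_unit a b : pair_mul a b = (mone, mone) ->
  a = (mone, mone) /\ b = (mone, mone).
Proof.
by case: a b => [a a'] [b b'] [/unitm[-> ->] /unitm[-> ->]].
Qed.
HB.instance Definition _ := Choice_isMonomialDef.Build (M * N)%type
  pair_mulA pair_mul1 pair_mulr1 pair_unit.
End ProdMonom.

(* (Q<H,E,F> (x) Q<H,E,F>)[[h]], with basis the w (x) w' = (w, w'); it maps onto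
   the completed tensor square of U_h. *)
Notation free2 := {fps malgQ (word * word)%type}.

Definition tensor (w w' : word) : free2 := fps_const << (w, w') >>.

(* A lift of the universal R-matrix.  It is already invertible in free2 (see
   Rmat_unit), so that Rmat^-1 is a lift of the inverse of the R-matrix. *)
Definition Rmat : free2 :=
  fps_exp ((fps_h / 4%:R : Qh) *: tensor (fmu GenH) (fmu GenH)) *
  fps_sum (fun n =>
    (v ^+ (n * n.-1)./2 * ((v - v^-1) ^+ n / qfact n)) *:
      tensor (fmu GenF) (fmu GenE) ^+ n).

Lemma Rmat_unit : Rmat \is a GRing.unit.
Proof.
apply: fps_unit1; rewrite fps_coef0M fps_exp_coef0 mul1r [LHS]big_ord1.
by rewrite !expr0 mul1r /qfact big_nil divr1 scale1r.
Qed.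

(* A diagram is cut by horizontal lines into slices, listed from bottom to top.
   The slice (i, c) consists of the piece c with i vertical lines on its left
   and any number of vertical lines on its right.  CrossPos (resp. CrossNeg) is
   the crossing that is positive (resp. negative) when both strings are oriented
   downward, i.e., the string joining upper right to lower left passes over
   (resp. under) the other one. *)
Inductive piece := CrossPos | CrossNeg | LocalMin | LocalMax.
Notation diagram := (seq (nat * piece)).

Definition slice (T : diagram) (k : nat) : nat * piece := nth (0%N, LocalMax) T k.

(* Level l is the horizontal line below slice l; both endpoints are at level 0. *)
Definition width (T : diagram) (l : nat) : nat :=
  foldl (fun n s => match s.2 with
                    | LocalMin => n.+2
                    | LocalMax => n.-2
                    | _ => n
                    end) 2%N (take l T).

Definition slice_fits (n : nat) (s : nat * piece) : bool :=
  match s.2 with LocalMin => (s.1 <= n)%N | _ => (s.1.+2 <= n)%N end.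

Definition bottom_diagram (T : diagram) : Prop :=
  width T (size T) = 0%N /\
  forall k, (k < size T)%N -> slice_fits (width T k) (slice T k).

(* What an oriented string meets in a slice.  In AtCrossing k s d, k is the
   slice, s tells whether the string joins upper left to lower right (otherwise
   it joins upper right to lower left), and d whether it is oriented downward.
   In AtMin ltr and AtMax ltr, ltr tells whether it goes from left to right. *)
Inductive event :=
| AtCrossing of nat & bool & bool
| AtMin of bool
| AtMax of bool.

(* (l, j, d): at the j-th point (from the left) of level l, going down iff d. *)
Notation position := (nat * nat * bool)%type.

Definition go_up (k j : nat) (s : nat * piece) : option event * position :=
  let: (i, c) := s in
  match c with
  | CrossPos | CrossNeg =>
      if j == i then (Some (AtCrossing k false false), (k.+1, i.+1, false))
      else if j == i.+1 then (Some (AtCrossing k true false), (k.+1, i, false))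
      else (None, (k.+1, j, false))
  | LocalMin => (None, (k.+1, if (j < i)%N then j else j.+2, false))
  | LocalMax =>
      if j == i then (Some (AtMax true), (k, i.+1, true))
      else if j == i.+1 then (Some (AtMax false), (k, i, true))
      else (None, (k.+1, if (j < i)%N then j else j.-2, false))
  end.

Definition go_down (k j : nat) (s : nat * piece) : option event * position :=
  let: (i, c) := s in
  match c with
  | CrossPos | CrossNeg =>
      if j == i then (Some (AtCrossing k true true), (k, i.+1, true))
      else if j == i.+1 then (Some (AtCrossing k false true), (k, i, true))
      else (None, (k, j, true))
  | LocalMin =>
      if j == i then (Some (AtMin true), (k.+1, i.+1, false))
      else if j == i.+1 then (Some (AtMin false), (k.+1, i, false))
      else (None, (k, if (j < i)%N then j else j.-2, true))
  | LocalMax => (None, (k, if (j < i)%N then j else j.+2, true))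
  end.

Definition advance (T : diagram) (x : position) : option event * position :=
  match x with
  | (l, j, false) => go_up l j (slice T l)
  | (l.+1, j, true) => go_down l j (slice T l)
  | (0, j, true) => (None, x)
  end.

(* From the right endpoint, taking one step per point of the diagram. *)
Definition walk (T : diagram) : seq position :=
  traject (fun x => (advance T x).2) (0%N, 1%N, false)
          (\sum_(l < (size T).+1) width T l)%N.

Definition one_component (T : diagram) : Prop :=
  forall l j, (l <= size T)%N -> (j < width T l)%N ->
    (l, j) \in [seq x.1 | x <- walk T].

Definition events (T : diagram) : seq event :=
  pmap (fun x => (advance T x).1) (walk T).

(* Whether the given string of the crossing in slice k is oriented downward. *)
Definition downward (T : diagram) (k : nat) (s : bool) : bool :=
  has (fun e => if e is AtCrossing k' s' true then (k' == k) && (s' == s)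
                else false) (events T).

Definition crossing_sign (T : diagram) (k : nat) : int :=
  let e : int := if downward T k true == downward T k false then 1 else -1 in
  match (slice T k).2 with CrossPos => e | CrossNeg => - e | _ => 0 end.

(* The blackboard framing of the closure of T, i.e., its writhe: closing T by an
   arc below the diagram adds no crossing. *)
Definition framing (T : diagram) : int :=
  \sum_(k < size T) crossing_sign T k.

Definition bottom_knot (T : diagram) : Prop :=
  [/\ bottom_diagram T, one_component T & framing T = 0].

Definition is_crossing (T : diagram) (k : nat) : bool :=
  match (slice T k).2 with CrossPos | CrossNeg => true | _ => false end.

Definition crossing_tensor (T : diagram) (k : nat) : free2 :=
  match (slice T k).2 with CrossPos => Rmat | _ => Rmat^-1 end.

(* st k is the pair of words (alpha, beta) chosen at the crossing in slice k;
   alpha is put on the string joining upper left to lower right for R, and on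
   the string joining upper right to lower left for R^-1. *)
Definition bead (T : diagram) (st : nat -> word * word) (e : event) : free :=
  match e with
  | AtCrossing k s d =>
      let on_first := match (slice T k).2 with CrossPos => s | _ => ~~ s end in
      let x := monomial (if on_first then (st k).1 else (st k).2) in
      if d then x else antipode x
  | AtMin ltr => if ltr then wK^-1 else 1
  | AtMax ltr => if ltr then wK else 1
  end.

Definition bead_product (T : diagram) (st : nat -> word * word) : free :=
  \prod_(e <- rev (events T)) bead T st e.

(* Writing the tensor at each crossing of cs as the sum of its terms
   alpha (x) beta, this is the sum of the corresponding products of beads. *)
Fixpoint state_sum (T : diagram) (cs : seq nat) (st : nat -> word * word) : free :=
  match cs with
  | [::] => bead_product T st
  | k :: cs' =>
      fps_lin (fun w => state_sum T cs' (fun j => if j == k then w else st j))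
              (crossing_tensor T k)
  end.

(* The starting choice of words is irrelevant: every crossing is summed over. *)
Definition J (T : diagram) : Uh :=
  toUh (state_sum T [seq k <- iota 0 (size T) | is_crossing T k]
                  (fun=> (mone, mone))).

(* Membership in Z[q, q^-1], seen inside Q[[h]]. *)
Definition laurent_q (a : Qh) : Prop :=
  exists (P : {poly int}) (n : nat), a = q ^- n * (map_poly intr P).[q].

Definition hsum (u : nat -> Uh) (x : Uh) : Prop :=
  hlim (fun n => \sum_(p < n) u p) x.

(* Main.v *)
(* Let V_n be the representation of dimension n+1.  The V_n are jointly faithful on U_h, in the
   h-adic sense, and sigma_p acts on V_n by a scalar sig n p which is divisible by h^p and is zero
   iff p > n.  By moving K, resp. the iterated coproduct of E, through the diagram from the bottom
   to the top, one slice at a time, J_T is seen to commute with K and E on V_n; hence it acts by a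
   scalar c(n).  So an expansion of J_T amounts to c(n) = sum_{p <= n} a_p sig n p for all n, which
   determines the a_p in Q[[h]], and what has to be shown is a_p in Z[q,q^-1].

   Write R = D (sum_k theta_k F^k (x) E^k), with D the Cartan part.  The entry of J_T at the a-th
   basis vector of V_n is a sum, over the choices of an exponent k at every crossing, of weights
   which can be read off the labels of the basis vectors met along T.  A weight is the product of
   a sign, a power of v, a q-binomial and a factor (q^(n+1-g)-1) ... (q^(n-g+k)-1) for each crossing.
   The framing being zero, v^(n^2) disappears, and by a parity argument the weights are v^(rn)
   times Laurent polynomials in q^n over Z[q,q^-1], with r depending only on T; modulo
   (q)_N = (q-1) ... (q^N-1) only k < N matter.  So c extends to all integers n modulo each (q)_N.
   Now c(n) does not depend on a, and the sums for (n, a) = (-m-1, 0) and (m-1, m) agree term by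
   term, whence the symmetry c(-m-1) = c(m-1) modulo (q)_N.  The a_p are thus obtained by Newton
   interpolation at the points q^k, k in {0, ..., p-1} and {-2, ..., -p-1}, and the divided
   differences involved have no denominators since they can be computed modulo (q)_N for all N. *)

From HB Require Import structures.
From mathcomp Require Import all_boot all_order all_algebra.
From mathcomp Require Import boolp.
From mathcomp Require Import finmap monalg.
From mathcomp Require Import ring lra zify.
Require Import Defs.

Set Implicit Arguments.
Unset Strict Implicit.
Unset Printing Implicit Defensive.

Import Order.TTheory GRing.Theory Num.Theory.

(** * The walk along the diagram *)

(** The term-by-term agreement is a fact about Verma modules: the one of highest weight m-1
    contains, from label m on, a copy of the one of highest weight -m-1, and weights read off the
    labels do not see the difference. Label m lies just outside V_{m-1}, however, so the sum for
    (m-1, m) is not an entry of J_T. It is reached from n >= m, where the entries at e_0 and e_m are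
    both c(n): for Laurent polynomials in q^n, divisibility by (q)_N at all n >= m propagates down
    to n = m-1. Interpolation in q^n also requires v^(rn) to be a power of q^n, so r must be even;
    this is drawn from the same congruences, at first order in h. The points of interpolation are
    the zeros of the eigenvalue of sigma_p, so that the nodal polynomial is this eigenvalue up to a
    power of q. Denominators disappear because (q)_N is, for large N, a multiple of any given
    product of differences q^a - q^b with a <> b: a congruence modulo (q)_N survives division by all
    of them. *)

Lemma uniq_map_inj (S U : eqType) (f : S -> U) (s : seq S) :
  uniq (map f s) -> {in s &, injective f}.
Proof.
elim: s => //= a s IH /andP[fa us] x y.
rewrite !inE => /orP[/eqP->|xs] /orP[/eqP->|ys] fxy //.
- by rewrite fxy map_f in fa.
- by rewrite -fxy map_f in fa.
exact: IH us _ _ xs ys fxy.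
Qed.

Section Walk.
Variable T : diagram.

Definition next_position (x : position) : position := (advance T x).2.
Definition event_at (x : position) : option event := (advance T x).1.
Definition x0 : position := (0, 1, false).
Definition xl : position := (0, 0, true).
Definition npts : nat := \sum_(l < (size T).+1) width T l.
Definition valid (x : position) : bool := (x.1.1 <= size T) && (x.1.2 < width T x.1.1).
(* The last position (0, 0, true) of the walk is dropped: it is a fixed point of advance. *)
Definition walk_path : seq position := traject next_position x0 npts.-1.

Lemma walkE : walk T = traject next_position x0 npts. Proof. by []. Qed.

Lemma advU l j : advance T (l, j, false) = go_up l j (slice T l).
Proof. by case: l. Qed.

Lemma widthS l : l < size T -> width T l.+1 =
  match (slice T l).2 with LocalMin => (width T l).+2 | LocalMax => (width T l).-2
  | _ => width T l end.
Proof. by move=> lT; rewrite /width (take_nth (0, LocalMax)) // foldl_rcons. Qed.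

(** Indices of the lower end ([jl]) and of the upper end ([ju]) of string [s] at crossing [k];
    [pass] is the end at which the string is entered when run in direction [d]. *)
Definition jl (k : nat) (s : bool) := if s then (slice T k).1.+1 else (slice T k).1.
Definition ju (k : nat) (s : bool) := if s then (slice T k).1 else (slice T k).1.+1.
Definition pass (k : nat) (s d : bool) : position :=
  if d then (k.+1, ju k s, true) else (k, jl k s, false).

Lemma is_crossing_lt k : is_crossing T k -> k < size T.
Proof. by rewrite /is_crossing /slice; case: ltnP => // h; rewrite nth_default. Qed.

Lemma advance_pass k s d : is_crossing T k ->
  advance T (pass k s d) = (Some (AtCrossing k s d), if d then (k, jl k s, true) else (k.+1, ju k s, false)).
Proof.
rewrite /is_crossing /pass /jl /ju; case: d; case: s => /=; case: (slice T k) => i [] //= _;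
  by rewrite ?eqxx ?(gtn_eqF (ltnSn i)) //; case: k.
Qed.

Lemma evt_crossing x k s d : event_at x = Some (AtCrossing k s d) -> is_crossing T k /\ x = pass k s d.
Proof.
case: x => [[l j] []]; rewrite /event_at ?advU /is_crossing /pass /jl /ju /=.
  case: l => // l; rewrite /go_down; case sl: (slice T l) => [i []] //=;
    do 2?[case: eqP => [->|_] //=]; by move=> [<- <- <-]; rewrite sl /=.
rewrite /go_up; case sl: (slice T l) => [i []] //=;
  do 2?[case: eqP => [->|_] //=]; by move=> [<- <- <-]; rewrite sl /=.
Qed.

(** An upward position is only reached through the slice below it, and there is none below level
    0. *)
Lemma nxt_level0 y j : next_position y <> (0, j, false).
Proof.
case: y => [[l a] []]; rewrite /next_position ?advU /=.
  by case: l => // l; rewrite /go_down; case: (slice T l) => [i []] //=; do 2?[case: ifP => _ //=].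
by rewrite /go_up; case: (slice T l) => [i []] //=; do 2?[case: ifP => _ //=].
Qed.

(** The second alternative is the fixed point of [advance] at level 0. *)
Lemma pred_pass k s y : is_crossing T k -> next_position y = (k, jl k s, true) ->
  y = pass k s true \/ y = (k, jl k s, true).
Proof.
move=> ck; case: y => [[l a] []]; rewrite /next_position ?advU /=; last first.
  move: ck; rewrite /is_crossing /go_up; case sl: (slice T l) => [i []] //=; do 2?[case: ifP => _ //=];
    by move=> ck [lk _]; move: ck; rewrite -lk sl.
case: l => [|l]; first by right.
move: ck; rewrite /is_crossing /go_down /jl /pass /ju; case sl: (slice T l) => [i c] ck E.
have lk : l = k by move: E; case: (c) => //=; do 2?[case: ifP => _ //=]; case.
subst l; rewrite sl in ck E *; left.
case: c ck E {sl} => //= _; case: (eqVneq a i) => [->|ai] /=; try (case: (eqVneq a i.+1) => [->|ai1] /=);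
  case: s; move/(congr1 (fun x : position => x.1.2)) => /= h; by [|exfalso; lia].
Qed.

Lemma pred_max k i y : slice T k = (i, LocalMax) -> next_position y = (k, i, true) ->
  y = (k, i.+1, false) \/ y = (k, i, true).
Proof.
move=> sk; case: y => [[l a] []]; rewrite /next_position ?advU /=; last first.
  rewrite /go_up; case sl: (slice T l) => [i' []] //=; do 2?[case: ifP => //=].
    by move=> /eqP -> [lk]; rewrite -lk sl in sk; case: sk => ->; lia.
  by move=> /eqP -> _ [lk _]; rewrite -lk sl in sk; case: sk => ->; left; rewrite lk.
case: l => [|l]; first by right.
rewrite /go_down; case sl: (slice T l) => [i' c] E.
have lk : l = k by move: E; case: (c) => //=; do 2?[case: ifP => _ //=]; case.
rewrite -lk sl in sk; case: sk => ii cc; rewrite {}ii {}cc /= in E.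
by case: E => _; case: ltnP; lia.
Qed.

Lemma pred_min k i y : slice T k = (i, LocalMin) -> next_position y = (k.+1, i, false) ->
  y = (k.+1, i.+1, true).
Proof.
move=> sk; case: y => [[l a] []]; rewrite /next_position ?advU /=; last first.
  rewrite /go_up; case sl: (slice T l) => [i' c] E.
  have lk : l = k by move: E; case: (c) => //=; do 2?[case: ifP => _ //=]; case.
  rewrite -lk sl in sk; case: sk => ii cc; rewrite {}ii {}cc /= in E.
  by case: E => _; case: ltnP; lia.
case: l => [|l] //.
rewrite /go_down; case sl: (slice T l) => [i' []] //=; do 2?[case: ifP => //=].
  by move=> /eqP -> [lk]; rewrite -lk sl in sk; case: sk => ->; lia.
by move=> /eqP -> _ [lk _]; rewrite -lk sl in sk; case: sk => ->; rewrite lk.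
Qed.

Hypotheses (hB : bottom_diagram T) (hC : one_component T).

Lemma width_size : width T (size T) = 0. Proof. by case: hB. Qed.
Lemma fits k : k < size T -> slice_fits (width T k) (slice T k). Proof. by case: hB => _; apply. Qed.

Lemma valid_lt l j d : valid (l, j, d) -> l < size T.
Proof.
rewrite /valid /= => /andP[lT jw]; rewrite ltn_neqAle lT andbT; apply/eqP => E.
by rewrite E width_size in jw.
Qed.

Lemma valid_nxt x : valid x -> valid (next_position x).
Proof.
case: x => [[l j] d] vx; have lT := valid_lt vx; move: vx; rewrite /valid /= => /andP[_ jw].
case: d; rewrite /next_position ?advU; last first.
  rewrite /go_up; have := fits lT; have := widthS lT; rewrite /slice_fits.
  by case: (slice T l) => i [] /= wS fit; do 3?[case: ifP => //=]; lia.
case: l lT jw => [|l] lT jw; first exact: jw.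
have lT' : l < size T by exact: ltnW.
rewrite /advance /go_down; have := fits lT'; have := widthS lT'; rewrite /slice_fits.
by case: (slice T l) => i [] /= wS fit; do 3?[case: ifP => //=]; lia.
Qed.

Lemma npts_gt1 : 1 < npts.
Proof. by rewrite /npts big_ord_recl /width take0 /= leq_addr. Qed.

Lemma walk_valid x : x \in walk T -> valid x.
Proof.
rewrite walkE => /trajectP[i _ ->]; elim: i => [|i IH]; last exact: valid_nxt.
by rewrite /valid /width take0.
Qed.

Definition points : seq (nat * nat) :=
  [seq (l, j) | l <- iota 0 (size T).+1, j <- iota 0 (width T l)].

Lemma points_in x : x \in points = (x.1 <= size T) && (x.2 < width T x.1).
Proof.
case: x => l j /=; apply/allpairsPdep/andP => [[l' [j' []]]|[lT jw]].
  by rewrite !mem_iota !add0n => /andP[_ h] /andP[_ h'] [-> ->].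
by exists l, j; rewrite !mem_iota !add0n.
Qed.

(** The walk lists as many positions as there are points; since all points are visited, none can be
    repeated. *)
Lemma walk1_uniq : uniq [seq x.1 | x <- walk T].
Proof.
have up : uniq points.
  by apply: allpairs_uniq_dep => [|l _|[l j] [l' j'] _ _ /= [-> ->]]; rewrite ?iota_uniq.
apply: (leq_size_uniq up) => [[l j]|].
  by rewrite points_in => /andP[/hC]; apply.
rewrite size_map size_traject size_allpairs_dep sumnE big_map /npts.
rewrite -[X in iota _ X]subn0 -/(index_iota 0 _) big_mkord leq_eqVlt; apply/orP; left.
by apply/eqP/eq_bigr => l _; rewrite size_iota.
Qed.

Lemma walk_uniq : uniq (walk T). Proof. exact: map_uniq walk1_uniq. Qed.

Lemma walk_pt x y : x \in walk T -> y \in walk T -> x.1 = y.1 -> x = y.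
Proof. by move=> xw yw; apply: (@uniq_map_inj _ _ (fun x : position => x.1) _ walk1_uniq). Qed.

Lemma iter_inj i j : i < npts -> j < npts -> iter i next_position x0 = iter j next_position x0 -> i = j.
Proof.
move=> iM jM; rewrite -(nth_traject _ iM) -(nth_traject _ jM) => /eqP.
by rewrite nth_uniq ?size_traject ?walk_uniq // => /eqP.
Qed.

Lemma walk_point l j : l <= size T -> j < width T l -> exists d, (l, j, d) \in walk T.
Proof. by move=> lT jw; have /mapP[[[a b] d] xw [-> ->]] := hC lT jw; exists d. Qed.

Lemma walk_fix x : x \in walk T -> next_position x = x -> x = iter npts.-1 next_position x0.
Proof.
rewrite walkE => /trajectP[i iM ->] xx; case: (ltnP i.+1 npts) => [iM1|]; last first.
  by move=> h; congr iter; lia.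
by have := iter_inj iM1 iM xx; lia.
Qed.

(** The left endpoint is visited, and not upwards, by [nxt_level0]. So the walk meets the fixed
    point [xl], which by uniqueness can only be its last position. *)
Lemma last_walk : iter npts.-1 next_position x0 = xl.
Proof.
have [//||d dw] := @walk_point 0 0; first by rewrite /width take0.
case: d dw => dw; first by rewrite -(walk_fix dw).
by move: dw; rewrite walkE => /trajectP[[|i] _ //] /esym /nxt_level0.
Qed.

Lemma walk_rcons : walk T = rcons walk_path xl.
Proof. by rewrite -last_walk -trajectSr prednK // (ltn_trans _ npts_gt1). Qed.

Lemma walk_steps x : x \in walk T -> x <> xl -> x \in walk_path.
Proof. by rewrite walk_rcons mem_rcons inE => /orP[/eqP|]. Qed.

Lemma steps_walk x : x \in walk_path -> x \in walk T.
Proof. by move=> xs; rewrite walk_rcons mem_rcons inE xs orbT. Qed.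

Lemma steps_uniq : uniq walk_path.
Proof. by have := walk_uniq; rewrite walk_rcons rcons_uniq => /andP[]. Qed.

Lemma steps_nxt x : x \in walk_path -> next_position x \in walk T /\ next_position x <> x.
Proof.
move=> xs; have xw := steps_walk xs; split.
  move: xs => /trajectP[i iM ->]; rewrite walkE; apply/trajectP; exists i.+1 => //; lia.
move=> xx; have := walk_uniq; rewrite walk_rcons rcons_uniq.
by rewrite -last_walk -(walk_fix xw xx) xs.
Qed.

Lemma steps_down l j : (l, j, true) \in walk_path -> 0 < l.
Proof. by case: l => // /steps_nxt[]. Qed.

Lemma walk_pred x : x \in walk T -> x <> x0 -> exists2 y, y \in walk_path & next_position y = x.
Proof.
rewrite walkE => /trajectP[[|i] iM ->] // _.
by exists (iter i next_position x0) => //; apply/trajectP; exists i; rewrite // -ltnS prednK // (ltn_trans _ npts_gt1).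
Qed.

Lemma walk_nxt x : x \in walk T -> x <> xl -> next_position x \in walk T.
Proof. by move=> xw xx; have [] := steps_nxt (walk_steps xw xx). Qed.

Lemma pass_not2 k s : is_crossing T k -> ~~ ((pass k s true \in walk T) && (pass k s false \in walk T)).
Proof.
move=> ck; apply/negP => /andP[pt pf].
have h : (k.+1, ju k s, false) \in walk T by have := @walk_nxt (pass k s false) pf; rewrite /next_position advance_pass //; apply.
by have := walk_pt pt h erefl.
Qed.

Definition dw k s := pass k s true \in walk T.

(** The lower end of the string is visited: if upwards, the pass starts there; if downwards, it
    starts at the predecessor. *)
Lemma pass_walk k s : is_crossing T k -> pass k s (dw k s) \in walk T.
Proof.
move=> ck; rewrite /dw; case ptw: (pass k s true \in walk T) => //.
have kT := is_crossing_lt ck; have fk := fits kT.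
have [||d xw] := @walk_point k (jl k s); first exact: ltnW.
  by move: ck fk; rewrite /is_crossing /slice_fits /jl; case: (slice T k) => i [] //=; case: (s); lia.
case: d xw => // xw; have [//|y ys ny] := walk_pred xw.
have [_ yy] := steps_nxt ys.
case: (pred_pass ck ny) => yE; last by rewrite ny yE in yy.
by rewrite -yE steps_walk in ptw.
Qed.

Lemma walk_evt_crossing x k s d : x \in walk T -> event_at x = Some (AtCrossing k s d) ->
  [/\ is_crossing T k, d = dw k s & x = pass k s (dw k s)].
Proof.
move=> xw /evt_crossing[ck xE]; have pw := pass_walk s ck.
have -> : dw k s = d.
  by rewrite /dw; case: d xE => xE; rewrite -?xE //; apply/negbTE; have := pass_not2 s ck; rewrite -xE xw andbT.
by [].
Qed.

Definition mn (k : nat) : bool := (k.+1, (slice T k).1, true) \in walk T.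
(* The step along the extremum in slice k, from left to right iff b. *)
Definition maxpass (k : nat) (b : bool) : position := (k, if b then (slice T k).1 else (slice T k).1.+1, false).
Definition minpass (k : nat) (b : bool) : position := (k.+1, if b then (slice T k).1 else (slice T k).1.+1, true).

Lemma maxpass_walk k i : k < size T -> slice T k = (i, LocalMax) ->
  exists b, maxpass k b \in walk T /\ maxpass k (~~ b) \notin walk T.
Proof.
move=> kT sk; have := fits kT; rewrite sk /slice_fits /= => fk.
have [||d xw] := @walk_point k i; [exact: ltnW|exact: ltnW|].
have E b : (k, (if b then i else i.+1), false) \in walk T -> (k, (if b then i.+1 else i), false) \notin walk T.
  move=> pw; apply/negP => pw'; have /(walk_pt pw') : next_position (k, (if b then i else i.+1), false) \in walk T.
    exact: walk_nxt.
  by rewrite /next_position ?advU /= /go_up sk; case: (b); rewrite ?eqxx ?(gtn_eqF (ltnSn i)) => /(_ erefl).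
rewrite /maxpass sk /=; case: d xw => xw; last first.
  by exists true; split=> //; apply: (E true).
have [//|y ys ny] := walk_pred xw; have [_ yy] := steps_nxt ys.
case: (pred_max sk ny) => yE; last by rewrite ny yE in yy.
by exists false; rewrite -yE steps_walk //; split=> //; apply: (E false); rewrite -yE steps_walk.
Qed.

Lemma minpass_walk k i : k < size T -> slice T k = (i, LocalMin) ->
  exists b, minpass k b \in walk T /\ minpass k (~~ b) \notin walk T.
Proof.
move=> kT sk; have := fits kT; have := widthS kT; rewrite sk /slice_fits /= => wk fk.
have [//||d xw] := @walk_point k.+1 i; first by rewrite wk; lia.
have E b : (k.+1, (if b then i else i.+1), true) \in walk T -> (k.+1, (if b then i.+1 else i), true) \notin walk T.
  move=> pw; apply/negP => pw'; have /(walk_pt pw') : next_position (k.+1, (if b then i else i.+1), true) \in walk T.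
    exact: walk_nxt.
  by rewrite /next_position ?advU /= sk /go_down; case: (b); rewrite ?eqxx ?(gtn_eqF (ltnSn i)) => /(_ erefl).
rewrite /minpass sk /=; case: d xw => xw.
  by exists true; split=> //; apply: (E true).
have [//|y ys ny] := walk_pred xw.
have yE := pred_min sk ny.
by exists false; rewrite -yE steps_walk //; split=> //; apply: (E false); rewrite -yE steps_walk.
Qed.

Lemma has_pmap (S U : Type) (f : S -> option U) (a : pred U) (s : seq S) :
  has a (pmap f s) = has (fun x => if f x is Some e then a e else false) s.
Proof. by elim: s => //= x s IH; case: (f x) => //= e; rewrite IH. Qed.

Lemma downwardE k s : is_crossing T k -> downward T k s = dw k s.
Proof.
move=> ck; rewrite /downward /events has_pmap; apply/hasP/idP => [[x xw]|dk].
  case xe: (advance T x).1 => [[k' s' []| |]|] // /andP[/eqP kk /eqP ss].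
  by have [_ E _] := walk_evt_crossing xw xe; rewrite -kk -ss -E.
by exists (pass k s true); rewrite ?advance_pass //= !eqxx.
Qed.
End Walk.

Local Open Scope ring_scope.

(** * Power series and quantum integers *)

Section FpsGeneral.
Variable A : nzRingType.
Implicit Types x y : {fps A}.

Lemma coef_hM x n : (fps_h * x) n = if n is n'.+1 then x n' else 0.
Proof.
case: n => [|n]; first by rewrite fps_coef0M mul0r.
rewrite fpsEM 2!big_ord_recl mul0r add0r /= mul1r subn1 big1 ?addr0 //.
by move=> i _; rewrite mul0r.
Qed.

Lemma coef_hXM k x n : (fps_h ^+ k * x) n = if (n < k)%N then 0 else x (n - k)%N.
Proof.
elim: k n => [|k IH] n; first by rewrite mul1r subn0.
by rewrite exprS -mulrA coef_hM; case: n => // n; rewrite IH ltnS subSS.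
Qed.

Lemma hX_dvdP k x : (forall n, (n < k)%N -> x n = 0) <-> exists y, x = fps_h ^+ k * y.
Proof.
split=> [x0|[y ->] n nk]; last by rewrite coef_hXM nk.
exists (Fps (fun n => x (n + k)%N)); apply: fpsP => n; rewrite coef_hXM.
by case: ltnP => [/x0|kn]; rewrite //= subnK.
Qed.

Lemma fps_coef_sum (I : Type) (r : seq I) (P : pred I) (F : I -> {fps A}) n :
  (\sum_(i <- r | P i) F i) n = \sum_(i <- r | P i) F i n.
Proof. by elim/big_rec2: _ => // i a b _ <-. Qed.
End FpsGeneral.

Lemma fps_dvd_h_eq0 (A : nzRingType) (x : {fps A}) :
  (forall k, exists y, x = fps_h ^+ k * y) -> x = 0.
Proof. by move=> xh; apply: fpsP => n; have /hX_dvdP -> := xh n.+1. Qed.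

Section FpsIdomain.
Variable A : idomainType.

Fact fps_integral (x y : {fps A}) : x * y = 0 -> (x == 0) || (y == 0).
Proof.
move=> xy0; apply/negPn/negP; rewrite negb_or => /andP[x0 y0].
have low (z : {fps A}) : z != 0 -> exists n, z n != 0 /\ forall i, (i < n)%N -> z i = 0.
  move=> z0; have ex : exists n, z n != 0.
    apply/not_existsP => nz; move/eqP: z0; apply; apply: fpsP => n.
    by apply/eqP/negPn/negP/nz.
  exists (ex_minn ex); case: ex_minnP => n zn nmin; split=> // i lt_in.
  by apply/eqP; apply: contraTT lt_in => /nmin; rewrite -leqNgt.
have [m [xm xlt]] := low _ x0; have [n [yn ylt]] := low _ y0.
have /eqP := congr1 (fun z : {fps A} => z (m + n)%N) xy0.
rewrite fpsEM (bigD1 (Ordinal (leq_addr n m.+1 : m < (m + n).+1)%N)) //= addKn.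
rewrite big1 ?addr0 ?mulf_eq0 ?(negPf xm) ?(negPf yn) // => i.
rewrite -val_eqE neq_ltn /= => /orP[/xlt -> | lt_mi]; first by rewrite mul0r.
by rewrite ylt ?mulr0 // ltn_subLR ?ltn_add2r // -ltnS.
Qed.
HB.instance Definition _ := GRing.ComUnitRing_isIntegral.Build {fps A} fps_integral.
End FpsIdomain.


Lemma fps_const_zmod (A : nzRingType) : zmod_morphism (@fps_const A).
Proof. by move=> a b; apply: fpsP => -[|n] //; rewrite fpsED fpsEN /= subr0. Qed.
HB.instance Definition _ (A : nzRingType) :=
  GRing.isZmodMorphism.Build A {fps A} (@fps_const A) (@fps_const_zmod A).

Lemma fps_constM_coef (A : nzRingType) (a : A) (x : {fps A}) n : (fps_const a * x) n = a * x n.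
Proof. by rewrite fpsEM big_ord_recl subn0 big1 ?addr0 // => i _; rewrite mul0r. Qed.

Lemma fps_const_monoid (A : nzRingType) : monoid_morphism (@fps_const A).
Proof.
split=> // a b; apply: fpsP => n; rewrite fps_constM_coef.
by case: n => //= n; rewrite mulr0.
Qed.
HB.instance Definition _ (A : nzRingType) :=
  GRing.isMonoidMorphism.Build A {fps A} (@fps_const A) (@fps_const_monoid A).

Lemma fps_unit (x : Qh) : x 0%N != 0 -> x \is a GRing.unit.
Proof.
move=> x0; have : fps_const (x 0%N)^-1 * x \is a GRing.unit.
  by apply: fps_unit1; rewrite fps_coef0M mulVf.
by rewrite unitrM => /andP[].
Qed.

Lemma fps_h_neq0 : (fps_h : Qh) != 0.
Proof. by apply/eqP => /(congr1 (fun x : Qh => x 1%N)). Qed.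

Lemma coef_hX (A : nzRingType) k n : (fps_h ^+ k : {fps A}) n = (n == k)%:R.
Proof. by rewrite -[fps_h ^+ k]mulr1 coef_hXM fpsE1 subn_eq0; case: ltngtP. Qed.

(** The series exp(c h). Rational exponents are needed for v = exp(h/2) and for the quarters coming
    from exp(h/4 H (x) H). *)
Definition eh (c : rat) : Qh := Fps (fun n => c ^+ n / n`!%:R).

Lemma eh_coef0 c : eh c 0%N = 1. Proof. exact: divr1. Qed.

Lemma eh0 : eh 0 = 1.
Proof. by apply: fpsP => -[|n]; rewrite ?eh_coef0 //= expr0n mul0r. Qed.

Lemma factr_neq0 n : (n`!%:R : rat) != 0.
Proof. by rewrite pnatr_eq0 -lt0n fact_gt0. Qed.

Lemma ehD a b : eh (a + b) = eh a * eh b.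
Proof.
apply: fpsP => n; rewrite fpsEM /= addrC exprDn mulr_suml; apply: eq_bigr => i _.
have le_in : (i <= n)%N by rewrite -ltnS.
rewrite -mulr_natr -(bin_fact le_in) !natrM !invfM.
have := factr_neq0 i; have := factr_neq0 (n - i).
have : ('C(n, i)%:R : rat) != 0 by rewrite pnatr_eq0 -lt0n bin_gt0.
by move=> h1 h2 h3; field; rewrite h1 h2 h3.
Qed.

Lemma eh_unit c : eh c \is a GRing.unit.
Proof. by apply: fps_unit; rewrite eh_coef0 oner_eq0. Qed.

Lemma eh_neq0 c : eh c != 0.
Proof. by apply/eqP => /(congr1 (fun x : Qh => x 0%N)) /eqP; rewrite eh_coef0 oner_eq0. Qed.

Lemma ehN c : eh (- c) = (eh c)^-1.
Proof. by apply: (mulIr (eh_unit c)); rewrite mulVr ?eh_unit // -ehD addNr eh0. Qed.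

Lemma ehMn c n : eh (c *+ n) = eh c ^+ n.
Proof. by elim: n => [|n IH]; rewrite ?eh0 // mulrS ehD IH exprS. Qed.

Lemma natr_fpsV (A : nzRingType) n (c : A) : n%:R * c = 1 ->
  (n%:R : {fps A})^-1 = fps_const c.
Proof.
move=> nc; have cn : c * n%:R = 1 by rewrite mulr_natr -mulr_natl.
have nA : (n%:R : {fps A}) = fps_const (n%:R) by rewrite rmorph_nat.
have n_unit : (n%:R : {fps A}) \is a GRing.unit.
  apply/unitrP; exists (fps_const c).
  by rewrite nA -!rmorphM /= nc cn rmorph1.
by apply: (mulrI n_unit); rewrite mulrV // nA -rmorphM nc rmorph1.
Qed.

Lemma fps_expE (A : nzRingType) (x : {fps A}) n :
  fps_exp x n = \sum_(i < n.+1) ((i`!%:R)^-1 * x ^+ i) n.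
Proof. by []. Qed.

Lemma fps_exp_h c : fps_exp (fps_const c * fps_h) = eh c.
Proof.
apply: fpsP => n; rewrite fps_expE (bigD1 ord_max) // big1.
  rewrite [LHS]addr0 -[LHS]/(((n`!%:R)^-1 * (fps_const c * fps_h) ^+ n) n).
  rewrite (natr_fpsV (mulfV (factr_neq0 n))) exprMn -rmorphXn mulrA -rmorphM.
  by rewrite fps_constM_coef coef_hX eqxx mulr1 mulrC.
move=> i; rewrite -val_eqE /= => ni.
rewrite -[LHS]/(((i`!%:R)^-1 * (fps_const c * fps_h) ^+ i) n).
rewrite (natr_fpsV (mulfV (factr_neq0 i))).
by rewrite exprMn -rmorphXn mulrA -rmorphM fps_constM_coef coef_hX eq_sym (negPf ni) mulr0.
Qed.

Lemma hdivn n : (fps_h / n.+1%:R : Qh) = fps_const (n.+1%:R)^-1 * fps_h.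
Proof. by rewrite mulrC (@natr_fpsV _ _ (n.+1%:R^-1)) // mulfV ?pnatr_eq0. Qed.

Lemma vE : v = eh 2^-1.
Proof. by rewrite /v hdivn fps_exp_h. Qed.

Lemma vX n : v ^+ n = eh (n%:R / 2).
Proof. by rewrite vE -ehMn mulr_natl. Qed.

Lemma vXN n : v ^- n = eh (- (n%:R / 2)).
Proof. by rewrite ehN vX. Qed.

Lemma qE : q = eh 1.
Proof. by rewrite /q vX divff. Qed.

Lemma qX n : q ^+ n = eh n%:R.
Proof. by rewrite qE -ehMn. Qed.

Lemma qXN n : q ^- n = eh (- n%:R).
Proof. by rewrite ehN qX. Qed.

(* [br c] is {c} = v^c - v^-c and [qn c] is [c], for rational c *)
Definition br (c : rat) : Qh := eh (c / 2) - eh (- c / 2).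
Definition brh (c : rat) : Qh := Fps (fun n => br c n.+1).
Definition qn (c : rat) : Qh := brh c / brh 1.

Lemma br_coef0 c : br c 0%N = 0.
Proof. by rewrite fpsED fpsEN !eh_coef0 subrr. Qed.

Lemma br_coef1 c : br c 1%N = c.
Proof. by rewrite fpsED fpsEN /= !divr1; field. Qed.

Lemma brE c : br c = fps_h * brh c.
Proof. exact: fps_h_mul (br_coef0 c). Qed.

Lemma brh_unit c : c != 0 -> brh c \is a GRing.unit.
Proof. by move=> c0; apply: fps_unit; rewrite /= -[X in X != 0]/(br c 1%N) br_coef1. Qed.

Lemma br_neq0 c : c != 0 -> br c != 0.
Proof.
move=> c0; rewrite brE mulf_neq0 ?fps_h_neq0 //; apply/negP => /eqP bc.
by have := brh_unit c0; rewrite bc unitr0.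
Qed.

Lemma qnE c : br 1 * qn c = br c.
Proof. by rewrite /qn mulrC brE mulrCA divrK ?brh_unit // -brE. Qed.

Lemma qn_coef0 c : qn c 0%N = c.
Proof.
have : (br 1 * qn c) 1%N = br c 1%N by rewrite qnE.
rewrite fpsEM (sum2 (fun i => br 1 i * qn c (1 - i)%N)) br_coef0 mul0r add0r !br_coef1.
by rewrite mul1r.
Qed.

Lemma qn_unit c : c != 0 -> qn c \is a GRing.unit.
Proof. by move=> c0; apply: fps_unit; rewrite qn_coef0. Qed.

Lemma v_subE : v - v^-1 = br 1.
Proof. by rewrite vE -ehN /br; congr (eh _ - eh _); field. Qed.

Lemma qint_qn i : qint i = qn i%:R.
Proof.
apply: (mulfI (br_neq0 (oner_neq0 _))); rewrite qnE -{1}v_subE qintE vXN vX.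
by rewrite /br mulNr.
Qed.

Lemma br0 : br 0 = 0. Proof. by rewrite /br oppr0 subrr. Qed.
Lemma qn0 : qn 0 = 0.
Proof. by apply: (mulfI (br_neq0 (oner_neq0 _))); rewrite qnE br0 mulr0. Qed.
Lemma brN c : br (- c) = - br c.
Proof. by rewrite /br opprK opprB. Qed.
Lemma brM a b : br a * br b = eh ((a + b) / 2) + eh (- (a + b) / 2)
   - eh ((a - b) / 2) - eh (- (a - b) / 2).
Proof.
rewrite /br mulrBl !mulrBr -!ehD.
have -> : a / 2 + b / 2 = (a + b) / 2 by ring.
have -> : a / 2 + - b / 2 = (a - b) / 2 by ring.
have -> : - a / 2 + b / 2 = - (a - b) / 2 by ring.
have -> : - a / 2 + - b / 2 = - (a + b) / 2 by ring.
by ring.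
Qed.

(** * Continuous extension of maps on monomials *)

Definition hshift (A : zmodType) (x : {fps A}) : {fps A} :=
  Fps (fun n => if n is n'.+1 then x n' else 0).

Lemma hmulE (A : nzRingType) (x : {fps A}) : fps_h * x = hshift x.
Proof. by apply: fpsP => n; rewrite coef_hM. Qed.

Lemma hscaleE (A : lalgType rat) (x : {fps A}) : (fps_h : Qh) *: x = hshift x.
Proof.
apply: fpsP => -[|n]; first by rewrite fpsEZ big_ord1 scale0r.
rewrite fpsEZ 2!big_ord_recl scale0r add0r /= scale1r subn1 big1 ?addr0 //.
by move=> i _; rewrite scale0r.
Qed.

Definition hlinear (A : zmodType) (f : {fps A} -> Qh) :=
  (forall x y, f (x + y) = f x + f y) /\ (forall x, f (hshift x) = fps_h * f x).

Section Hlinear.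
Variables (A : zmodType) (f : {fps A} -> Qh).
Hypothesis f_lin : hlinear f.

Lemma hlinear0 : f 0 = 0.
Proof. by apply: (addrI (f 0)); rewrite -f_lin.1 !addr0. Qed.

Lemma hlinearN x : f (- x) = - f x.
Proof. by apply: (addrI (f x)); rewrite -f_lin.1 !subrr hlinear0. Qed.

Lemma hlinearB x y : f (x - y) = f x - f y.
Proof. by rewrite f_lin.1 hlinearN. Qed.

Lemma hlinear_sum (I : Type) (r : seq I) (P : pred I) F :
  f (\sum_(i <- r | P i) F i) = \sum_(i <- r | P i) f (F i).
Proof. by elim/big_rec2: _ => [|i x y _ <-]; rewrite ?hlinear0 // f_lin.1. Qed.
End Hlinear.

Lemma hlinear_mull (A : zmodType) (f : {fps A} -> Qh) (c : Qh) :
  hlinear f -> hlinear (fun x => c * f x).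
Proof. by move=> [fD fh]; split=> [x y|x]; rewrite ?fD ?mulrDr // fh mulrCA. Qed.

Lemma hlinear_bigsum (A : zmodType) (I : Type) (r : seq I) (f : I -> {fps A} -> Qh) :
  (forall i, hlinear (f i)) -> hlinear (fun x => \sum_(i <- r) f i x).
Proof.
move=> fl; split=> [x y|x].
  by rewrite -big_split; apply: eq_bigr => i _; rewrite (fl i).1.
by rewrite mulr_sumr; apply: eq_bigr => i _; rewrite (fl i).2.
Qed.

(* A map that is additive and commutes with multiplication by [h] is determined
   by its values on constants, since the [h]-adic topology of [Q[[h]]] is separated. *)
Lemma hlinear_eq (A : nzRingType) (f g : {fps A} -> Qh) :
  hlinear f -> hlinear g -> (forall a, f (fps_const a) = g (fps_const a)) -> f =1 g.
Proof.
move=> fl gl fg x; apply/eqP; rewrite -subr_eq0; apply/eqP/fps_dvd_h_eq0 => k.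
elim: k x => [|k IH] x; first by exists (f x - g x); rewrite mul1r.
pose x' : {fps A} := Fps (fun n => x n.+1).
have -> : x = fps_const (x 0%N) + hshift x'.
  by apply: fpsP => -[|n]; rewrite fpsED /= ?addr0 ?add0r.
have [y yE] := IH x'; exists y.
by rewrite fl.1 gl.1 fl.2 gl.2 fg opprD addrACA subrr add0r -mulrBr yE mulrA -exprS.
Qed.

Lemma hlinear_malg_eq (M : monomType) (f g : {fps malgQ M} -> Qh) :
  hlinear f -> hlinear g ->
  (forall c m, f (fps_const (<< c *g m >> : malgQ M)) = g (fps_const (<< c *g m >> : malgQ M))) ->
  f =1 g.
Proof.
move=> fl gl fg; apply: hlinear_eq => // a.
have aE : fps_const a = \sum_(m <- msupp a) fps_const (<< a@_m *g m >> : malgQ M).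
  by rewrite {1}[a]monalgE raddf_sum.
by rewrite aE !hlinear_sum //; apply: eq_bigr => m _; apply: fg.
Qed.

(* The continuous Q[[h]]-linear extension of [phi]. *)
Definition ext (M : monomType) (phi : M -> Qh) (x : {fps malgQ M}) : Qh :=
  Fps (fun k => \sum_(d < k.+1) mmap (@fps_const rat) phi (x d) (k - d)%N).

Lemma ext_hlinear (M : monomType) (phi : M -> Qh) : hlinear (ext phi).
Proof.
split=> [x y|x]; apply: fpsP => k.
  rewrite fpsED /= -big_split; apply: eq_bigr => d _.
  by rewrite [mmap _ _ _](raddfD (mmap (@fps_const rat) phi)) fpsED.
rewrite coef_hM; case: k => [|k]; first by rewrite /= big_ord1 (raddf0 (mmap _ _)).
rewrite /= big_ord_recl (raddf0 (mmap _ _)) add0r.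
by apply: eq_bigr => d _; rewrite /= subSS.
Qed.

Lemma extU (M : monomType) (phi : M -> Qh) c (m : M) :
  ext phi (fps_const (<< c *g m >> : malgQ M)) = fps_const c * phi m.
Proof.
apply: fpsP => k; rewrite /= big_ord_recl subn0 big1 ?addr0.
  by rewrite [mmap _ _ _](mmapU (f := @fps_const rat)).
by move=> i _; rewrite (raddf0 (mmap _ _)).
Qed.

Section Ext.
Variable M : monomType.
Implicit Types (phi : M -> Qh) (x y : {fps malgQ M}).

Lemma ext_sum (K : Type) (r : seq K) (c : K -> Qh) (phi : K -> M -> Qh) x :
  ext (fun m => \sum_(k <- r) c k * phi k m) x = \sum_(k <- r) c k * ext (phi k) x.
Proof.
move: x; apply: hlinear_malg_eq; first exact: ext_hlinear.
  by apply: hlinear_bigsum => k; apply/hlinear_mull/ext_hlinear.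
move=> c' m; rewrite extU mulr_sumr; apply: eq_bigr => k _.
by rewrite extU mulrCA.
Qed.

Lemma hscale_const (c : rat) (a : malgQ M) :
  (fps_const c : Qh) *: (fps_const a : {fps malgQ M}) = fps_const (c *: a).
Proof.
apply: fpsP => -[|n]; first by rewrite fpsEZ big_ord1.
by rewrite fpsEZ big1 // => i _; case: i => -[|i] lti /=; rewrite ?scaler0 ?scale0r.
Qed.

Lemma malgZU (c d : rat) (m : M) : c *: (<< d *g m >> : malgQ M) = << (c * d) *g m >>.
Proof. by apply/malgP => k; rewrite mcoeffZ !mcoeffU mulrnAr. Qed.

Lemma hshift_scalel (s : Qh) x : hshift s *: x = hshift (s *: x).
Proof. by rewrite -hmulE -hscaleE scalerA. Qed.

Lemma hshift_scaler (s : Qh) x : s *: hshift x = hshift (s *: x).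
Proof. by rewrite -!hscaleE !scalerA mulrC. Qed.

Lemma extZ phi (s : Qh) x : ext phi (s *: x) = s * ext phi x.
Proof.
pose f s := ext phi (s *: x); pose g s := s * ext phi x.
apply: (@hlinear_eq rat f g) => {s}.
- split=> [s t|s]; rewrite /f ?scalerDl ?(ext_hlinear phi).1 //.
  by rewrite hshift_scalel (ext_hlinear phi).2.
- by split=> [s t|s]; rewrite /g ?mulrDl // -hmulE mulrA.
move=> c; rewrite /f /g; move: x {f g}; apply: hlinear_malg_eq.
- split=> [x y|x]; rewrite ?scalerDr ?(ext_hlinear phi).1 //.
  by rewrite hshift_scaler (ext_hlinear phi).2.
- exact/hlinear_mull/ext_hlinear.
by move=> c' m; rewrite hscale_const malgZU !extU rmorphM mulrA.
Qed.

Lemma ext_const phi c m : ext phi (fps_const << c *g m >>) = fps_const c * phi m.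
Proof. exact: extU. Qed.

Lemma hshiftMl x y : hshift x * y = hshift (x * y).
Proof. by rewrite -!hmulE mulrA. Qed.

Lemma hshiftMr x y : x * hshift y = hshift (x * y).
Proof. by rewrite -!hscaleE scalerAr. Qed.

(** The hypothesis is the rule for the matrix coefficients of a product, so that representations of
    the free monoid extend to multiplicative maps on series. *)
Lemma ext_mul (K : finType) phi (a b : K -> M -> Qh) :
  (forall m m', phi (mmul m m') = \sum_k a k m * b k m') ->
  forall x y, ext phi (x * y) = \sum_k ext (a k) x * ext (b k) y.
Proof.
move=> phiM x y; move: x; apply: hlinear_malg_eq.
- split=> [x x'|x]; rewrite ?mulrDl ?(ext_hlinear phi).1 //.
  by rewrite hshiftMl (ext_hlinear phi).2.
- apply: hlinear_bigsum => k; split=> [x x'|x].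
    by rewrite (ext_hlinear _).1 mulrDl.
  by rewrite (ext_hlinear _).2 mulrA.
move=> c m; move: y; apply: hlinear_malg_eq.
- split=> [y y'|y]; rewrite ?mulrDr ?(ext_hlinear phi).1 //.
  by rewrite hshiftMr (ext_hlinear phi).2.
- by apply: hlinear_bigsum => k; apply/hlinear_mull/ext_hlinear.
move=> c' m'; rewrite -rmorphM.
have -> : (<< c *g m >> : malgQ M) * << c' *g m' >> = << (c * c') *g (mmul m m') >>.
  by rewrite [LHS]malgM_def fgmulUU.
rewrite extU phiM mulr_sumr; apply: eq_bigr => k _.
by rewrite !extU rmorphM mulrACA.
Qed.

Lemma ext_fps_sum phi (f : nat -> {fps malgQ M}) :
  (forall n k, (k < n)%N -> f n k = 0) ->
  ext phi (fps_sum f) = fps_sum (fun n => ext phi (f n)).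
Proof.
move=> f0; apply: fpsP => k.
have low x n : (forall d, (d < n)%N -> x d = 0) -> forall d, (d < n)%N -> ext phi x d = 0.
  move=> x0 d dn; rewrite /= big1 // => i _.
  by rewrite x0 ?(raddf0 (mmap _ _)) // (leq_trans (ltn_ord i)).
have := low (fps_sum f - \sum_(n < k.+1) f n) k.+1 _ k (ltnSn k).
rewrite (hlinearB (ext_hlinear phi)) (hlinear_sum (ext_hlinear phi)) fpsED fpsEN fps_coef_sum.
move=> /(_ _)/eqP; rewrite subr_eq0 => H; apply/eqP/H => d dk.
rewrite fpsED fpsEN fps_coef_sum /= -(subnKC dk) big_split_ord /=.
rewrite [X in _ - (_ + X)]big1 ?addr0 ?subrr // => i _.
by rewrite f0 // ltn_addr.
Qed.
End Ext.

Lemma malg_suppD (M : choiceType) (B : lmodType rat) (F : M -> B) (x y : {malg rat[M]}) :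
  \sum_(m <- msupp (x + y)) (x + y)@_m *: F m =
  \sum_(m <- msupp x) x@_m *: F m + \sum_(m <- msupp y) y@_m *: F m.
Proof.
have w (d : {fset M}) z : (msupp z `<=` d)%fset ->
    \sum_(m <- msupp z) z@_m *: F m = \sum_(m <- d) z@_m *: F m.
  by move=> le; rewrite (big_fset_incl _ le) // => m _ /mcoeff_outdom ->; rewrite scale0r.
rewrite (w _ _ (msuppD_le _ _)) (w (msupp x `|` msupp y)%fset x) ?fsubsetUl //.
rewrite (w (msupp x `|` msupp y)%fset y) ?fsubsetUr // -big_split.
by apply: eq_bigr => m _; rewrite mcoeffD scalerDl.
Qed.

Section Fubini.
Variables M N : monomType.

Lemma fps_linD (B : lmodType rat) (G : N -> {fps B}) (x y : {fps malgQ N}) :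
  fps_lin G (x + y) = fps_lin G x + fps_lin G y.
Proof.
apply: fpsP => k; rewrite fpsED /= -big_split; apply: eq_bigr => d _.
exact: (malg_suppD (fun m => G m (k - d)%N)).
Qed.

Lemma fps_lin_hshift (B : lmodType rat) (G : N -> {fps B}) (x : {fps malgQ N}) :
  fps_lin G (hshift x) = hshift (fps_lin G x).
Proof.
apply: fpsP => -[|k] /=; first by rewrite big_ord1 msupp0 big_seq_fset0.
by rewrite big_ord_recl msupp0 big_seq_fset0 add0r.
Qed.

Lemma fps_linU (B : lmodType rat) (G : N -> {fps B}) c m :
  fps_lin G (fps_const (<< c *g m >> : malgQ N)) = Fps (fun k => c *: G m k).
Proof.
apply: fpsP => k; rewrite /= big_ord_recl subn0 [X in _ + X]big1 ?addr0.
  rewrite msuppU; case: eqP => [->|_]; first by rewrite big_seq_fset0 scale0r.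
  by rewrite big_seq_fset1 mcoeffU eqxx.
by move=> i _; rewrite /= msupp0 big_seq_fset0.
Qed.

Lemma ext_fps_lin (phi : M -> Qh) (G : N -> {fps malgQ M}) (x : {fps malgQ N}) :
  ext phi (fps_lin G x) = ext (fun m => ext phi (G m)) x.
Proof.
move: x; apply: hlinear_malg_eq; last 1 first.
- move=> c m; rewrite fps_linU ext_const -extZ; congr ext; apply: fpsP => k.
  rewrite fpsEZ big_ord_recl subn0 big1 ?addr0 // => i _; exact: scale0r.
- split=> [x y|x]; first by rewrite fps_linD (ext_hlinear phi).1.
  by rewrite fps_lin_hshift (ext_hlinear phi).2.
exact: ext_hlinear.
Qed.
End Fubini.

Lemma ext_fps_exp (M : monomType) (phi : M -> Qh) (x : {fps malgQ M}) : x 0%N = 0 ->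
  ext phi (fps_exp x) = fps_sum (fun n => fps_const (n`!%:R)^-1 * ext phi (x ^+ n)).
Proof.
move=> x0; have nA n : (n`!%:R^-1 : {fps malgQ M}) = (fps_const (n`!%:R)^-1 : Qh) *: 1.
  have c : (n`!%:R : malgQ M) * ((n`!%:R^-1 : rat) *: 1) = 1.
    by rewrite -scalerAr mulr1 -scaler_nat scalerA mulVf ?factr_neq0 // scale1r.
  rewrite (natr_fpsV c); apply/esym; exact: (hscale_const _ (1 : malgQ M)).
rewrite ext_fps_sum => [|n k kn].
  apply: fpsP => k; apply: eq_bigr => n _.
  by rewrite nA mulr_algl extZ.
by rewrite nA mulr_algl fpsEZ big1 // => i _; rewrite fps_expr_lt ?scaler0 // (leq_ltn_trans _ kn) ?leq_subr.
Qed.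

(** * Finite-dimensional representations *)

Section Rep.
Variable n : nat.
Local Notation B := 'M[Qh]_n.+1.
Local Notation lam := (n%:R : rat).

(** The basis of V_n is e_g = F^g e_0, without divided powers: F has entries 0 and 1, and E e_g =
    [g] [n+1-g] e_{g-1}. *)
Definition Ec (j : rat) : Qh := qn j * qn (lam + 1 - j).
Definition rE : B := \matrix_(i, j) if (j == i.+1 :> nat) then Ec j%:R else 0.
Definition rF : B := \matrix_(i, j) (i == j.+1 :> nat)%:R.
Definition rdiag (f : rat -> Qh) : B := \matrix_(i, j) if i == j then f (lam - 2 * j%:R) else 0.
Definition rH : B := rdiag (@fps_const rat).
Definition rK : B := rdiag (fun mu => eh (mu / 2)).
Definition rKi : B := rdiag (fun mu => eh (- (mu / 2))).

(** Zero unless 0 <= g <= n. The formulas for E and for diagonal matrices then hold for all integers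
    g, that for F only for g >= 0, since F e_{-1} = 0 while e_0 is not zero. *)
Definition evec (g : int) : 'cV[Qh]_n.+1 := \col_i (i%:Z == g)%:R.

Lemma evec_out g : (g < 0) || (n%:Z < g) -> evec g = 0.
Proof.
move=> gout; apply/matrixP => i j; rewrite !mxE.
by case: eqP gout => // <-; have := ltn_ord i; lia.
Qed.

Lemma evecP (X Y : B) : (forall g : 'I_n.+1, X *m evec g%:Z = Y *m evec g%:Z) -> X = Y.
Proof.
move=> XY; apply/matrixP => i j.
have colE (Z : B) : Z i j = (Z *m evec j%:Z) i 0.
  rewrite mxE (bigD1 j) //= mxE eqxx mulr1 big1 ?addr0 // => k kj.
  by rewrite mxE eqz_nat (inj_eq val_inj) (negPf kj) mulr0.
by rewrite !colE XY.
Qed.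

Lemma mulmx_evec (X : B) (g : 'I_n.+1) i : (X *m evec g%:Z) i 0 = X i g.
Proof.
rewrite mxE (bigD1 g) //= mxE eqxx mulr1 big1 ?addr0 // => k kj.
by rewrite mxE eqz_nat (inj_eq val_inj) (negPf kj) mulr0.
Qed.

Lemma mx_evec (X : B) (g : int) (y : 'cV_n.+1) :
  ((g < 0) || (n%:Z < g) -> y = 0) ->
  (forall (j : 'I_n.+1) i, j%:Z = g -> X i j = y i 0) -> X *m evec g = y.
Proof.
move=> y0 Xy; case gout: ((g < 0) || (n%:Z < g)); first by rewrite evec_out // y0 // mulmx0.
have lt_gn : (absz g < n.+1)%N by lia.
have gE : g = (Ordinal lt_gn)%:Z by rewrite /=; lia.
apply/matrixP => i k; rewrite ord1 gE mulmx_evec; exact: Xy.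
Qed.

Lemma rF_evec g : 0 <= g -> rF *m evec g = evec (g + 1).
Proof.
move=> g0; apply: mx_evec => [gout|j i jg]; first by apply: evec_out; lia.
by rewrite !mxE -jg addrC -intS eqz_nat.
Qed.

Lemma Ec0 : Ec 0 = 0. Proof. by rewrite /Ec qn0 mul0r. Qed.
Lemma Ec_top : Ec (lam + 1) = 0. Proof. by rewrite /Ec subrr qn0 mulr0. Qed.

Lemma rE_evec g : rE *m evec g = Ec g%:~R *: evec (g - 1).
Proof.
apply: mx_evec => [gout|j i jg].
  case: (eqVneq g (n%:Z + 1)) => [->|gn].
    by rewrite rmorphD /= -[n%:~R]/lam Ec_top scale0r.
  by rewrite evec_out ?scaler0 //; lia.
rewrite !mxE -jg; case: (eqVneq (j : nat) i.+1) => ji.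
  have -> : (i%:Z == j%:Z - 1) by lia.
  by rewrite mulr1.
have -> : (i%:Z == j%:Z - 1) = false by lia.
by rewrite mulr0.
Qed.

Lemma rdiag_evec f g : rdiag f *m evec g = f (lam - 2 * g%:~R) *: evec g.
Proof.
apply: mx_evec => [gout|j i jg]; first by rewrite evec_out ?scaler0.
rewrite !mxE -jg eqz_nat; case: (eqVneq i j) => [->|/negPf ij].
  by rewrite eqxx mulr1.
by rewrite (inj_eq val_inj) ij mulr0.
Qed.

Lemma mulvA (X Y : B) (u : 'cV_n.+1) : (X * Y) *m u = X *m (Y *m u).
Proof. by rewrite mulmxA. Qed.

Lemma rdiagM f g : rdiag f * rdiag g = rdiag (fun c => f c * g c).
Proof.
by apply: evecP => k; rewrite mulvA !rdiag_evec -scalemxAr rdiag_evec scalerA [_ * f _]mulrC.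
Qed.

Lemma rdiag1 : rdiag (fun=> 1) = 1.
Proof. by apply: evecP => k; rewrite rdiag_evec mul1mx scale1r. Qed.

Lemma rdiagX f k : rdiag f ^+ k = rdiag (fun c => f c ^+ k).
Proof. by elim: k => [|k IH]; rewrite ?rdiag1 // exprS IH rdiagM; congr rdiag; apply/funext => c; rewrite exprS. Qed.

Lemma rK_Ki : rK * rKi = 1.
Proof. by rewrite rdiagM -rdiag1; congr rdiag; apply/funext => c; rewrite -ehD subrr eh0. Qed.
Lemma rKi_K : rKi * rK = 1.
Proof. by rewrite rdiagM -rdiag1; congr rdiag; apply/funext => c; rewrite -ehD addNr eh0. Qed.

Definition rgen (g : gen) : B := match g with GenH => rH | GenE => rE | GenF => rF end.
Definition rhow (w : word) : B := \prod_(g <- (w : seq gen)) rgen g.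

Lemma rhowM w w' : rhow (mmul w w') = rhow w * rhow w'.
Proof. by rewrite /rhow [mmul w w']fmmulE big_cat. Qed.
Lemma rhow1 : rhow mone = 1.
Proof. by rewrite /rhow [mone]fmoneE big_nil. Qed.
Lemma rhowU g : rhow (fmu g) = rgen g.
Proof. by rewrite /rhow fmuE big_seq1. Qed.

Definition rho (x : free) : B := \matrix_(i, j) ext (fun w => rhow w i j) x.

Fact rho_zmod : zmod_morphism rho.
Proof. by move=> x y; apply/matrixP => i j; rewrite !mxE (hlinearB (ext_hlinear _)). Qed.
HB.instance Definition _ := GRing.isZmodMorphism.Build free B rho rho_zmod.

Lemma rhoU c (w : word) : rho (fps_const << c *g w >>) = fps_const c *: rhow w.
Proof. by apply/matrixP => i j; rewrite !mxE ext_const. Qed.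

Lemma rho_monomial w : rho (monomial w) = rhow w.
Proof. by rewrite rhoU rmorph1 scale1r. Qed.

Fact rho_monoid : monoid_morphism rho.
Proof.
split; first by rewrite -[1]/(monomial mone) rho_monomial rhow1.
move=> x y; apply/matrixP => i j; rewrite !mxE.
rewrite (@ext_mul _ _ _ (fun k w => rhow w i k) (fun k w => rhow w k j)).
  by apply: eq_bigr => k _; rewrite !mxE.
by move=> w w'; rewrite rhowM mxE.
Qed.
HB.instance Definition _ := GRing.isMonoidMorphism.Build free B rho rho_monoid.

Lemma rhoZ s x : rho (s *: x) = s *: rho x.
Proof. by apply/matrixP => i j; rewrite !mxE extZ. Qed.

Lemma rhoM x y : rho (x * y) = rho x * rho y. Proof. exact: rmorphM. Qed.
Lemma rhoX x k : rho (x ^+ k) = rho x ^+ k. Proof. exact: rmorphXn. Qed.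
Lemma rhoB x y : rho (x - y) = rho x - rho y. Proof. exact: raddfB. Qed.
Lemma rho_1 : rho 1 = 1. Proof. exact: rmorph1. Qed.

Lemma rho_letter g : rho (letter g) = rgen g.
Proof. by rewrite -rhowU -rho_monomial. Qed.

Lemma rhoK : rho wK = rK.
Proof.
apply/matrixP => i j; rewrite !mxE ext_fps_exp; last first.
  by rewrite fpsEZ big_ord1 fps_coef0M mul0r scale0r.
have -> : eh ((lam - 2 * j%:R) / 2) = fps_exp (fps_const ((lam - 2 * j%:R) / 2) * fps_h).
  by rewrite fps_exp_h.
have rH_ d : ext (fun w => rhow w i j) ((fps_h / 2 *: wH) ^+ d) =
    if i == j then (fps_const ((lam - 2 * j%:R) / 2) * fps_h) ^+ d else 0.
  transitivity (rho ((fps_h / 2 *: wH) ^+ d) i j); first by rewrite mxE.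
  rewrite rhoX rhoZ rho_letter exprZn rdiagX !mxE; case: eqP; rewrite ?mulr0 // => _.
  by rewrite hdivn rmorphM /= -exprMn mulrAC [X in X * _]mulrC.
rewrite (_ : (fun d => _) = fun d => (d`!%:R)^-1 *
    (if i == j then (fps_const ((lam - 2 * j%:R) / 2) * fps_h) ^+ d else 0)).
  case: eqP => // _; apply: fpsP => k; apply: big1 => d _.
  by rewrite mulr0.
by apply/funext => d; rewrite rH_ (natr_fpsV (mulfV (factr_neq0 d))).
Qed.

Lemma wK_unit : wK \is a GRing.unit.
Proof. exact/fps_unit1/fps_exp_coef0. Qed.

Lemma rhoKi : rho wK^-1 = rKi.
Proof.
have : rho (wK * wK^-1) = 1 by rewrite mulrV ?wK_unit // rho_1.
by rewrite rhoM rhoK => /(congr1 (fun X => rKi * X)); rewrite mulrA rKi_K mul1r mulr1.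
Qed.

Lemma rel_HE_rep : rH * rE - rE * rH = rE *+ 2.
Proof.
apply: evecP => g; rewrite mulmxBl !mulvA rE_evec rdiag_evec -!scalemxAr rdiag_evec rE_evec.
rewrite !scalerA -scalerBl mulr2n mulmxDl rE_evec -scalerDl; congr (_ *: _).
have -> : n%:R - (1 + 1) * (g%:Z - 1)%:~R = (n%:R - (1 + 1) * g%:Z%:~R) + 2%:R :> rat.
  by rewrite intrB; ring.
by rewrite raddfD /= rmorph_nat; ring.
Qed.

Lemma rel_HF_rep : rH * rF - rF * rH = - (rF *+ 2).
Proof.
rewrite -[rF *+ 2](scaler_nat 2) -scaleNr; apply: evecP => g.
rewrite mulmxBl !mulvA rF_evec // !rdiag_evec -scalemxAr rF_evec // -scalemxAl rF_evec //.
rewrite -scalerBl; congr (_ *: _).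
have -> : n%:R - (1 + 1) * (g%:Z + 1)%:~R = (n%:R - (1 + 1) * g%:Z%:~R) - 2%:R :> rat.
  by rewrite intrD; ring.
by rewrite raddfB /= rmorph_nat; ring.
Qed.

Lemma rel_EF_rep : br 1 *: (rE * rF - rF * rE) = rK - rKi.
Proof.
apply: evecP => g; rewrite -scalemxAl !mulmxBl !mulvA rF_evec // !rE_evec -scalemxAr !rdiag_evec.
have rFE : Ec g%:Z%:~R *: (rF *m evec (g%:Z - 1)) = Ec g%:Z%:~R *: evec g%:Z.
  case: (posnP g) => [->|g0]; first by rewrite Ec0 !scale0r.
  by rewrite rF_evec ?subrK //; lia.
rewrite rFE addrK -!scalerBl scalerA; congr (_ *: _).
apply: (mulfI (br_neq0 (oner_neq0 _))).
have EcE x : br 1 * (br 1 * Ec x) = br x * br (lam + 1 - x).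
  by rewrite /Ec -(qnE x) -(qnE (lam + 1 - x)); ring.
have brE' a : eh (a / 2) - eh (- (a / 2)) = br a by rewrite /br mulNr.
rewrite brE' mulrBr [br 1 * (_ - _)]mulrBr !EcE intrD !brM.
set c := g%:Z%:~R : rat; rewrite [1%Z%:~R]mulr1z.
have -> : (c + 1 + (lam + 1 - (c + 1))) / 2 = (c + (lam + 1 - c)) / 2 by ring.
have -> : - (c + 1 + (lam + 1 - (c + 1))) / 2 = - (c + (lam + 1 - c)) / 2 by ring.
have -> : (c + 1 - (lam + 1 - (c + 1))) / 2 = (1 - (lam - 2 * c)) / 2 by ring.
have -> : - (c + 1 - (lam + 1 - (c + 1))) / 2 = - (1 - (lam - 2 * c)) / 2 by ring.
have -> : (c - (lam + 1 - c)) / 2 = - (1 + (lam - 2 * c)) / 2 by ring.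
have -> : - (c - (lam + 1 - c)) / 2 = (1 + (lam - 2 * c)) / 2 by ring.
by ring.
Qed.

(* Stated for an abstract algebra [U], because unification would unfold the terms of
   [free] and [Uh]. *)
Section AbstractAdditive.
Variables (U : algType Qh) (f : U -> B).
Hypotheses (fB : forall x y, f (x - y) = f x - f y)
  (fM : forall x y, f (x * y) = f x * f y).

Lemma hom_add x y : f (x + y) = f x + f y.
Proof.
have f0 : f 0 = 0 by rewrite -(subrr 0) fB subrr.
by rewrite -[y in LHS]opprK fB -[- y]add0r fB f0 sub0r opprK.
Qed.

Lemma hom_rel_sub x y z X Y Z : f x = X -> f y = Y -> f z = Z ->
  f (x * y - y * x - z) = X * Y - Y * X - Z.
Proof. by move=> <- <- <-; rewrite !fB !fM. Qed.

Lemma hom_rel_sub2 x y X Y : f x = X -> f y = Y ->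
  f (x * y - y * x - y *+ 2) = X * Y - Y * X - Y *+ 2.
Proof. by move=> <- <-; rewrite !fB !fM mulr2n hom_add. Qed.

Lemma hom_rel_add2 x y X Y : f x = X -> f y = Y ->
  f (x * y - y * x + y *+ 2) = X * Y - Y * X + Y *+ 2.
Proof. by move=> <- <-; rewrite hom_add fB !fM mulr2n hom_add. Qed.
End AbstractAdditive.

Lemma rho_eq_mod (x : free) : (forall k, exists y, rho x = fps_h ^+ k *: y) -> rho x = 0.
Proof.
move=> xh; apply/matrixP => i j; rewrite [RHS]mxE; apply: fps_dvd_h_eq0 => k.
by have [y ->] := xh k; exists (y i j); rewrite mxE.
Qed.

Lemma wK_sub0 : (wK - wK^-1) 0%N = 0.
Proof.
have [V0 _] := inv_coef1 (fps_exp_coef0 ((fps_h / 2 : Qh) *: wH)).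
by rewrite fpsED fpsEN V0 fps_exp_coef0 subrr.
Qed.

Lemma rho_rel x : sl2_rel x -> rho x = 0.
Proof.
case=> {x}.
- apply: etrans (@hom_rel_sub2 free rho rhoB rhoM _ _ _ _ (rho_letter _) (rho_letter _)) _.
  by rewrite rel_HE_rep subrr.
- apply: etrans (@hom_rel_add2 free rho rhoB rhoM _ _ _ _ (rho_letter _) (rho_letter _)) _.
  by rewrite rel_HF_rep addNr.
(* The quotient is only known through (v - v^-1) z = K - K^-1; this suffices because matrices over
   Q[[h]] have no torsion. *)
move: (exquot_v wK_sub0); set z := exquot _ _; move: z => z zE.
apply: etrans (@hom_rel_sub free rho rhoB rhoM _ _ _ _ _ _ (rho_letter _) (rho_letter _) erefl) _.
apply/eqP; rewrite subr_eq0; apply/eqP.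
have {zE} : (v - v^-1) *: rho z = rK - rKi.
  by rewrite -rhoK -rhoKi -rhoB -zE mulr_algl rhoZ.
rewrite -rel_EF_rep v_subE => zE; apply/matrixP => i j.
apply: (mulfI (br_neq0 (oner_neq0 _))).
by have := congr1 (fun X : B => X i j) zE; rewrite !mxE => <-.
Qed.

(** On the closure of the ideal, [rho x] is divisible by every power of h, hence zero. *)
Lemma rho_closed (x : free) : x \in closed_ideal sl2_rel -> rho x = 0.
Proof.
have rho_ideal y : gen_ideal sl2_rel y -> rho y = 0.
  elim=> {y} [y /rho_rel //||y z _ y0 _ z0|a y _ y0|a y _ y0].
  - exact: raddf0.
  - by rewrite rhoB y0 z0 subr0.
  - by rewrite rhoM y0 mulr0.
  - by rewrite rhoM y0 mul0r.
move=> /asboolP xI; apply: rho_eq_mod => k; have [y [z [/rho_ideal y0 ->]]] := xI k.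
by exists (rho z); rewrite raddfD /= y0 add0r rhoZ.
Qed.

Definition rhoUh (a : Uh) : B := rho (repr a).

Lemma rhoUh_class x : rhoUh (toUh x) = rho x.
Proof. by apply/eqP; rewrite -subr_eq0 -rhoB; apply/eqP/rho_closed/repr_class. Qed.

Lemma rhoUhB a b : rhoUh (a - b) = rhoUh a - rhoUh b.
Proof.
have [x ->] := class_surj a; have [y ->] := class_surj b.
by rewrite -[class _ x - _]raddfB !rhoUh_class rhoB.
Qed.

Fact rhoUh_zmod : zmod_morphism rhoUh. Proof. exact: rhoUhB. Qed.
HB.instance Definition _ := GRing.isZmodMorphism.Build Uh B rhoUh rhoUh_zmod.

Lemma rhoUhM a b : rhoUh (a * b) = rhoUh a * rhoUh b.
Proof.
have [x ->] := class_surj a; have [y ->] := class_surj b.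
by rewrite -[class _ x * _]rmorphM !rhoUh_class rhoM.
Qed.

Lemma rhoUhZ s a : rhoUh (s *: a) = s *: rhoUh a.
Proof. by have [x ->] := class_surj a; rewrite -classZ !rhoUh_class rhoZ. Qed.

Lemma rhoUh1 : rhoUh 1 = 1.
Proof. by rewrite -[1]/(toUh 1) rhoUh_class rho_1. Qed.

Definition central_value : Qh := eh ((lam + 1) / 2) + eh (- (lam + 1) / 2).

Lemma rep_casimir : br 1 ^+ 2 *: (rF * rE) + eh 2^-1 *: rK + eh (- 2^-1) *: rKi =
  central_value%:A.
Proof.
apply: evecP => g; rewrite !mulmxDl -!scalemxAl mulvA rE_evec !rdiag_evec mul1mx -scalemxAr.
have -> : Ec g%:Z%:~R *: (rF *m evec (g%:Z - 1)) = Ec g%:Z%:~R *: evec g%:Z.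
  case: (posnP g) => [->|g0]; first by rewrite Ec0 !scale0r.
  by rewrite rF_evec ?subrK //; lia.
rewrite !scalerA -!scalerDl; congr (_ *: _).
have -> : br 1 ^+ 2 * Ec g%:Z%:~R = br g%:Z%:~R * br (lam + 1 - g%:Z%:~R).
  by rewrite /Ec -(qnE g%:Z%:~R) -(qnE (lam + 1 - g%:Z%:~R)) expr2; ring.
set c := g%:Z%:~R : rat; rewrite brM -!ehD /central_value.
have -> : (c + (lam + 1 - c)) / 2 = (lam + 1) / 2 by ring.
have -> : - (c + (lam + 1 - c)) / 2 = - (lam + 1) / 2 by ring.
have -> : (c - (lam + 1 - c)) / 2 = - 2^-1 - (lam - 2 * c) / 2 by field.
have -> : - (c - (lam + 1 - c)) / 2 = 2^-1 + (lam - 2 * c) / 2 by field.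
by ring.
Qed.

Lemma central_value_sqr : central_value ^+ 2 = eh (lam + 1) + eh (- (lam + 1)) + 2%:R.
Proof.
rewrite /central_value expr2 mulrDl !mulrDr -!ehD.
have -> : (lam + 1) / 2 + (lam + 1) / 2 = lam + 1 by field.
have -> : - (lam + 1) / 2 + - (lam + 1) / 2 = - (lam + 1) by field.
have -> : (lam + 1) / 2 + - (lam + 1) / 2 = 0 by field.
have -> : - (lam + 1) / 2 + (lam + 1) / 2 = 0 by field.
by rewrite eh0; ring.
Qed.

Definition sig (p : nat) : Qh :=
  \prod_(1 <= i < p.+1) (eh (lam + 1) + eh (- (lam + 1)) - eh i%:R - eh (- i%:R)).

Section Abstract.
Variables (U : algType Qh) (f : U -> B).
Hypotheses (fB : forall x y, f (x - y) = f x - f y)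
  (fM : forall x y, f (x * y) = f x * f y)
  (fZ : forall s x, f (s *: x) = s *: f x) (f1 : f 1 = 1).
Let hom_add := hom_add fB.

Lemma hom_casimir E F K Ki : f E = rE -> f F = rF -> f K = rK -> f Ki = rKi ->
  f ((v - v^-1) ^+ 2 *: (F * E) + v *: K + v^-1 *: Ki) = central_value%:A.
Proof.
move=> fE fF fK fKi; rewrite v_subE vE -ehN -rep_casimir.
by rewrite !hom_add !fZ fM fE fF fK fKi.
Qed.

Lemma hom_sigma (C : U) p : f C = central_value%:A ->
  f (\prod_(1 <= i < p.+1) (C ^+ 2 - (q ^+ i + 2%:R + q ^- i)%:A)) = (sig p)%:A.
Proof.
move=> fC; rewrite /sig; elim/big_rec2: _ => [|i y x _ IH]; first by rewrite scale1r f1.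
rewrite fM IH fB expr2 fM fC fZ f1 qXN qX.
rewrite -scalerAl mul1r scalerA -scalerBl -scalerAl mul1r scalerA; congr (_ *: _).
by congr (_ * _); rewrite -expr2 central_value_sqr; ring.
Qed.
End Abstract.

Lemma rho_casimir : rhoUh casimir = central_value%:A.
Proof.
apply: (@hom_casimir Uh rhoUh rhoUhB rhoUhM rhoUhZ UE UF UK UKinv).
- exact: (etrans (rhoUh_class _) (rho_letter _)).
- exact: (etrans (rhoUh_class _) (rho_letter _)).
- exact: (etrans (rhoUh_class _) rhoK).
- exact: (etrans (rhoUh_class _) rhoKi).
Qed.

Lemma rho_sigma p : rhoUh (sigma p) = (sig p)%:A.
Proof. exact: (@hom_sigma Uh rhoUh rhoUhB rhoUhM rhoUhZ rhoUh1 casimir p rho_casimir). Qed.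
End Rep.

(** * The R-matrix in a tensor product *)

Definition qf (k : nat) : Qh := \prod_(1 <= i < k.+1) qn i%:R.

Lemma qf0 : qf 0 = 1. Proof. by rewrite /qf big_nil. Qed.
Lemma qfS k : qf k.+1 = qf k * qn k.+1%:R. Proof. by rewrite /qf big_nat_recr. Qed.

Lemma qf_unit k : qf k \is a GRing.unit.
Proof. by elim: k => [|k IH]; rewrite ?qf0 ?unitr1 // qfS unitrM IH qn_unit ?pnatr_eq0. Qed.

Lemma qfactE k : qfact k = qf k.
Proof. by apply: eq_bigr => i _; rewrite qint_qn. Qed.

(* The coefficients of the quasi-R-matrix and of its inverse. *)
Definition th (k : nat) : Qh := eh (k%:R * (k%:R - 1) / 4) * br 1 ^+ k / qf k.
Definition th' (k : nat) : Qh := (-1) ^+ k * eh (- (k%:R * (k%:R - 1) / 4)) * br 1 ^+ k / qf k.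

Lemma thS k : th k.+1 * qn k.+1%:R = th k * br 1 * eh (k%:R / 2).
Proof.
have u : qn k.+1%:R \is a GRing.unit by rewrite qn_unit ?pnatr_eq0.
have -> : th k.+1 = eh (k.+1%:R * (k.+1%:R - 1) / 4) * br 1 ^+ k.+1 / qf k / qn k.+1%:R.
  by rewrite /th qfS invrM ?qf_unit //; ring.
rewrite divrK //.
have -> : k.+1%:R * (k.+1%:R - 1) / 4 = k%:R * (k%:R - 1) / 4 + k%:R / 2 :> rat.
  by rewrite -natr1; field.
by rewrite /th ehD exprSr; ring.
Qed.

(** A partial sum of an alternating sum of q-binomials. Stopping at an arbitrary J < N gives a
    closed form provable by induction; for J = N - 1 it cancels the last term of the full sum. *)
Lemma th_partial N J : (J < N)%N ->
  \sum_(j < J.+1) (-1) ^+ j * eh (- (j%:R * (N%:R - 1) / 2)) / (qf j * qf (N - j)) =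
  (-1) ^+ J * eh (- (J%:R * N%:R / 2)) / (qf J * qf (N - J.+1) * qn N%:R).
Proof.
elim: J => [|J IH] JN.
  rewrite big_ord1 !mul0r oppr0 eh0 qf0 !mul1r subn0; congr (_^-1).
  by rewrite -{1}(prednK JN) qfS prednK // subn1.
rewrite big_ord_recr /= IH 1?ltnW //.
have -> : (N - J.+1)%N = (N - J.+2).+1 by lia.
have cE : (N - J.+2).+1%:R = N%:R - J%:R - 1 :> rat.
  by rewrite -subSn // subSS natrB; [rewrite -natr1; ring|lia].
have J1 : J.+1%:R = J%:R + 1 :> rat by rewrite natr1.
rewrite !qfS cE !J1.
have uJ := qf_unit J; have uM := qf_unit (N - J.+2).
have uN : qn N%:R \is a GRing.unit by rewrite qn_unit // pnatr_eq0; lia.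
have uJ1 : qn (J%:R + 1) \is a GRing.unit by rewrite qn_unit // natr1 pnatr_eq0.
have uM1 : qn (N%:R - J%:R - 1) \is a GRing.unit by rewrite qn_unit // -cE pnatr_eq0.
have E y z : br 1 * (y * qn z) = y * br z by rewrite -(qnE z); ring.
have key : - (eh (- (J%:R * N%:R / 2)) * qn (J%:R + 1)) + eh (- ((J%:R + 1) * (N%:R - 1) / 2)) * qn N%:R =
    eh (- ((J%:R + 1) * N%:R / 2)) * qn (N%:R - J%:R - 1).
  apply: (mulfI (br_neq0 (oner_neq0 _))).
  rewrite mulrDr mulrN !E.
  rewrite /br ![eh _ * (_ - _)]mulrBr -!ehD.
  have -> : - (J%:R * N%:R / 2) + (J%:R + 1) / 2 = - ((J%:R + 1) * (N%:R - 1) / 2) + N%:R / 2 :> rat by field.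
  have -> : - (J%:R * N%:R / 2) + - (J%:R + 1) / 2 = - ((J%:R + 1) * N%:R / 2) + (N%:R - J%:R - 1) / 2 :> rat by field.
  have -> : - ((J%:R + 1) * (N%:R - 1) / 2) + - N%:R / 2 = - ((J%:R + 1) * N%:R / 2) + - (N%:R - J%:R - 1) / 2 :> rat by field.
  by ring.
move: uJ uM uN uJ1 uM1 key; set A := qf J; set D := qf _; set a := qn (J%:R + 1).
set b := qn (N%:R - J%:R - 1); set d := qn N%:R.
set e1 := eh (- (J%:R * N%:R / 2)); set e2 := eh (- ((J%:R + 1) * (N%:R - 1) / 2)).
set e3 := eh (- ((J%:R + 1) * N%:R / 2)).
move: A D a b d e1 e2 e3 => A D a b d e1 e2 e3 uA uD ud ua ub key.
rewrite exprS mulN1r; set sg := (-1) ^+ J; move: sg => sg.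
have {}key : e2 * d = e3 * b + e1 * a by rewrite -key; ring.
have UM (x y : Qh) : x \is a GRing.unit -> y \is a GRing.unit -> x * y \is a GRing.unit.
  by move=> ux uy; rewrite unitrM ux.
rewrite !invrM ?UM //.
have := mulrV ua; have := mulrV ub; have := mulrV ud.
move: (A^-1) (D^-1) (a^-1) (b^-1) (d^-1) => iA iD ia ib id d1 b1 a1.
have -> : sg * e1 * (id * (ib * iD * iA)) = sg * iA * iD * (e1 * ib * id) * (a * ia) by rewrite a1; ring.
have -> : - sg * e2 * (ib * iD * (ia * iA)) = - (sg * iA * iD * (id * ia * ib) * (e2 * d)).
  by rewrite -[LHS]mulr1 -d1; ring.
have -> : - sg * e3 * (id * (iD * (ia * iA))) = - (sg * iA * iD * (id * ia * ib) * (e3 * b)).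
  by rewrite -[LHS]mulr1 -b1; ring.
by rewrite key; ring.
Qed.

Lemma th_inv N : \sum_(k < N.+1) th k * th' (N - k) = (N == 0%N)%:R.
Proof.
case: N => [|N].
  by rewrite big_ord1 /th /th' !mul0r oppr0 eh0 qf0 !expr0 !mul1r invr1 mulr1.
rewrite (reindex_inj rev_ord_inj) /=.
transitivity (\sum_(j < N.+2) br 1 ^+ N.+1 * eh (N.+1%:R * (N.+1%:R - 1) / 4) *
    ((-1) ^+ j * eh (- (j%:R * (N.+1%:R - 1) / 2)) / (qf j * qf (N.+1 - j)))).
  apply: eq_bigr => j _; have jN : (j <= N.+1)%N by rewrite -ltnS.
  rewrite subSS subKn // /th /th' invrM ?qf_unit //.
  rewrite -[X in br 1 ^+ X * _](subnK jN) exprD natrB //.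
  set a := (N.+1%:R : rat); set b := (j%:R : rat).
  have -> : (a - b) * (a - b - 1) / 4 = a * (a - 1) / 4 + - (b * (a - 1) / 2) + b * (b - 1) / 4 by field.
  rewrite !ehD; have E : eh (b * (b - 1) / 4) * eh (- (b * (b - 1) / 4)) = 1.
    by rewrite -ehD subrr eh0.
  rewrite -[RHS]mul1r -E; ring.
rewrite -mulr_sumr big_ord_recr /= th_partial // subnn qf0 !mulr1.
rewrite [(-1) ^+ N.+1]exprS mulN1r !mulNr qfS -[N.+1%:R - 1]/(N.+1%:R - 1%:R) -natrB // subn1 /=.
have -> : N%:R * N.+1%:R / 2 = N.+1%:R * N%:R / 2 :> rat by rewrite mulrC [_ * N.+1%:R]mulrC mulrA; ring.
by rewrite addrN mulr0.
Qed.

Lemma fps_sum_fin (g : nat -> Qh) N : (forall k d, (d < k)%N -> g k d = 0) ->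
  (forall k, (N <= k)%N -> g k = 0) -> fps_sum g = \sum_(k < N) g k.
Proof.
move=> g_low g0; apply: fpsP => d; rewrite fps_coef_sum /=.
have widen M M' : (M <= M')%N -> (forall k, (M <= k)%N -> g k d = 0) ->
    \sum_(k < M') g k d = \sum_(k < M) g k d.
  move=> MM gM; rewrite -(subnKC MM) big_split_ord /= [X in _ + X]big1 ?addr0 // => k _.
  by rewrite gM // leq_addr.
rewrite -(widen d.+1 (maxn d.+1 N)) ?leq_maxl //; last by move=> k dk; rewrite g_low.
by rewrite (widen N) ?leq_maxr // => k Nk; rewrite g0.
Qed.

Section Tensor.
Variable n : nat.
Local Notation B := 'M[Qh]_n.+1.
Local Notation C := 'M[B]_n.+1.
Local Notation lam := (n%:R : rat).

(** The tensor square of End(V_n) is encoded as matrices over matrices, the first factor carrying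
    the outer indices. *)
Definition tens (a b : B) : C := \matrix_(i, j) (a i j *: b).

Lemma tensM a b c d : tens a b * tens c d = tens (a * c) (b * d).
Proof.
apply/matrixP => i j; rewrite !mxE scaler_suml; apply: eq_bigr => k _.
by rewrite !mxE -scalerAl -scalerAr scalerA.
Qed.

Lemma tens1 : tens 1 1 = 1.
Proof.
apply/matrixP => i j; rewrite !mxE; case: (i == j); first by rewrite mulr1n scale1r.
by rewrite mulr0n scale0r.
Qed.

Lemma tensDl a a' b : tens (a + a') b = tens a b + tens a' b.
Proof. by apply/matrixP => i j; rewrite !mxE scalerDl. Qed.
Lemma tensBl a a' b : tens (a - a') b = tens a b - tens a' b.
Proof. by apply/matrixP => i j; rewrite !mxE scalerBl. Qed.
Lemma tens0l b : tens 0 b = 0.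
Proof. by apply/matrixP => i j; rewrite !mxE scale0r. Qed.
Lemma tens_suml (I : Type) (r : seq I) (P : pred I) (F : I -> B) b :
  tens (\sum_(i <- r | P i) F i) b = \sum_(i <- r | P i) tens (F i) b.
Proof. by elim/big_rec2: _ => [|i x y _ <-]; rewrite ?tens0l ?tensDl. Qed.

Definition rho2 (x : {fps malgQ (word * word)%type}) : C :=
  \matrix_(i, j) \matrix_(k, l) ext (fun w => rhow n w.1 i j * rhow n w.2 k l) x.

Lemma rho2M x y : rho2 (x * y) = rho2 x * rho2 y.
Proof.
apply/matrixP => i j; rewrite !mxE; apply/matrixP => k l; rewrite !mxE.
rewrite (@ext_mul _ _ _ (fun pq w => rhow n w.1 i pq.1 * rhow n w.2 k pq.2)
   (fun pq w => rhow n w.1 pq.1 j * rhow n w.2 pq.2 l)).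
  rewrite summxE -(pair_bigA _ (fun p q => ext (fun w => rhow n w.1 i p * rhow n w.2 k q) x *
    ext (fun w => rhow n w.1 p j * rhow n w.2 q l) y)) /=.
  by apply: eq_bigr => p _; rewrite !mxE; apply: eq_bigr => q _; rewrite !mxE.
move=> [w1 w2] [w1' w2']; rewrite /= !rhowM !mxE big_distrlr /= pair_bigA /=.
by apply: eq_bigr => pq _; rewrite mulrACA.
Qed.

Lemma rho2_tensor w w' : rho2 (tensor w w') = tens (rhow n w) (rhow n w').
Proof.
apply/matrixP => i j; rewrite !mxE; apply/matrixP => k l; rewrite !mxE.
by rewrite ext_const rmorph1 mul1r.
Qed.

Lemma rho2_1 : rho2 1 = 1.
Proof. by rewrite -[1]/(tensor mone mone) rho2_tensor !rhow1 tens1. Qed.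

Lemma rho2X x k : rho2 (x ^+ k) = rho2 x ^+ k.
Proof. by elim: k => [|k IH]; rewrite ?rho2_1 // !exprS rho2M IH. Qed.

Lemma tensX a b k : tens a b ^+ k = tens (a ^+ k) (b ^+ k).
Proof. by elim: k => [|k IH]; rewrite ?tens1 // !exprS IH tensM. Qed.

Local Notation rE := (rE n).
Local Notation rF := (rF n).
Local Notation rH := (rH n).
Local Notation rK := (rK n).
Local Notation rKi := (rKi n).
Local Notation evec := (evec n).

Lemma rFX_evec k g : 0 <= g -> rF ^+ k *m evec g = evec (g + k%:Z).
Proof.
move=> g0; elim: k => [|k IH]; first by rewrite mul1mx addr0.
by rewrite exprS mulvA IH rF_evec -?addrA ?[k%:Z + 1]addrC -?intS // addr_ge0.
Qed.

Lemma rFX_eq0 k : (n < k)%N -> rF ^+ k = 0.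
Proof.
move=> nk; apply: evecP => g; rewrite rFX_evec // mul0mx evec_out //.
by have := ltn_ord g; lia.
Qed.

(* exp (s h/4 H (x) H) *)
Definition rD (s : rat) : C :=
  \matrix_(i, j) if i == j then rdiag n (fun mu => eh (s * (lam - 2 * j%:R) * mu / 4)) else 0.

(** The sum may stop at n because F^(n+1) = 0 on V_n. *)
Definition rTh (t : nat -> Qh) : C := \sum_(k < n.+1) tens (t k *: rF ^+ k) (rE ^+ k).

Lemma tensor_F_E k i j p l :
  ext (fun w => rhow n w.1 i j * rhow n w.2 p l) (tensor (fmu GenF) (fmu GenE) ^+ k) =
  (rF ^+ k) i j * (rE ^+ k) p l.
Proof.
have := congr1 (fun X : C => X i j p l) (rho2X (tensor (fmu GenF) (fmu GenE)) k).
by rewrite rho2_tensor !rhowU tensX !mxE.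
Qed.

Lemma tensor_H_H c k i j p l :
  ext (fun w => rhow n w.1 i j * rhow n w.2 p l) ((fps_const c * fps_h *: tensor (fmu GenH) (fmu GenH)) ^+ k) =
  if (i == j) && (p == l) then (fps_const (c * (lam - 2 * j%:R) * (lam - 2 * l%:R)) * fps_h) ^+ k else 0.
Proof.
rewrite exprZn extZ.
have := congr1 (fun X : C => X i j p l) (rho2X (tensor (fmu GenH) (fmu GenH)) k).
rewrite rho2_tensor !rhowU tensX !rdiagX !mxE => ->.
case: (i == j); case: (p == l); rewrite ?mul0r ?mulr0 //=.
by rewrite -!exprMn !rmorphM /=; congr (_ ^+ k); ring.
Qed.

Lemma rho2_D : rho2 (fps_exp ((fps_h / 4%:R : Qh) *: tensor (fmu GenH) (fmu GenH))) = rD 1.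
Proof.
apply/matrixP => i j; rewrite !mxE; apply/matrixP => p l; rewrite mxE ext_fps_exp; last first.
  by rewrite fpsEZ big_ord1 fps_coef0M mul0r scale0r.
rewrite hdivn; under eq_fun do rewrite tensor_H_H.
case: eqP => _; rewrite mxE /=; last by apply: fpsP => d; apply: big1 => k _; rewrite mulr0.
case: eqP => _ /=; last by apply: fpsP => d; apply: big1 => k _; rewrite mulr0.
have -> : 1 * (lam - 2 * j%:R) * (lam - 2 * l%:R) / 4 = 4%:R^-1 * (lam - 2 * j%:R) * (lam - 2 * l%:R).
  by rewrite mul1r; ring.
rewrite -fps_exp_h; apply: fpsP => d; apply: eq_bigr => k _.
by rewrite (natr_fpsV (mulfV (factr_neq0 k))).
Qed.

Lemma Rmat_coef k : v ^+ (k * k.-1)./2 * ((v - v^-1) ^+ k / qfact k) = th k.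
Proof.
rewrite /th qfactE v_subE mulrA vX; congr (eh _ * _ / _).
have -> : ((k * k.-1)./2)%:R = k%:R * (k%:R - 1) / 2 :> rat.
  apply: (mulIf (_ : 2%:R != 0 :> rat)) => //; rewrite divfK // -natrM muln2 halfK.
  have -> : odd (k * k.-1) = false by case: k => // k; rewrite oddM /=; case: odd.
  by rewrite subn0 natrM; case: k => [|k]; rewrite ?mul0r //= -natr1 addrK.
by field.
Qed.

Lemma th_low k d : (d < k)%N -> th k d = 0.
Proof.
move: d; apply/hX_dvdP; exists (eh (k%:R * (k%:R - 1) / 4) * brh 1 ^+ k / qf k).
by rewrite /th brE exprMn; ring.
Qed.

Lemma rho2_Th : rho2 (fps_sum (fun k => (v ^+ (k * k.-1)./2 * ((v - v^-1) ^+ k / qfact k)) *: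
   tensor (fmu GenF) (fmu GenE) ^+ k)) = rTh th.
Proof.
rewrite (_ : (fun k => _) = fun k => th k *: tensor (fmu GenF) (fmu GenE) ^+ k); last first.
  by apply/funext => k; rewrite Rmat_coef.
apply/matrixP => i j; rewrite !mxE summxE; apply/matrixP => p l; rewrite mxE summxE.
rewrite ext_fps_sum => [|k d dk]; last first.
  rewrite fpsEZ big1 // => a _; rewrite th_low ?scale0r //.
  by rewrite (leq_ltn_trans _ dk) // -ltnS.
under eq_fun do rewrite extZ tensor_F_E.
rewrite (@fps_sum_fin _ n.+1).
- by apply: eq_bigr => k _; rewrite !mxE mulrA.
- move=> k d dk; rewrite fpsEM big1 // => a _; rewrite th_low ?mul0r //.
  by rewrite (leq_ltn_trans _ dk) // -ltnS.
by move=> k nk; rewrite rFX_eq0 // mxE mul0r mulr0.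
Qed.

Lemma rho2_Rmat : rho2 Rmat = rD 1 * rTh th.
Proof. by rewrite /Rmat rho2M rho2_D rho2_Th. Qed.

Lemma rD_tens s a b i j : (rD s * tens a b) i j =
  a i j *: (rdiag n (fun mu => eh (s * (lam - 2 * i%:R) * mu / 4)) * b).
Proof.
rewrite mxE (bigD1 i) //= !mxE eqxx big1 ?addr0 ?scalerAr // => k ki.
by rewrite !mxE eq_sym (negPf ki) mul0r.
Qed.

Lemma tens_rD s a b i j : (tens a b * rD s) i j =
  a i j *: (b * rdiag n (fun mu => eh (s * (lam - 2 * j%:R) * mu / 4))).
Proof.
rewrite mxE (bigD1 j) //= !mxE eqxx big1 ?addr0 ?scalerAl // => k kj.
by rewrite !mxE (negPf kj) mulr0.
Qed.

Lemma rD_inv s : rD s * rD (- s) = 1.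
Proof.
apply/matrixP => i j; rewrite mxE (bigD1 i) //= !mxE eqxx big1 ?addr0 => [|k ki]; last first.
  by rewrite !mxE eq_sym (negPf ki) mul0r.
case: eqP => [->|_]; last by rewrite mulr0.
rewrite rdiagM -rdiag1; congr rdiag; apply/funext => mu; rewrite -ehD -eh0; congr eh; ring.
Qed.

(** The terms with k + l = N add up to the coefficient computed in [th_inv]; those with k + l > n
    vanish together with F^(k+l). *)
Lemma rTh_inv : rTh th * rTh th' = 1.
Proof.
rewrite /rTh mulr_suml.
under eq_bigr => k _ do rewrite mulr_sumr.
have term k l : tens (th k *: rF ^+ k) (rE ^+ k) * tens (th' l *: rF ^+ l) (rE ^+ l) =
    tens ((th k * th' l) *: rF ^+ (k + l)) (rE ^+ (k + l)).
  by rewrite tensM -scalerAl -scalerAr scalerA -!exprD.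
transitivity (\sum_(N < n.+1) \sum_(k < n.+1 | (k <= N)%N)
    tens ((th k * th' (N - k)) *: rF ^+ N) (rE ^+ N)).
  rewrite [RHS](exchange_big_dep xpredT) //=; apply: eq_bigr => k _.
  transitivity (\sum_(0 <= l < n.+1) tens ((th k * th' l) *: rF ^+ (k + l)) (rE ^+ (k + l))).
    by rewrite big_mkord; apply: eq_bigr => l _; rewrite term.
  transitivity (\sum_(k <= N < n.+1) tens ((th k * th' (N - k)) *: rF ^+ N) (rE ^+ N)); last first.
    by rewrite big_geq_mkord.
  rewrite (@big_cat_nat _ _ _ (n.+1 - k)%N) ?leq_subr //= [X in _ + X]big_nat_cond.
  rewrite [X in _ + X]big1 ?addr0 => [|l /andP[/andP[kl _] _]]; last first.
    by rewrite rFX_eq0 ?scaler0 ?tens0l //; lia.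
  rewrite [RHS](@big_addn _ _ _ 0 n.+1 k).
  by apply: eq_bigr => l _; rewrite addnK addnC.
have NE (N : 'I_n.+1) : \sum_(k < n.+1 | (k <= N)%N) tens ((th k * th' (N - k)) *: rF ^+ N) (rE ^+ N) =
    if N == ord0 then 1 else 0.
  rewrite -tens_suml -scaler_suml.
  have <- := @big_ord_widen_cond _ _ _ N.+1 n.+1 xpredT (fun k => th k * th' (N - k)) (ltn_ord N).
  rewrite th_inv -val_eqE /=; case: eqP => [->|_]; last by rewrite scale0r tens0l.
  by rewrite scale1r tens1.
by rewrite (eq_bigr _ (fun N _ => NE N)) (bigD1 ord0) //= big1 ?addr0 // => N /negPf ->.
Qed.
End Tensor.

(** * Intertwining relations of the R-matrix, and the antipode *)

Lemma addr_shuffle (V : zmodType) (a b c d : V) : a + b - (c + d) = b - c - (d - a).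
Proof. by rewrite opprB opprD [a + b]addrC addrACA. Qed.

Lemma commutatorD (R : pzRingType) (x a b c d : R) :
  x * (a + b) - (c + d) * x = x * a + x * b - (c * x + d * x).
Proof. by rewrite mulrDr mulrDl. Qed.

Section Intertwine.
Variable n : nat.
Local Notation B := 'M[Qh]_n.+1.
Local Notation C := 'M[B]_n.+1.
Local Notation lam := (n%:R : rat).
Local Notation rE := (rE n).
Local Notation rF := (rF n).
Local Notation rH := (rH n).
Local Notation rK := (rK n).
Local Notation rKi := (rKi n).
Local Notation evec := (evec n).
Local Notation rdiag := (rdiag n).
Local Notation rD := (rD n).
Local Notation rTh := (rTh n).

Lemma Ec_shift k (g : rat) : br 1 * (Ec n (g + k%:R) - Ec n g) = qn k%:R * br (lam + 1 - 2 * g - k%:R).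
Proof.
apply: (mulfI (br_neq0 (oner_neq0 _))).
have EcE x : br 1 * (br 1 * Ec n x) = br x * br (lam + 1 - x).
  by rewrite /Ec -(qnE x) -(qnE (lam + 1 - x)); ring.
rewrite [br 1 * (_ - _)]mulrBr mulrBr !EcE mulrA qnE !brM.
have -> : (g + k%:R + (lam + 1 - (g + k%:R))) / 2 = (g + (lam + 1 - g)) / 2 by ring.
have -> : - (g + k%:R + (lam + 1 - (g + k%:R))) / 2 = - (g + (lam + 1 - g)) / 2 by ring.
have -> : (g + k%:R - (lam + 1 - (g + k%:R))) / 2 = (k%:R - (lam + 1 - 2 * g - k%:R)) / 2 by ring.
have -> : - (g + k%:R - (lam + 1 - (g + k%:R))) / 2 = - (k%:R - (lam + 1 - 2 * g - k%:R)) / 2 by ring.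
have -> : (g - (lam + 1 - g)) / 2 = - (k%:R + (lam + 1 - 2 * g - k%:R)) / 2 by ring.
have -> : - (g - (lam + 1 - g)) / 2 = (k%:R + (lam + 1 - 2 * g - k%:R)) / 2 by ring.
by ring.
Qed.

Section Abstract.
Variables E F K Ki : B.
Hypotheses (FX : forall k g, 0 <= g -> F ^+ k *m evec g = evec (g + k%:Z))
  (E_ : forall g, E *m evec g = Ec n g%:~R *: evec (g - 1))
  (K_ : forall g, K *m evec g = eh ((lam - 2 * g%:~R) / 2) *: evec g)
  (Ki_ : forall g, Ki *m evec g = eh (- ((lam - 2 * g%:~R) / 2)) *: evec g).

(** The recursion which determines the coefficients theta_k: the commutator of E with F^(k+1)
    balances the terms of degree k produced by K (x) E and K^-1 (x) E. *)
Lemma EF_comm_abs k :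
  th k.+1 *: (E * F ^+ k.+1 - F ^+ k.+1 * E) = th k *: (F ^+ k * K - Ki * F ^+ k).
Proof.
apply: evecP => g; rewrite -!scalemxAl !mulmxBl !mulvA.
have g0 : 0 <= g%:Z by [].
rewrite (FX k.+1 g0) (FX k g0) !E_ K_ Ki_ -!scalemxAr (FX k g0).
have -> : Ec n g%:Z%:~R *: (F ^+ k.+1 *m evec (g%:Z - 1)) = Ec n g%:Z%:~R *: evec (g%:Z + k%:Z).
  case: (posnP g) => [->|gp]; first by rewrite Ec0 !scale0r.
  rewrite FX; last by lia.
  by have -> : g%:Z - 1 + k.+1%:Z = g%:Z + k%:Z by lia.
have -> : g%:Z + k.+1%:Z - 1 = g%:Z + k%:Z by lia.
rewrite -!scalerBl !scalerA; congr (_ *: _).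
have uk : qn k.+1%:R \is a GRing.unit by rewrite qn_unit ?pnatr_eq0.
apply: (mulIr uk); rewrite mulrAC thS; set c := g%:Z%:~R : rat.
have -> : (g%:Z + k.+1%:Z)%:~R = c + k.+1%:R :> rat by rewrite intrD.
have -> : (g%:Z + k%:Z)%:~R = c + k%:R :> rat by rewrite intrD.
transitivity (th k * eh (k%:R / 2) * (br 1 * (Ec n (c + k.+1%:R) - Ec n c))); first by ring.
rewrite Ec_shift.
have -> : eh ((lam - 2 * c) / 2) - eh (- ((lam - 2 * (c + k%:R)) / 2)) =
    eh (k%:R / 2) * br (lam + 1 - 2 * c - k.+1%:R).
  by rewrite /br -natr1 mulrBr -!ehD; congr (eh _ - eh _); field.
by ring.
Qed.

(** The difference of the two sides telescopes: with A_k = theta_k [E, F^k], its k-th term is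
    A_{k+1} (x) E^(k+1) - A_k (x) E^k by [EF_comm_abs], and A_0 = A_{n+1} = 0. *)
Lemma intertwine_Th_abs : F ^+ n.+1 = 0 ->
  (\sum_(k < n.+1) tens (th k *: F ^+ k) (E ^+ k)) * (tens E 1 + tens K E) =
  (tens Ki E + tens E 1) * (\sum_(k < n.+1) tens (th k *: F ^+ k) (E ^+ k)).
Proof.
move=> F0; rewrite mulr_suml mulr_sumr.
pose A k := th k *: (E * F ^+ k - F ^+ k * E).
have AE k : A k.+1 = th k *: (F ^+ k * K - Ki * F ^+ k) := EF_comm_abs k.
have A0 : A 0%N = 0 by rewrite /A expr0 mulr1 mul1r subrr scaler0.
have An : A n.+1 = 0 by rewrite /A F0 mulr0 mul0r subrr scaler0.
apply/eqP; rewrite -subr_eq0 -sumrB.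
rewrite (eq_bigr (fun k : 'I_n.+1 => tens (A k.+1) (E ^+ k.+1) - tens (A k) (E ^+ k))); last first.
  move=> k _; rewrite commutatorD !tensM mulr1 mul1r -exprS -exprSr AE /A !scalerBr.
  rewrite [X in _ = X - _]tensBl [X in _ = _ - X]tensBl -!scalerAl -!scalerAr.
  exact: addr_shuffle.
have := telescope_sumr (fun k => tens (A k) (E ^+ k)) (leq0n n.+1).
rewrite big_mkord => ->; by rewrite An A0 !tens0l subrr.
Qed.
End Abstract.

Lemma rTh_E : rTh th * (tens rE 1 + tens rK rE) = (tens rKi rE + tens rE 1) * rTh th.
Proof.
apply: intertwine_Th_abs; first by move=> k g; apply: rFX_evec.
- exact: rE_evec.
- by move=> g; rewrite rdiag_evec.
- by move=> g; rewrite rdiag_evec.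
exact: rFX_eq0.
Qed.

Lemma rD_KiE : rD 1 * tens rKi rE = tens 1 rE * rD 1.
Proof.
apply/matrixP => i j; rewrite [LHS]rD_tens [RHS]tens_rD.
rewrite !mxE; case: eqP => [->|_]; last by rewrite !scale0r.
rewrite mulr1n scale1r; apply: evecP => g.
rewrite -scalemxAl !mulvA rE_evec -!scalemxAr !rdiag_evec -scalemxAr rE_evec !scalerA.
congr (_ *: _); rewrite mulrAC -ehD; congr (eh _ * _).
by rewrite intrB mulr1z; field.
Qed.

Lemma rD_E1 : rD 1 * tens rE 1 = tens rE rK * rD 1.
Proof.
apply/matrixP => i j; rewrite [LHS]rD_tens [RHS]tens_rD.
rewrite !mxE; case: eqP => [ij|_]; last by rewrite !scale0r.
congr (_ *: _); rewrite mulr1 rdiagM; congr rdiag; apply/funext => mu; rewrite -ehD; congr eh.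
by rewrite ij -natr1; field.
Qed.

Lemma rD_E : rD 1 * (tens rKi rE + tens rE 1) = (tens 1 rE + tens rE rK) * rD 1.
Proof. by rewrite [LHS]mulrDr [RHS]mulrDl rD_KiE rD_E1. Qed.

Lemma rD_KK : rD 1 * tens rK rK = tens rK rK * rD 1.
Proof.
apply/matrixP => i j; rewrite [LHS]rD_tens [RHS]tens_rD !mxE.
case: eqP => [->|_]; last by rewrite !scale0r.
by rewrite !rdiagM; congr (_ *: rdiag _); apply/funext => mu; rewrite mulrC.
Qed.

Definition rX (b : bool) : C := if b then rD 1 * rTh th else rTh th' * rD (- 1).

Lemma rX_inv : rX true * rX false = 1.
Proof. by rewrite /rX mulrA -[X in X * _]mulrA rTh_inv mulr1 rD_inv. Qed.

Lemma rho2_Rmat_inv : rho2 n Rmat^-1 = rX false.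
Proof.
have VR : rho2 n Rmat^-1 * rX true = 1.
  by rewrite -[rX true]/(rD 1 * rTh th) -rho2_Rmat -rho2M mulVr ?Rmat_unit // rho2_1.
by rewrite -[LHS]mulr1 -rX_inv mulrA VR mul1r.
Qed.

(** This is R Delta(E) = Delta^op(E) R. The quasi-R-matrix turns Delta(E) into K^-1 (x) E + E (x) 1,
    which the Cartan part turns into Delta^op(E). *)
Lemma rX_E : rX true * (tens rE 1 + tens rK rE) = (tens 1 rE + tens rE rK) * rX true.
Proof. by rewrite /rX -mulrA rTh_E mulrA rD_E mulrA. Qed.

Lemma rXV_conj (x y : C) : rX true * x = y * rX true -> x * rX false = rX false * y.
Proof.
move=> xy; have VX : rX false * rX true = 1 by rewrite -rho2_Rmat_inv -[rX true]/(rD 1 * rTh th) -rho2_Rmat -rho2M mulVr ?Rmat_unit // rho2_1.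
by rewrite -[x]mul1r -VX -[_ * _ * x]mulrA xy mulrA -[LHS]mulrA rX_inv mulr1.
Qed.

(** F^k (x) E^k has total weight zero. *)
Lemma Kdeg (E F K : B) k : 
  K * F = eh (- 1) *: (F * K) -> K * E = eh 1 *: (E * K) ->
  tens K K * tens (th k *: F ^+ k) (E ^+ k) = tens (th k *: F ^+ k) (E ^+ k) * tens K K.
Proof.
move=> KF KE; have FX j : K * F ^+ j = eh (- 1) ^+ j *: (F ^+ j * K).
  elim: j => [|j IH]; first by rewrite !expr0 scale1r mulr1 mul1r.
  by rewrite exprS mulrA KF -scalerAl -2!mulrA IH -scalerAr scalerA exprS.
have EX j : K * E ^+ j = eh 1 ^+ j *: (E ^+ j * K).
  elim: j => [|j IH]; first by rewrite !expr0 scale1r mulr1 mul1r.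
  by rewrite exprS mulrA KE -scalerAl -2!mulrA IH -scalerAr scalerA exprS.
have tZl c a b : tens (c *: a) b = tens a (c *: b) :> C.
  by apply/matrixP => i j; rewrite !mxE scalerA mulrC.
have tZ c d a b : tens (c *: a) (d *: b) = tens ((c * d) *: a) b :> C.
  by apply/matrixP => i j; rewrite !mxE scalerA mulrAC.
rewrite !tensM -scalerAr FX EX scalerA tZ -scalerAl; congr tens; congr (_ *: _).
by rewrite -mulrA -exprMn -ehD addNr eh0 expr1n mulr1.
Qed.

Lemma rK_F : rK * rF = eh (- 1) *: (rF * rK).
Proof.
apply: evecP => g; rewrite -scalemxAl !mulvA rF_evec // !rdiag_evec -scalemxAr rF_evec // scalerA -ehD.
by congr (eh _ *: _); rewrite intrD mulr1z; field.
Qed.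

Lemma rK_E : rK * rE = eh 1 *: (rE * rK).
Proof.
apply: evecP => g; rewrite -scalemxAl !mulvA rE_evec -scalemxAr !rdiag_evec -scalemxAr rE_evec !scalerA.
congr (_ *: _); rewrite -ehD mulrC; congr (eh _ * _).
by rewrite intrB mulr1z; field.
Qed.

Lemma rX_K : rX true * tens rK rK = tens rK rK * rX true.
Proof.
rewrite /rX -mulrA.
have -> : rTh th * tens rK rK = tens rK rK * rTh th.
  by rewrite mulr_suml mulr_sumr; apply: eq_bigr => k _; rewrite (Kdeg k rK_F rK_E).
by rewrite [LHS]mulrA [RHS]mulrA rD_KK.
Qed.

(** The ratio of the values at i+1 and i is minus the eigenvalue of K on e_i, as S(F) = -FK
    requires; [muV] is the inverse. *)
Definition mu (i : nat) : Qh := (-1) ^+ i * eh ((lam * i%:R - i%:R * (i%:R - 1)) / 2).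
Definition muV (i : nat) : Qh := (-1) ^+ i * eh (- ((lam * i%:R - i%:R * (i%:R - 1)) / 2)).

Lemma mu_muV i : mu i * muV i = 1.
Proof. by rewrite /mu /muV mulrACA -ehD subrr eh0 mulr1 -exprMn mulrNN mulr1 expr1n. Qed.

(* If a is the action of x on V then tau a is the action of S(x): the transpose of a, read
   through the isomorphism of V with its dual. *)
Definition tau (a : B) : B := \matrix_(i, j) (mu i * muV j * a (rev_ord j) (rev_ord i)).

Lemma tauM a b : tau (a * b) = tau b * tau a.
Proof.
apply/matrixP => i j; rewrite !mxE mulr_sumr (reindex_inj rev_ord_inj) /=; apply: eq_bigr => k _.
by rewrite !mxE -[X in X * _]mul1r -(mu_muV k); ring.
Qed.

Lemma tau1 : tau 1 = 1.
Proof.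
apply/matrixP => i j; rewrite !mxE (inj_eq rev_ord_inj) eq_sym; case: eqP => [->|_].
  by rewrite mu_muV mulr1.
by rewrite mulr0.
Qed.

Lemma tauD a b : tau (a + b) = tau a + tau b.
Proof. by apply/matrixP => i j; rewrite !mxE mulrDr. Qed.
Lemma tauZ c a : tau (c *: a) = c *: tau a.
Proof. by apply/matrixP => i j; rewrite !mxE mulrCA. Qed.

Lemma mu_step i : mu i * muV i.+1 = - eh (- ((lam - 2 * i%:R) / 2)).
Proof.
rewrite /mu /muV mulrACA -ehD -exprD addnS exprS -signr_odd addnn odd_double mulr1 mulN1r.
by congr (- eh _); rewrite -natr1; field.
Qed.
Lemma mu_step' i : mu i.+1 * muV i = - eh ((lam - 2 * i%:R) / 2).
Proof.
rewrite /mu /muV mulrACA -ehD -exprD addSn exprS -signr_odd addnn odd_double mulr1 mulN1r.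
by congr (- eh _); rewrite -natr1; field.
Qed.

Lemma natr_rev (j : 'I_n.+1) : (rev_ord j)%:R = lam - j%:R :> rat.
Proof. by rewrite /= subSS natrB // -ltnS. Qed.

Lemma tau_diag f : tau (rdiag f) = rdiag (fun x => f (- x)).
Proof.
apply/matrixP => i j; rewrite !mxE (inj_eq rev_ord_inj) eq_sym; case: eqP => [->|_].
  by rewrite mu_muV mul1r natr_rev; congr f; ring.
by rewrite mulr0.
Qed.

Lemma tau_K : tau rK = rKi.
Proof. by rewrite tau_diag; congr rdiag; apply/funext => x; rewrite mulNr. Qed.

Lemma diag_mul f a i j : (rdiag f * a) i j = f (lam - 2 * i%:R) * a i j.
Proof.
rewrite mxE (bigD1 i) //= mxE eqxx big1 ?addr0 // => k ki.
by rewrite mxE eq_sym (negPf ki) mul0r.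
Qed.
Lemma mul_diag f a i j : (a * rdiag f) i j = a i j * f (lam - 2 * j%:R).
Proof.
rewrite mxE (bigD1 j) //= mxE eqxx big1 ?addr0 // => k kj.
by rewrite mxE (negPf kj) mulr0.
Qed.

Lemma tau_E : tau rE = - (rKi * rE).
Proof.
apply/matrixP => i j; rewrite [RHS]mxE diag_mul !mxE.
have -> : (rev_ord i == (rev_ord j).+1 :> nat) = (j == i.+1 :> nat).
  by have := ltn_ord i; have := ltn_ord j; rewrite /=; lia.
case: eqP => [ji|_]; last by rewrite !mulr0 oppr0.
rewrite ji mu_step mulNr; congr (- (_ * _)); rewrite natr_rev /Ec mulrC -natr1.
by congr (qn _ * qn _); ring.
Qed.

Lemma tau_F : tau rF = - (rF * rK).
Proof.
apply/matrixP => i j; rewrite [RHS]mxE mul_diag !mxE.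
have -> : (rev_ord j == (rev_ord i).+1 :> nat) = (i == j.+1 :> nat).
  by have := ltn_ord i; have := ltn_ord j; rewrite /=; lia.
case: eqP => [ij|_]; last by rewrite mulr0 mul0r oppr0.
by rewrite mulr1 mul1r ij mu_step'.
Qed.

Lemma tau_prod (s : seq gen) : tau (\prod_(g <- s) rgen n g) = \prod_(g <- rev s) tau (rgen n g).
Proof.
elim: s => [|g s IH]; first by rewrite !big_nil tau1.
by rewrite big_cons tauM IH rev_cons -cats1 big_cat big_seq1.
Qed.

Lemma rho_antipode_gen g : rho n (antipode_gen g) = tau (rgen n g).
Proof.
have rhoN x : rho n (- x) = - rho n x by exact: raddfN.
case: g => /=; rewrite rhoN ?rhoM ?rho_letter ?rhoKi ?rhoK ?tau_E ?tau_F //= tau_diag.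
apply/matrixP => i j; rewrite !mxE; case: eqP => _; last by rewrite oppr0.
by apply: fpsP => -[|k]; rewrite fpsEN ?oppr0.
Qed.

Lemma rho_antipode (w : word) : rho n (antipode (monomial w)) = tau (rhow n w).
Proof.
rewrite /antipode /monomial fps_linU /rhow tau_prod.
set G := \prod_(g <- _) antipode_gen g.
have -> : Fps (fun k => 1 *: G k) = G by apply: fpsP => k /=; rewrite scale1r.
rewrite {}/G; apply: (etrans (rmorph_prod _ _ _ _)).
by apply: eq_bigr => g _; apply: rho_antipode_gen.
Qed.

End Intertwine.

(** * The state sum in a representation *)

Section Lin.
Variables (R : pzRingType) (U V : lmodType R).

Definition lin (f : U -> V) := forall c a b, f (c *: a + b) = c *: f a + f b.

Variable f : U -> V.
Hypothesis fl : lin f.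

Lemma linD a b : f (a + b) = f a + f b.
Proof. by rewrite -[a]scale1r fl !scale1r. Qed.
Lemma lin0 : f 0 = 0.
Proof. by apply: (addrI (f 0)); rewrite -linD !addr0. Qed.
Lemma linZ c a : f (c *: a) = c *: f a.
Proof. by rewrite -[c *: a]addr0 fl lin0 addr0. Qed.
Lemma lin_sum (I : Type) (r : seq I) (P : pred I) (F : I -> U) :
  f (\sum_(i <- r | P i) F i) = \sum_(i <- r | P i) f (F i).
Proof. by elim/big_rec2: _ => [|i x y _ <-]; rewrite ?lin0 ?linD. Qed.
End Lin.

Section SlotProduct.
Variables (R : comNzRingType) (U : lmodType R) (A : algType R) (S : eqType) (s : seq S) (y : S).
Hypotheses (us : uniq s) (ys : y \in s).

(** Since [y] occurs once in [s], the factors on its two sides depend on the other values only.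
    Linearity and signs in one slot of a noncommutative product follow. *)
Lemma prod_slot : exists p q : (S -> A) -> A,
  (forall c, \prod_(x <- rev s) c x = p c * c y * q c) /\
  (forall c c', {in s, forall x, x != y -> c x = c' x} -> p c = p c' /\ q c = q c').
Proof.
case/splitPr: ys us => s1 s2; rewrite cat_uniq /= => /and3P[_ /norP[ys1 _] /andP[ys2 _]].
exists (fun c => \prod_(x <- rev s2) c x), (fun c => \prod_(x <- rev s1) c x); split=> [c|c c' E].
  by rewrite rev_cat rev_cons -cats1 !big_cat big_seq1.
split; apply: eq_big_seq => x; rewrite mem_rev => xs; apply: E; rewrite ?mem_cat ?inE ?xs ?orbT //.
  by apply: contraNneq ys2 => <-.
by apply: contraNneq ys1 => <-.
Qed.

Lemma prod_lin (c : U -> S -> A) : (forall a x, x \in s -> x != y -> c a x = c 0 x) ->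
  lin (fun a => c a y) -> lin (fun a => \prod_(x <- rev s) c a x).
Proof.
move=> cE cl k a b; have [p [q [pq pqE]]] := prod_slot; rewrite !pq.
have E a' : p (c a') = p (c 0) /\ q (c a') = q (c 0) by apply: pqE => x; apply: cE.
have [-> ->] := E (k *: a + b); have [-> ->] := E a; have [-> ->] := E b.
by rewrite cl mulrDr mulrDl -scalerAr -scalerAl.
Qed.

Lemma prod_opp (c c' : S -> A) : {in s, forall x, x != y -> c x = c' x} -> c y = - c' y ->
  \prod_(x <- rev s) c x = - \prod_(x <- rev s) c' x.
Proof.
move=> cE cy; have [p [q [pq pqE]]] := prod_slot; rewrite !pq.
by have [-> ->] := pqE _ _ cE; rewrite cy mulrN mulNr.
Qed.
End SlotProduct.

Definition upd (V : Type) (st : nat -> V) (k : nat) (w : V) : nat -> V :=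
  fun j => if j == k then w else st j.

Lemma updC (V : Type) (st : nat -> V) k k' w w' : k != k' ->
  upd (upd st k w) k' w' = upd (upd st k' w') k w.
Proof.
move=> kk; apply/funext => j; rewrite /upd; case: eqP => // ->; case: eqP => // E.
by rewrite E eqxx in kk.
Qed.

Section StateSum.
Variable n : nat.
Local Notation B := 'M[Qh]_n.+1.
Local Notation C := 'M[B]_n.+1.

(** The value at the tensor X of the linear map induced by the bilinear map Psi, computed by
    expanding the first factor in matrix units. *)
Definition Ev (X : C) (Psi : B -> B -> B) : B := \sum_i \sum_j Psi (delta_mx i j) (X i j).
Definition bil (Psi : B -> B -> B) := (forall b, lin (Psi^~ b)) /\ (forall a, lin (Psi a)).

Lemma Ev_tens a b Psi : bil Psi -> Ev (tens a b) Psi = Psi a b.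
Proof.
move=> [l1 l2]; rewrite {2}[a]matrix_sum_delta (lin_sum (l1 b)); apply: eq_bigr => i _.
rewrite (lin_sum (l1 b)); apply: eq_bigr => j _.
by rewrite mxE (linZ (l2 _)) (linZ (l1 b)).
Qed.

Lemma Ev_sum (I : Type) (r : seq I) (P : pred I) (F : I -> C) Psi : bil Psi ->
  Ev (\sum_(i <- r | P i) F i) Psi = \sum_(i <- r | P i) Ev (F i) Psi.
Proof.
move=> [_ l2]; rewrite exchange_big /=; apply: eq_bigr => i _; rewrite exchange_big /=.
by apply: eq_bigr => j _; rewrite !summxE (lin_sum (l2 _)).
Qed.

Lemma EvD X Y Psi : bil Psi -> Ev (X + Y) Psi = Ev X Psi + Ev Y Psi.
Proof.
move=> [_ l2]; rewrite -big_split; apply: eq_bigr => i _; rewrite -big_split.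
by apply: eq_bigr => j _; rewrite mxE (linD (l2 _)).
Qed.

Lemma tens_decomp (X : C) : X = \sum_i \sum_j tens (delta_mx i j) (X i j).
Proof.
apply/matrixP => p r; rewrite summxE (bigD1 p) //= [Y in _ + Y]big1 ?addr0; last first.
  by move=> i ip; rewrite summxE big1 // => j _; rewrite !mxE eq_sym (negPf ip) scale0r.
rewrite summxE (bigD1 r) //= [Y in _ + Y]big1 ?addr0; first by rewrite !mxE !eqxx scale1r.
by move=> j jr; rewrite !mxE eqxx [r == j]eq_sym (negPf jr) scale0r.
Qed.

Lemma Ev_mull p r X Psi : bil Psi -> Ev (tens p r * X) Psi = Ev X (fun a b => Psi (p * a) (r * b)).
Proof.
move=> bP; rewrite [X in tens p r * X]tens_decomp mulr_sumr Ev_sum //; apply: eq_bigr => i _.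
by rewrite mulr_sumr Ev_sum //; apply: eq_bigr => j _; rewrite tensM Ev_tens.
Qed.

Lemma Ev_mulr p r X Psi : bil Psi -> Ev (X * tens p r) Psi = Ev X (fun a b => Psi (a * p) (b * r)).
Proof.
move=> bP; rewrite [X in X * tens p r]tens_decomp mulr_suml Ev_sum //; apply: eq_bigr => i _.
by rewrite mulr_suml Ev_sum //; apply: eq_bigr => j _; rewrite tensM Ev_tens.
Qed.

Lemma Ev_lin X c Psi Psi' :
  Ev X (fun a b => c *: Psi a b + Psi' a b) = c *: Ev X Psi + Ev X Psi'.
Proof.
rewrite /Ev scaler_sumr -big_split; apply: eq_bigr => i _.
by rewrite scaler_sumr -big_split.
Qed.

(** The infinite sum over words at a crossing becomes finite in V_n: the entries of Psi are finite
    combinations of products of matrix coefficients, whose extensions are the entries of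
    [rho2 n x]. *)
Lemma rho_fps_lin (G : word * word -> free) (Psi : B -> B -> B) x : bil Psi ->
  (forall w, rho n (G w) = Psi (rhow n w.1) (rhow n w.2)) -> rho n (fps_lin G x) = Ev (rho2 n x) Psi.
Proof.
move=> [l1 l2] GP; apply/matrixP => p r; rewrite mxE ext_fps_lin.
pose F := ('I_n.+1 * 'I_n.+1)%type.
have PE a b : Psi a b p r = \sum_(K : F * F)
    Psi (delta_mx K.1.1 K.1.2) (delta_mx K.2.1 K.2.2) p r * (a K.1.1 K.1.2 * b K.2.1 K.2.2).
  rewrite {1}[a]matrix_sum_delta pair_bigA (lin_sum (l1 b)) /=.
  rewrite {1}[b]matrix_sum_delta pair_bigA summxE.
  rewrite -(pair_bigA _ (fun K1 K2 : F => Psi (delta_mx K1.1 K1.2) (delta_mx K2.1 K2.2) p r *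
     (a K1.1 K1.2 * b K2.1 K2.2))) /=.
  apply: eq_bigr => K1 _; rewrite (linZ (l1 _)) (lin_sum (l2 _)) mxE summxE mulr_sumr.
  by apply: eq_bigr => K2 _; rewrite (linZ (l2 _)) mxE mulrA mulrC.
have -> : (fun m => ext (fun w => rhow n w p r) (G m)) = fun w => \sum_(K : F * F)
    Psi (delta_mx K.1.1 K.1.2) (delta_mx K.2.1 K.2.2) p r * (rhow n w.1 K.1.1 K.1.2 * rhow n w.2 K.2.1 K.2.2).
  by apply/funext => w; have := congr1 (fun X : B => X p r) (GP w); rewrite mxE => ->; rewrite PE.
rewrite ext_sum -(pair_bigA _ (fun K1 K2 : F => Psi (delta_mx K1.1 K1.2) (delta_mx K2.1 K2.2) p r *
     ext (fun w => rhow n w.1 K1.1 K1.2 * rhow n w.2 K2.1 K2.2) x)) /=.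
rewrite /Ev [in RHS]pair_bigA [RHS]summxE; apply: eq_bigr => K1 _.
rewrite [rho2 n x _ _]matrix_sum_delta pair_bigA (lin_sum (l2 _)) summxE.
by apply: eq_bigr => K2 _; rewrite (linZ (l2 _)) !mxE mulrC.
Qed.

Variable X : nat -> C.

Fixpoint tensor_sum (cs : seq nat) (Gam : (nat -> B * B) -> B) (st : nat -> B * B) : B :=
  if cs is k :: cs' then Ev (X k) (fun a b => tensor_sum cs' Gam (upd st k (a, b))) else Gam st.

Lemma esum_lin cs c G G' st :
  tensor_sum cs (fun st => c *: G st + G' st) st = c *: tensor_sum cs G st + tensor_sum cs G' st.
Proof.
elim: cs st => //= k cs IH st; rewrite -Ev_lin; congr Ev.
by apply/funext => a; apply/funext => b; apply: IH.
Qed.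

Lemma esumD cs G G' st : tensor_sum cs (fun st => G st + G' st) st = tensor_sum cs G st + tensor_sum cs G' st.
Proof.
rewrite -[tensor_sum cs G st]scale1r -esum_lin; congr tensor_sum.
by apply/funext => st'; rewrite scale1r.
Qed.

Lemma esum0 cs st : tensor_sum cs (fun=> 0) st = 0.
Proof. by have := esum_lin cs (- 1) (fun=> 0) (fun=> 0) st; rewrite scaler0 addr0 scaleN1r addNr. Qed.

Lemma esum_sum (I : Type) (r : seq I) cs (G : I -> (nat -> B * B) -> B) st :
  tensor_sum cs (fun st => \sum_(i <- r) G i st) st = \sum_(i <- r) tensor_sum cs (G i) st.
Proof.
elim: r => [|i r IH].
  by rewrite [RHS]big_nil -[RHS](esum0 cs st); congr tensor_sum; apply/funext => st'; rewrite big_nil.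
by rewrite [RHS]big_cons -IH -esumD; congr tensor_sum; apply/funext => st'; rewrite big_cons.
Qed.

Lemma esum_mul cs p r G st : tensor_sum cs (fun st => p * G st * r) st = p * tensor_sum cs G st * r.
Proof.
elim: cs st => //= k cs IH st; rewrite /Ev mulr_sumr mulr_suml; apply: eq_bigr => i _.
by rewrite mulr_sumr mulr_suml; apply: eq_bigr => j _; apply: IH.
Qed.

Lemma esum_upd cs k w G st : k \notin cs ->
  tensor_sum cs G (upd st k w) = tensor_sum cs (fun st => G (upd st k w)) st.
Proof.
elim: cs st => //= k' cs IH st; rewrite inE negb_or => /andP[kk kcs]; congr Ev.
by apply/funext => a; apply/funext => b; rewrite updC // IH.
Qed.

Definition slotbil (k : nat) (G : (nat -> B * B) -> B) :=
  forall st, bil (fun a b => G (upd st k (a, b))).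

Lemma esum_slotbil cs k G : k \notin cs -> slotbil k G -> slotbil k (tensor_sum cs G).
Proof.
move=> kcs Gb st; split=> [b c a a'|a c b b']; rewrite !esum_upd // -esum_lin; congr tensor_sum;
  by apply/funext => st'; have [l1 l2] := Gb st'; rewrite ?(l1 b) ?(l2 a).
Qed.

Lemma Ev_esum cs k G st Y : k \notin cs ->
  Ev Y (fun a b => tensor_sum cs G (upd st k (a, b))) = tensor_sum cs (fun st => Ev Y (fun a b => G (upd st k (a, b)))) st.
Proof.
move=> kcs; rewrite /Ev esum_sum; apply: eq_bigr => i _; rewrite esum_sum; apply: eq_bigr => j _.
exact: esum_upd.
Qed.

(** The sum at crossing [k] can be carried out first ([Ev_esum]), so two integrands need only agree
    after summation over that crossing. *)
Lemma esum_local cs k G G' : uniq cs -> k \in cs ->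
  (forall st, Ev (X k) (fun a b => G (upd st k (a, b))) = Ev (X k) (fun a b => G' (upd st k (a, b)))) ->
  forall st, tensor_sum cs G st = tensor_sum cs G' st.
Proof.
move=> + + GG; elim: cs => //= k' cs IH /andP[k'cs ucs]; rewrite inE => /orP[/eqP kE|kcs] st.
  by rewrite -kE in k'cs *; rewrite !Ev_esum //; congr tensor_sum; apply/funext.
by congr Ev; apply/funext => a; apply/funext => b; apply: IH.
Qed.
End StateSum.


Section WalkSum.
Variables (T : diagram) (n : nat).
Hypotheses (hB : bottom_diagram T) (hC : one_component T).
Local Notation B := 'M[Qh]_n.+1.
Local Notation C := 'M[B]_n.+1.
Local Notation rK := (rK n).
Local Notation rKi := (rKi n).
Local Notation steps := (walk_path T).
Local Notation dw := (dw T).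
Local Notation pass := (pass T).

Definition positive k : bool := if (slice T k).2 is CrossPos then true else false.
Definition X k : C := rX n (positive k).
Definition crossings : seq nat := [seq k <- iota 0 (size T) | is_crossing T k].

Lemma cs_uniq : uniq crossings. Proof. by rewrite filter_uniq ?iota_uniq. Qed.
Lemma csP k : k \in crossings = is_crossing T k.
Proof.
rewrite mem_filter mem_iota add0n; case ck: (is_crossing T k) => //=.
exact: is_crossing_lt.
Qed.

Definition orient (d : bool) (a : B) : B := if d then a else tau a.

Lemma orient_lin d : lin (orient d).
Proof. by case: d => c a b //=; rewrite /orient tauD tauZ. Qed.
Lemma orientM d a b : orient d (a * b) = if d then a * b else tau b * tau a.
Proof. by case: d; rewrite /orient ?tauM. Qed.

Definition bead_mx (st : nat -> B * B) (x : position) : B :=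
  match event_at T x with
  | Some (AtCrossing k s d) => orient d (if s == positive k then (st k).1 else (st k).2)
  | Some (AtMin ltr) => if ltr then rKi else 1
  | Some (AtMax ltr) => if ltr then rK else 1
  | None => 1
  end.

Definition conv (st : nat -> word * word) (k : nat) : B * B := (rhow n (st k).1, rhow n (st k).2).

Lemma rho_bead st x :
  rho n (if event_at T x is Some e then bead T st e else 1) = bead_mx (conv st) x.
Proof.
rewrite /bead_mx; case E: (event_at T x) => [[k s d|[]|[]]|] /=; rewrite ?rho_1 ?rhoKi ?rhoK //.
have [ck _] := evt_crossing E.
have -> : (match (slice T k).2 with CrossPos => s | _ => ~~ s end) = (s == positive k).
  by rewrite /positive; case: (slice T k).2; case: (s).
by case: d {E}; rewrite ?rho_monomial ?rho_antipode; case: ifP.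
Qed.

Lemma bm_xl st : bead_mx st xl = 1. Proof. by []. Qed.

Lemma rho_bead_product st :
  rho n (bead_product T st) = \prod_(x <- rev steps) bead_mx (conv st) x.
Proof.
have -> : bead_product T st = \prod_(x <- rev (walk T)) (if event_at T x is Some e then bead T st e else 1).
  rewrite /bead_product /events; elim: (walk T) => [|x s IH] /=; first by rewrite !big_nil.
  rewrite [rev (x :: s)]rev_cons -cats1 big_cat big_seq1 -IH /event_at /=.
  by case: (advance T x).1 => [e|] /=; rewrite ?mulr1 // rev_cons -cats1 big_cat big_seq1.
rewrite (walk_rcons hC) rev_rcons big_cons mul1r.
by apply: (etrans (rmorph_prod _ _ _ _)); apply: eq_bigr => x _; apply: rho_bead.
Qed.

Definition bead_mx_prod (L R : position -> B) (st : nat -> B * B) : B :=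
  \prod_(x <- rev steps) (L x * bead_mx st x * R x).

Lemma bm_upd st k w x s0 : is_crossing T k -> x \in steps -> x != pass k s0 (dw k s0) ->
  forall w', (if s0 == positive k then w.2 = w'.2 else w.1 = w'.1) -> bead_mx (upd st k w) x = bead_mx (upd st k w') x.
Proof.
move=> ck xs xp w' ww; rewrite /bead_mx; case E: (event_at T x) => [[k' s d|//|//]|//].
rewrite /upd; case: (eqVneq k' k) => [kk|//]; rewrite kk in E *.
have [_ dE xE] := walk_evt_crossing hB hC (steps_walk hC xs) E.
have ss : s != s0 by apply: contraNneq xp => <-; rewrite -xE.
move: ww ss; rewrite eq_sym; by case: (s0); case: (s); case: (positive k) => //= -> _.
Qed.

Lemma bm_pass st k s w : is_crossing T k ->
  bead_mx (upd st k w) (pass k s (dw k s)) = orient (dw k s) (if s == positive k then w.1 else w.2).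
Proof. by move=> ck; rewrite /bead_mx /event_at advance_pass //= /upd eqxx. Qed.

Lemma pass_steps k s : is_crossing T k -> pass k s (dw k s) \in steps.
Proof.
move=> ck; apply: walk_steps => //; first exact: pass_walk.
by rewrite /pass; case: (dw k s).
Qed.

(** Each of the two beads of crossing [k] sits on exactly one step of the walk. *)
Lemma Gam_slotbil L R k : is_crossing T k -> slotbil k (bead_mx_prod L R).
Proof.
move=> ck st.
have key (w : B -> B * B) s : 
    (forall a, if s == positive k then (w a).2 = (w 0).2 else (w a).1 = (w 0).1) ->
    lin (fun a => if s == positive k then (w a).1 else (w a).2) -> lin (fun a => bead_mx_prod L R (upd st k (w a))).
  move=> wE wl; apply: (@prod_lin _ _ _ _ _ (pass k s (dw k s)) (steps_uniq hC) (pass_steps s ck)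
    (fun a x => L x * bead_mx (upd st k (w a)) x * R x)).
    by move=> a x xs xp; rewrite (@bm_upd st k (w a) x s ck xs xp (w 0) (wE a)).
  move=> c a b; rewrite !bm_pass // wl (orient_lin _) mulrDr mulrDl.
  by rewrite -scalerAr -scalerAl.
split=> [b|a].
  by apply: (key (fun a => (a, b)) (positive k)); rewrite eqxx.
by apply: (key (fun b => (a, b)) (~~ positive k)); case: (positive k).
Qed.

Lemma rho_state_sum cs' st : uniq cs' -> all (is_crossing T) cs' ->
  rho n (state_sum T cs' st) = tensor_sum X cs' (bead_mx_prod (fun=> 1) (fun=> 1)) (conv st).
Proof.
elim: cs' st => [|k cs' IH] st /=.
  move=> _ _; rewrite rho_bead_product; apply: eq_bigr => x _.
  by rewrite mul1r mulr1.
move=> /andP[kcs ucs] /andP[ck ccs].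
rewrite (@rho_fps_lin _ _ (fun a b => tensor_sum X cs' (bead_mx_prod (fun=> 1) (fun=> 1)) (upd (conv st) k (a, b)))).
- rewrite /crossing_tensor /X /positive; case: (slice T k).2; by rewrite ?rho2_Rmat ?rho2_Rmat_inv.
- exact: esum_slotbil kcs (Gam_slotbil _ _ ck) _.
move=> w; rewrite IH //; congr tensor_sum; apply/funext => j; rewrite /conv /upd.
by case: eqP.
Qed.

Lemma rhoUh_J : rhoUh n (J T) = tensor_sum X crossings (bead_mx_prod (fun=> 1) (fun=> 1)) (conv (fun=> (mone, mone))).
Proof. by rewrite rhoUh_class rho_state_sum ?cs_uniq // /crossings filter_all. Qed.
End WalkSum.

(** * The universal invariant acts by a scalar *)

(** An insertion at a point can be attached to the step leaving the point (when [own] holds) or to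
    the step arriving there; regrouping changes the product only at its two ends. *)
Lemma prod_own (R : pzRingType) (S : Type) (f : S -> S) (b u : S -> R) (own : pred S) m y :
  (\prod_(x <- rev (traject f y m)) ((if own (f x) then 1 else u (f x)) * b x * (if own x then u x else 1)))
    * (if own y then 1 else u y) =
  (if own (iter m f y) then 1 else u (iter m f y)) * \prod_(x <- rev (traject f y m)) (b x * u x).
Proof.
elim: m y => [|m IH] y; first by rewrite !big_nil mul1r mulr1.
rewrite trajectS rev_cons -cats1 !big_cat !big_seq1 iterSr [RHS]mulrA -IH -!mulrA.
by congr (_ * (_ * (_ * _))); case: (own y); rewrite ?mul1r ?mulr1.
Qed.

Lemma sum_skip2 (V : zmodType) (F H : nat -> V) w i : (i <= w)%N ->
  (forall j, (j < i)%N -> F j = H j) -> (forall j, (i <= j)%N -> F j.+2 = H j) ->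
  F i + F i.+1 = 0 -> \sum_(0 <= j < w.+2) F j = \sum_(0 <= j < w) H j.
Proof.
move=> iw Fl Fh F0; rewrite (@big_cat_nat _ _ _ i) //=; last by lia.
rewrite [RHS](@big_cat_nat _ _ _ i) //=; congr (_ + _).
  by apply: eq_big_nat => j /andP[_ /Fl].
rewrite big_ltn; last by lia.
rewrite big_ltn; last by lia.
rewrite addrA F0 add0r !big_add1 /=.
by apply: eq_big_nat => j /andP[/Fh].
Qed.

Lemma sum_two (V : zmodType) (F H : nat -> V) w i : (i.+1 < w)%N ->
  (forall j, j != i -> j != i.+1 -> F j = H j) -> F i + F i.+1 = H i + H i.+1 ->
  \sum_(0 <= j < w) F j = \sum_(0 <= j < w) H j.
Proof.
move=> iw FH E; have split G : \sum_(0 <= j < w) G j = \sum_(0 <= j < i) G j + (G i + G i.+1) +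
    \sum_(i.+2 <= j < w) G j :> V.
  rewrite (@big_cat_nat _ _ _ i) //=; last by lia.
  rewrite [X in _ + X]big_ltn; last by lia.
  by rewrite [X in _ + (_ + X)]big_ltn // !addrA.
rewrite !split E; congr (_ + _ + _); apply: eq_big_nat => j /andP[h1 h2]; apply: FH; lia.
Qed.

(** * Moving insertions through one slice *)

Section Insert.
Variables (T : diagram) (n : nat).
Hypotheses (hB : bottom_diagram T) (hC : one_component T).
Local Notation B := 'M[Qh]_n.+1.
Local Notation C := 'M[B]_n.+1.
Local Notation rE := (rE n).
Local Notation rK := (rK n).
Local Notation rKi := (rKi n).
Local Notation steps := (walk_path T).
Local Notation nxt := (next_position T).
Local Notation evt := (event_at T).
Local Notation bm := (@bead_mx T n).
Local Notation Gam := (@bead_mx_prod T n).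
Local Notation X := (X T n).
Local Notation esum := (tensor_sum X (crossings T)).
Local Notation st0 := (nat -> B * B).

(* The slice through which a step goes. *)
Definition via (x : position) : nat := if x.2 then x.1.1.-1 else x.1.1.
(** The steps through slice [l] which run along the crossing or the extremum, not along a vertical
    line. *)
Definition isP (l : nat) (x : position) := (via x == l) && (if evt x is Some _ then true else false).

Lemma via_level x : x \in steps -> x.1.1 = if x.2 then (via x).+1 else via x.
Proof. by case: x => [[l j] []] //= /(steps_down hC); case: l. Qed.

Lemma nxt_level x : x \in steps -> (nxt x).1.1 = if (nxt x).2 then via x else (via x).+1.
Proof.
case: x => [[l j] []]; rewrite /nxt ?advU.
  move=> /(steps_down hC); case: l => // l _; rewrite /via /= /go_down.
  by case: (slice T l) => i [] //=; do 2?[case: ifP => //=].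
by move=> _; rewrite /via /go_up /=; case: (slice T l) => i [] //=; do 2?[case: ifP => //=].
Qed.

(** The element [u j] is put on the j-th string at level [l], through the antipode if the string
    goes up there. *)
Definition ins (u : nat -> B) (l : nat) (x : position) : B :=
  if x.1.1 == l then orient x.2 (u x.1.2) else 1.

Definition GG u l (st : st0) : B := \prod_(x <- rev (walk T)) (bm st x * ins u l x).

(** Insertions at level [l] ([Ll], [Rl]) or at level [l.+1] ([Lh], [Rh]), attached in both cases to
    the steps through slice [l]: R at the start of the step, L at its end. The two products then
    differ at these steps only. *)
Definition Ll u l x := if ~~ (nxt x).2 then 1 else ins u l (nxt x).
Definition Rl u l x := if ~~ x.2 then ins u l x else 1.
Definition Lh u l x := if (nxt x).2 then 1 else ins u l.+1 (nxt x).
Definition Rh u l x := if x.2 then ins u l.+1 x else 1.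

Lemma GG_own u l st (own : pred position) : (own x0) || (ins u l x0 == 1) ->
  ~~ own xl || (ins u l xl == 1) -> GG u l st =
  Gam (fun x => if own (nxt x) then 1 else ins u l (nxt x)) (fun x => if own x then ins u l x else 1) st.
Proof.
move=> h0 hl; have := prod_own nxt (bm st) (ins u l) own (npts T).-1 x0.
rewrite last_walk // -/steps.
have -> : (if own x0 then 1 else ins u l x0) = 1 by move: h0; case: ifP => //= _ /eqP.
have -> : (if own xl then 1 else ins u l xl) = ins u l xl by move: hl; case: ifP => //= _ /eqP.
by rewrite mulr1 /Gam => ->; rewrite /GG (walk_rcons hC) rev_rcons big_cons bm_xl mul1r.
Qed.

Lemma GG_low u l st : GG u l st = Gam (Ll u l) (Rl u l) st.
Proof. exact: (@GG_own u l st (fun x => ~~ x.2)). Qed.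

Lemma GG_high u l st : GG u l.+1 st = Gam (Lh u l) (Rh u l) st.
Proof. by apply: (@GG_own u l.+1 st (fun x => x.2)); rewrite /= /ins /= eqxx ?orbT. Qed.

Definition lowf u l st x : B := Ll u l x * bm st x * Rl u l x.
Definition highf u l st x : B := Lh u l x * bm st x * Rh u l x.

Lemma low_far u l st x : x \in steps -> via x != l -> lowf u l st x = bm st x.
Proof.
move=> xs xl; rewrite /lowf /Ll /Rl /ins nxt_level // via_level //.
by case: (nxt x).2; case: x.2; rewrite /= ?(negPf xl) ?mul1r ?mulr1.
Qed.

Lemma high_far u l st x : x \in steps -> via x != l -> highf u l st x = bm st x.
Proof.
move=> xs xl; rewrite /highf /Lh /Rh /ins nxt_level // via_level //.
by case: (nxt x).2; case: x.2; rewrite /= ?eqSS ?(negPf xl) ?mul1r ?mulr1.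
Qed.

Lemma lowE u st x : x \in steps -> lowf u (via x) st x =
  (if (nxt x).2 then u (nxt x).1.2 else 1) * bm st x * (if x.2 then 1 else tau (u x.1.2)).
Proof.
move=> xs; rewrite /lowf /Ll /Rl /ins nxt_level // via_level //.
by case: (nxt x).2; case: x.2; rewrite /= ?eqxx.
Qed.

Lemma highE u st x : x \in steps -> highf u (via x) st x =
  (if (nxt x).2 then 1 else tau (u (nxt x).1.2)) * bm st x * (if x.2 then u x.1.2 else 1).
Proof.
move=> xs; rewrite /highf /Lh /Rh /ins nxt_level // via_level //.
by case: (nxt x).2; case: x.2; rewrite /= ?eqxx.
Qed.

(* A vertical step joins the a-th point of its lower level to the b-th point of its
   upper level. *)
Lemma vertical x st : x \in steps -> evt x = None -> exists a b,
  [/\ forall u, lowf u (via x) st x = orient x.2 (u a),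
      forall u, highf u (via x) st x = orient x.2 (u b) &
      let: (i, c) := slice T (via x) in
      match c with
      | LocalMin => (b < i /\ a = b)%N \/ (i <= a /\ b = a.+2)%N
      | LocalMax => (a < i /\ b = a)%N \/ (i <= b /\ a = b.+2)%N
      | _ => [/\ a = b, a != i & a != i.+1]
      end].
Proof.
move=> xs ex; have bx : bm st x = 1 by rewrite /bm ex.
exists (if x.2 then (nxt x).1.2 else x.1.2), (if x.2 then x.1.2 else (nxt x).1.2).
suff [nx] : (nxt x).2 = x.2 /\ let: (i, c) := slice T (via x) in
  let a := if x.2 then (nxt x).1.2 else x.1.2 in let b := if x.2 then x.1.2 else (nxt x).1.2 in
      match c with
      | LocalMin => (b < i /\ a = b)%N \/ (i <= a /\ b = a.+2)%N
      | LocalMax => (a < i /\ b = a)%N \/ (i <= b /\ a = b.+2)%N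
      | _ => [/\ a = b, a != i & a != i.+1]
      end.
  move=> H; split=> //= u; rewrite ?lowE ?highE // nx bx; by case: x.2; rewrite ?mulr1 ?mul1r.
move: ex; case: x xs {bx} => [[l j] []] xs; rewrite /evt /nxt ?advU.
  have := steps_down hC xs; case: l {xs} => // l _; rewrite /via /= /go_down.
  by case: (slice T l) => i [] //=; do 3?[case: ifP => //=]; do ?[by split=> //; split=> //; lia]; lia.
rewrite /via /go_up /=.
by case: (slice T l) => i [] //=; do 3?[case: ifP => //=]; lia.
Qed.

Lemma cross_pass x : x \in steps -> is_crossing T (via x) -> (if evt x is Some _ then true else false) ->
  exists s, evt x = Some (AtCrossing (via x) s (dw T (via x) s)) /\ x = pass T (via x) s (dw T (via x) s).
Proof.
move=> xs ck; have lv := via_level xs; have xw := steps_walk hC xs.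
have H : (if evt x is Some _ then true else false) -> exists s d, evt x = Some (AtCrossing (via x) s d).
  move: ck lv; case: x {xs xw} => [[l j] []]; rewrite /evt ?advU /via /=.
    case: l => // l /=; rewrite /is_crossing /go_down; case: (slice T l) => i [] //= _ _;
      (case: ifP => _ /=; [by exists true, true|case: ifP => _ //=; by exists false, true]).
  rewrite /is_crossing /go_up; case: (slice T l) => i [] //= _ _;
    (case: ifP => _ /=; [by exists false, false|case: ifP => _ //=; by exists true, false]).
move=> /H[s [d E]]; exists s; have [_ dE xE] := walk_evt_crossing hB hC xw E.
by rewrite E -dE; split=> //; rewrite {1}xE dE.
Qed.

(** As [tau] reverses products, an insertion at the lower end of a string multiplies the bead on the
    left whichever way the string runs; at the upper end, on the right. *)
Lemma low_pass u st l s : is_crossing T l -> lowf u l st (pass T l s (dw T l s)) =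
  orient (dw T l s) (u (jl T l s) * (if s == positive T l then (st l).1 else (st l).2)).
Proof.
move=> cl; set a := (X in u _ * X).
have E : bm st (pass T l s (dw T l s)) = orient (dw T l s) a by rewrite /bm /evt advance_pass.
rewrite /lowf E /Ll /Rl /ins /nxt advance_pass // orientM.
by rewrite /pass; case: (dw T l s); rewrite /= eqxx /orient ?mulr1 ?mul1r.
Qed.

Lemma high_pass u st l s : is_crossing T l -> highf u l st (pass T l s (dw T l s)) =
  orient (dw T l s) ((if s == positive T l then (st l).1 else (st l).2) * u (ju T l s)).
Proof.
move=> cl; set a := (X in X * u _).
have E : bm st (pass T l s (dw T l s)) = orient (dw T l s) a by rewrite /bm /evt advance_pass.
rewrite /highf E /Lh /Rh /ins /nxt advance_pass // orientM.
by rewrite /pass; case: (dw T l s); rewrite /= eqxx /orient ?mulr1 ?mul1r.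
Qed.

(** The insertions left on the vertical lines, once those at the crossing have been moved into its
    tensor. *)
Definition Lm u l x := if isP l x then 1 else Ll u l x.
Definition Rm u l x := if isP l x then 1 else Rl u l x.

Lemma bm_upd_far st l w x : ~~ isP l x -> bm (upd st l w) x = bm st x.
Proof.
rewrite /isP /bm; case E: (evt x) => [[k s d| |]|] //; rewrite andbT => vl.
rewrite /upd; case: (eqVneq k l) => // kl; have [_ xE] := evt_crossing E.
by rewrite xE kl /via /pass in vl; case: d vl {E xE} => /=; rewrite eqxx.
Qed.

Lemma bm_upd_pass st l w s : is_crossing T l -> bm (upd st l w) (pass T l s (dw T l s)) =
  orient (dw T l s) (if s == positive T l then w.1 else w.2).
Proof. exact: bm_pass. Qed.

Lemma cross_low u st l a b : is_crossing T l ->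
  Gam (Ll u l) (Rl u l) (upd st l (a, b)) =
  Gam (Lm u l) (Rm u l) (upd st l (u (jl T l (positive T l)) * a, u (jl T l (~~ positive T l)) * b)).
Proof.
move=> cl; apply: eq_big_seq => x; rewrite mem_rev => xs; rewrite -/(lowf u l _ x) /Lm /Rm.
case: ifP => [/andP[/eqP vl ex]|/negbT nP]; last by rewrite /lowf !bm_upd_far.
have [|s [_ xE]] := cross_pass xs _ ex; [by rewrite vl|rewrite vl in xE].
rewrite mul1r mulr1 xE low_pass // bm_upd_pass // /upd eqxx.
by case: s {xE}; case: (positive T l).
Qed.

Definition agree (l : nat) (u u' : nat -> B) :=
  forall j, j != (slice T l).1 -> j != (slice T l).1.+1 -> u j = u' j.

Lemma cross_vertical u st l x : is_crossing T l -> x \in steps -> ~~ isP l x -> lowf u l st x = highf u l st x.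
Proof.
move=> cl xs nP; case: (eqVneq (via x) l) => vl; last by rewrite low_far ?high_far.
have ex : evt x = None by move: nP; rewrite /isP vl eqxx; case: (evt x).
rewrite -vl in cl *; have [a [b [-> ->]]] := vertical st xs ex.
by move: cl; rewrite /is_crossing; case: (slice T (via x)) => i [] // _ [->].
Qed.

Lemma agree_vertical u u' st l x : is_crossing T l -> agree l u u' -> x \in steps -> ~~ isP l x ->
  lowf u l st x = lowf u' l st x.
Proof.
move=> cl uu xs nP; case: (eqVneq (via x) l) => vl; last by rewrite !low_far.
have ex : evt x = None by move: nP; rewrite /isP vl eqxx; case: (evt x).
rewrite -vl in cl uu *; have [a [b [lE _]]] := vertical st xs ex; rewrite !lE.
move: cl uu; rewrite /is_crossing /agree; case: (slice T (via x)) => i [] //= _ uu [_ ai ai1]; by rewrite uu.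
Qed.

Lemma agree_refl l u : agree l u u. Proof. by []. Qed.

Lemma cross_high u u' st l a b : is_crossing T l -> agree l u u' ->
  Gam (Lh u l) (Rh u l) (upd st l (a, b)) =
  Gam (Lm u' l) (Rm u' l) (upd st l (a * u (ju T l (positive T l)), b * u (ju T l (~~ positive T l)))).
Proof.
move=> cl uu; apply: eq_big_seq => x; rewrite mem_rev => xs; rewrite -/(highf u l _ x) /Lm /Rm.
case: ifP => [/andP[/eqP vl ex]|/negbT nP]; last first.
  by rewrite -cross_vertical // (@agree_vertical _ _ _ _ _ cl uu) // /lowf !bm_upd_far.
have [|s [_ xE]] := cross_pass xs _ ex; [by rewrite vl|rewrite vl in xE].
rewrite mul1r mulr1 xE high_pass // bm_upd_pass // /upd eqxx.
by case: s {xE}; case: (positive T l).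
Qed.

Lemma Gm_agree u u' st l : is_crossing T l -> agree l u u' ->
  Gam (Lm u l) (Rm u l) st = Gam (Lm u' l) (Rm u' l) st.
Proof.
move=> cl uu; apply: eq_big_seq => x; rewrite mem_rev => xs; rewrite /Lm /Rm.
case: ifP => // /negbT nP; exact: agree_vertical.
Qed.

Local Notation slotb := (Gam_slotbil hB hC).

Lemma Ev_low l u u' st Y : is_crossing T l -> agree l u u' ->
  Ev Y (fun a b => Gam (Ll u l) (Rl u l) (upd st l (a, b))) =
  Ev (tens (u (jl T l (positive T l))) (u (jl T l (~~ positive T l))) * Y)
     (fun a b => Gam (Lm u' l) (Rm u' l) (upd st l (a, b))).
Proof.
move=> cl uu; rewrite Ev_mull; last exact: slotb.
by congr Ev; apply/funext => a; apply/funext => b; rewrite cross_low // (Gm_agree _ cl uu).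
Qed.

Lemma Ev_high l u u' st Y : is_crossing T l -> agree l u u' ->
  Ev Y (fun a b => Gam (Lh u l) (Rh u l) (upd st l (a, b))) =
  Ev (Y * tens (u (ju T l (positive T l))) (u (ju T l (~~ positive T l))))
     (fun a b => Gam (Lm u' l) (Rm u' l) (upd st l (a, b))).
Proof.
move=> cl uu; rewrite Ev_mulr; last exact: slotb.
by congr Ev; apply/funext => a; apply/funext => b; rewrite (cross_high _ _ _ cl uu).
Qed.

Lemma Z_GG u l st : esum (GG u l) st = esum (Gam (Ll u l) (Rl u l)) st.
Proof. by congr tensor_sum; apply/funext => st'; rewrite GG_low. Qed.
Lemma Z_GGh u l st : esum (GG u l.+1) st = esum (Gam (Lh u l) (Rh u l)) st.
Proof. by congr tensor_sum; apply/funext => st'; rewrite GG_high. Qed.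

Lemma rX_conjK b : rX n b * tens rK rK = tens rK rK * rX n b.
Proof. by case: b; [exact: rX_K|rewrite -(rXV_conj (rX_K n))]. Qed.

Lemma cross_const l u k st : is_crossing T l -> k = 1 \/ k = rK ->
  u (slice T l).1 = k -> u (slice T l).1.+1 = k -> esum (GG u l) st = esum (GG u l.+1) st.
Proof.
move=> cl hk u0 u1; rewrite (Z_GG _ l) Z_GGh; apply: (esum_local (cs_uniq T) (k := l)); first by rewrite csP.
move=> st'; rewrite (Ev_low _ _ cl (@agree_refl l u)) (Ev_high _ _ cl (@agree_refl l u)).
have jk s : u (jl T l s) = k by rewrite /jl; case: s.
have uk s : u (ju T l s) = k by rewrite /ju; case: s.
rewrite !jk !uk.
have -> : tens k k * X l = X l * tens k k; last by [].
by case: hk => ->; rewrite ?tens1 ?mulr1 ?mul1r // /X rX_conjK.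
Qed.

(* The summands of the iterated coproduct of E. *)
Definition famE (j m : nat) : B := if (m < j)%N then rK else if m == j then rE else 1.

(** The two summands with E at the crossing form Delta(E) on one side of it and Delta^op(E) on the
    other, and coincide on all other strings; so [rX_E] applies, or its analogue for the inverse. *)
Lemma cross_pair l st : is_crossing T l -> let i := (slice T l).1 in
  esum (GG (famE i) l) st + esum (GG (famE i.+1) l) st =
  esum (GG (famE i) l.+1) st + esum (GG (famE i.+1) l.+1) st.
Proof.
move=> cl i; rewrite !(Z_GG _ l) !Z_GGh -!esumD; apply: (esum_local (cs_uniq T) (k := l)); first by rewrite csP.
move=> st'.
have ag : agree l (famE i.+1) (famE i).
  move=> j /negPf; rewrite -/i /famE => ji /negPf ji1; rewrite ji ji1 ltnS leq_eqVlt ji.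
  by case: ltnP.
have EvDD Y P Q : Ev (n := n) Y (fun a b => P a b + Q a b) = Ev Y P + Ev Y Q.
  rewrite -[Ev Y P]scale1r -Ev_lin; congr Ev; apply/funext => a; apply/funext => b.
  by rewrite scale1r.
rewrite !EvDD !(Ev_low _ _ cl (@agree_refl l (famE i))) !(Ev_low _ _ cl ag).
rewrite !(Ev_high _ _ cl (@agree_refl l (famE i))) !(Ev_high _ _ cl ag).
rewrite -!EvD; try exact: slotb.
rewrite -mulrDl -mulrDr.
have fii : famE i i = rE by rewrite /famE ltnn eqxx.
have fi1 : famE i i.+1 = 1 by rewrite /famE ltnNge leqnSn gtn_eqF.
have f1i : famE i.+1 i = rK by rewrite /famE leqnn.
have f11 : famE i.+1 i.+1 = rE by rewrite /famE ltnn eqxx.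
rewrite /jl /ju -/i /X; case: (positive T l); rewrite /= fii fi1 f1i f11; first by rewrite rX_E.
by rewrite (rXV_conj (rX_E n)).
Qed.

(* The insertion at the two ends of an extremum. *)
Definition maxins u i (b : bool) : B :=
  u (if b then i.+1 else i) * (if b then rK else 1) * tau (u (if b then i else i.+1)).
Definition minins u i (b : bool) : B :=
  tau (u (if b then i.+1 else i)) * (if b then rKi else 1) * u (if b then i else i.+1).

Lemma max_pass l i x : slice T l = (i, LocalMax) -> isP l x -> x \in steps -> exists b,
  [/\ x = maxpass T l b, forall u st, lowf u l st x = maxins u i b &
      forall u st, highf u l st x = if b then rK else 1].
Proof.
move=> sl /andP[/eqP vl ex] xs.
have [b [xE bxE nE]] : exists b, [/\ x = maxpass T l b, evt x = Some (AtMax b) &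
    nxt x = (l, if b then i.+1 else i, true)].
  have lv := via_level xs; rewrite vl in lv.
  move: ex lv vl xs; case: x => [[l' j] []]; rewrite /evt /nxt /maxpass sl ?advU /via /=.
    by case: l' => // l' + _ /= ll _; rewrite /go_down /= ll sl.
  move=> + ll _ _; rewrite ll /go_up sl; case: eqP => [->|_] /=; first by exists true.
  by case: eqP => [->|_] //=; exists false.
exists b; split=> // u st; rewrite -vl ?lowE ?highE // /bead_mx bxE nE xE /maxpass sl //=.
by case: (b); rewrite mul1r mulr1.
Qed.

Lemma min_pass l i x : slice T l = (i, LocalMin) -> isP l x -> x \in steps -> exists b,
  [/\ x = minpass T l b, forall u st, highf u l st x = minins u i b &
      forall u st, lowf u l st x = if b then rKi else 1].
Proof.
move=> sl /andP[/eqP vl ex] xs.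
have [b [xE bxE nE]] : exists b, [/\ x = minpass T l b, evt x = Some (AtMin b) &
    nxt x = (l.+1, if b then i.+1 else i, false)].
  have lv := via_level xs; rewrite vl in lv.
  move: ex lv vl xs; case: x => [[l' j] []]; rewrite /evt /nxt /minpass sl ?advU /via /=.
    move=> + ll _ _; rewrite ll /= /go_down sl; case: eqP => [->|_] /=; first by exists true.
    by case: eqP => [->|_] //=; exists false.
  by move=> + ll _ _; rewrite ll /go_up sl.
exists b; split=> // u st; rewrite -vl ?lowE ?highE // /bead_mx bxE nE xE /minpass sl //=.
by case: (b); rewrite mul1r mulr1.
Qed.

Lemma notP_vertical l x : ~~ isP l x -> via x = l -> evt x = None.
Proof. by move=> + vl; rewrite /isP vl eqxx; case: (evt x). Qed.

Lemma max_same l i u u' st : slice T l = (i, LocalMax) ->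
  (forall b, maxins u i b = if b then rK else 1) ->
  (forall j, (j < i)%N -> u j = u' j) -> (forall j, (i <= j)%N -> u j.+2 = u' j) ->
  GG u l st = GG u' l.+1 st.
Proof.
move=> sl ui ul uh; rewrite GG_low GG_high; apply: eq_big_seq => x; rewrite mem_rev => xs.
rewrite -/(lowf u l st x) -/(highf u' l st x).
case P : (isP l x); first by have [b [_ -> ->]] := max_pass sl P xs; rewrite ui.
case: (eqVneq (via x) l) => vl; last by rewrite low_far ?high_far.
have ex := notP_vertical (negbT P) vl; rewrite -vl in sl *.
have [a [b [-> ->]]] := vertical st xs ex; rewrite sl.
by case=> [[ai ->]|[ib ->]]; [rewrite ul|rewrite uh].
Qed.

Lemma min_same l i u u' st : slice T l = (i, LocalMin) ->
  (forall b, minins u' i b = if b then rKi else 1) ->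
  (forall j, (j < i)%N -> u j = u' j) -> (forall j, (i <= j)%N -> u j = u' j.+2) ->
  GG u l st = GG u' l.+1 st.
Proof.
move=> sl ui ul uh; rewrite GG_low GG_high; apply: eq_big_seq => x; rewrite mem_rev => xs.
rewrite -/(lowf u l st x) -/(highf u' l st x).
case P : (isP l x); first by have [b [_ -> ->]] := min_pass sl P xs; rewrite ui.
case: (eqVneq (via x) l) => vl; last by rewrite low_far ?high_far.
have ex := notP_vertical (negbT P) vl; rewrite -vl in sl *.
have [a [b [-> ->]]] := vertical st xs ex; rewrite sl.
by case=> [[ai ->]|[ib ->]]; [rewrite ul|rewrite uh].
Qed.

(** The walk runs along the maximum exactly once, in one of the two directions, so the sign appears
    once. *)
Lemma max_cancel l i u u' st : (l < size T)%N -> slice T l = (i, LocalMax) ->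
  (forall b, maxins u i b = - maxins u' i b) ->
  (forall j, j != i -> j != i.+1 -> u j = u' j) -> GG u l st = - GG u' l st.
Proof.
move=> lT sl ui uu; rewrite !GG_low; have [b [bw bn]] := maxpass_walk hB hC lT sl.
have ys : maxpass T l b \in steps by apply: walk_steps.
have yP : isP l (maxpass T l b).
  rewrite /isP /via /maxpass eqxx /evt ?advU /go_up sl /=; case: (b); rewrite eqxx //.
  by rewrite gtn_eqF.
apply: (prod_opp (steps_uniq hC) ys) => [x xs xy|].
  rewrite -/(lowf u l st x) -/(lowf u' l st x).
  case P : (isP l x).
    have [b' [xE _ _]] := max_pass sl P xs; case: (eqVneq b' b) => bb; first by rewrite xE bb eqxx in xy.
    have E : ~~ b = b' by move: bb; case: (b); case: (b').
    by move: bn; rewrite E -xE steps_walk.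
  case: (eqVneq (via x) l) => vl; last by rewrite !low_far.
  have ex := notP_vertical (negbT P) vl; rewrite -vl in sl *.
  have [a [c [lE _]]] := vertical st xs ex; rewrite !lE sl.
  by move=> H; rewrite uu //; case: H; lia.
have [b' [_ lE _]] := max_pass sl yP ys.
by rewrite -/(lowf u l st _) -/(lowf u' l st _) !lE ui.
Qed.

Lemma min_cancel l i u u' st : (l < size T)%N -> slice T l = (i, LocalMin) ->
  (forall b, minins u i b = - minins u' i b) ->
  (forall j, j != i -> j != i.+1 -> u j = u' j) -> GG u l.+1 st = - GG u' l.+1 st.
Proof.
move=> lT sl ui uu; rewrite !GG_high; have [b [bw bn]] := minpass_walk hB hC lT sl.
have ys : minpass T l b \in steps by apply: walk_steps.
have yP : isP l (minpass T l b).
  rewrite /isP /via /minpass eqxx /evt /= /go_down sl /=; case: (b); rewrite eqxx //.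
  by rewrite gtn_eqF.
apply: (prod_opp (steps_uniq hC) ys) => [x xs xy|].
  rewrite -/(highf u l st x) -/(highf u' l st x).
  case P : (isP l x).
    have [b' [xE _ _]] := min_pass sl P xs; case: (eqVneq b' b) => bb; first by rewrite xE bb eqxx in xy.
    have E : ~~ b = b' by move: bb; case: (b); case: (b').
    by move: bn; rewrite E -xE steps_walk.
  case: (eqVneq (via x) l) => vl; last by rewrite !high_far.
  have ex := notP_vertical (negbT P) vl; rewrite -vl in sl *.
  have [a [c [_ lE]]] := vertical st xs ex; rewrite !lE sl.
  by move=> H; rewrite uu //; case: H; lia.
have [b' [_ lE _]] := min_pass sl yP ys.
by rewrite -/(highf u l st _) -/(highf u' l st _) !lE ui.
Qed.

Lemma maxins_K (u : nat -> B) i b : u i = rK -> u i.+1 = rK -> maxins u i b = if b then rK else 1.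
Proof. by move=> ui u1; case: b; rewrite /maxins ui u1 tau_K ?mulr1 ?rK_Ki // -mulrA rK_Ki mulr1. Qed.
Lemma maxins_1 (u : nat -> B) i b : u i = 1 -> u i.+1 = 1 -> maxins u i b = if b then rK else 1.
Proof. by move=> ui u1; case: b; rewrite /maxins ui u1 tau1 ?mulr1 ?mul1r. Qed.
Lemma minins_K (u : nat -> B) i b : u i = rK -> u i.+1 = rK -> minins u i b = if b then rKi else 1.
Proof. by move=> ui u1; case: b; rewrite /minins ui u1 tau_K ?mulr1 ?rKi_K // -mulrA rKi_K mulr1. Qed.
Lemma minins_1 (u : nat -> B) i b : u i = 1 -> u i.+1 = 1 -> minins u i b = if b then rKi else 1.
Proof. by move=> ui u1; case: b; rewrite /minins ui u1 tau1 ?mulr1 ?mul1r. Qed.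

Lemma famE_eq j : famE j j = rE. Proof. by rewrite /famE ltnn eqxx. Qed.
Lemma famE_lt j m : (m < j)%N -> famE j m = rK. Proof. by rewrite /famE => ->. Qed.
Lemma famE_gt j m : (j < m)%N -> famE j m = 1.
Proof. by move=> jm; rewrite /famE ltnNge (ltnW jm) gtn_eqF. Qed.

(** With Delta(x) = x' (x) x'', this is x' S(x'') = epsilon(x), or x'' K S(x') = epsilon(x) K when
    the maximum goes from left to right, for x = E. *)
Lemma maxins_E i b : maxins (famE i) i b = - maxins (famE i.+1) i b.
Proof.
rewrite /maxins; case: b; rewrite !famE_eq (famE_gt (ltnSn i)) (famE_lt (ltnSn i)) ?tau_E ?tau_K ?tau1.
  by rewrite mul1r mulrN mulrA rK_Ki mul1r -mulrA rK_Ki mulr1.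
by rewrite !mulr1 mulrN opprK mulrA rK_Ki mul1r.
Qed.

Lemma minins_E i b : minins (famE i) i b = - minins (famE i.+1) i b.
Proof.
rewrite /minins; case: b; rewrite !famE_eq (famE_gt (ltnSn i)) (famE_lt (ltnSn i)) ?tau_E ?tau_K ?tau1.
  by rewrite mul1r !mulNr opprK -!mulrA rKi_K mulr1.
by rewrite !mulr1.
Qed.

Lemma famE_agree i j : j != i -> j != i.+1 -> famE i j = famE i.+1 j.
Proof. by move=> /negPf ji /negPf ji1; rewrite /famE ji ji1 ltnS [(j <= i)%N]leq_eqVlt ji. Qed.

Definition Z l st : B := \sum_(0 <= j < width T l) esum (GG (famE j) l) st.

Lemma esum_GG_eq u u' l l' st : (forall st, GG u l st = GG u' l' st) -> esum (GG u l) st = esum (GG u' l') st.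
Proof. by move=> /funext ->. Qed.

Lemma esum_GG_opp u u' l l' st : (forall st, GG u l st = - GG u' l' st) ->
  esum (GG u l) st + esum (GG u' l') st = 0.
Proof.
move=> E; rewrite -esumD -(esum0 X (crossings T) st); congr tensor_sum; apply/funext => st'.
by rewrite E addNr.
Qed.

(** At a crossing only the two summands with E on it mix. At an extremum the two summands with E on
    it cancel, and the others match those of the level with two strings fewer. *)
Lemma Z_step l st : (l < size T)%N -> Z l st = Z l.+1 st.
Proof.
move=> lT; rewrite /Z; have := widthS lT; have := fits hB lT; rewrite /slice_fits.
case sl: (slice T l) => [i c]; case: c sl => sl /= fl wl; rewrite wl.
- have cl : is_crossing T l by rewrite /is_crossing sl.
  apply: (sum_two fl) => [j ji ji1|]; last by have := cross_pair st cl; rewrite sl.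
  case: (ltnP j i) => jl.
    by apply: (cross_const _ cl (or_introl erefl)); rewrite sl /= famE_gt //; lia.
  by apply: (cross_const _ cl (or_intror erefl)); rewrite sl /= famE_lt //; lia.
- have cl : is_crossing T l by rewrite /is_crossing sl.
  apply: (sum_two fl) => [j ji ji1|]; last by have := cross_pair st cl; rewrite sl.
  case: (ltnP j i) => jl.
    by apply: (cross_const _ cl (or_introl erefl)); rewrite sl /= famE_gt //; lia.
  by apply: (cross_const _ cl (or_intror erefl)); rewrite sl /= famE_lt //; lia.
- symmetry; apply: (sum_skip2 fl) => [j ji|j ij|].
  + apply: esum_GG_eq => st'; symmetry; apply: (min_same _ sl) => [b|m mi|m im].
    * by apply: minins_1; rewrite famE_gt //; lia.
    * by [].
    by rewrite !famE_gt //; lia.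
  + apply: esum_GG_eq => st'; symmetry; apply: (min_same _ sl) => [b|m mi|m im].
    * by apply: minins_K; rewrite famE_lt //; lia.
    * by rewrite !famE_lt //; lia.
    by rewrite /famE !ltnS.
  apply: esum_GG_opp => st'; apply: (min_cancel _ lT sl); first exact: minins_E.
  exact: famE_agree.
have -> : width T l = (width T l).-2.+2 by lia.
apply: (@sum_skip2 _ _ _ _ i); first by lia.
- move=> j ji; apply: esum_GG_eq => st'; apply: (max_same _ sl) => [b|m mi|m im].
  + by apply: maxins_1; rewrite famE_gt //; lia.
  + by [].
  by rewrite !famE_gt //; lia.
- move=> j ij; apply: esum_GG_eq => st'; apply: (max_same _ sl) => [b|m mi|m im].
  + by apply: maxins_K; rewrite famE_lt //; lia.
  + by rewrite !famE_lt //; lia.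
  by rewrite /famE !ltnS.
apply: esum_GG_opp => st'; apply: (max_cancel _ lT sl); first exact: maxins_E.
exact: famE_agree.
Qed.

Lemma ZK_step l st : (l < size T)%N -> esum (GG (fun=> rK) l) st = esum (GG (fun=> rK) l.+1) st.
Proof.
move=> lT; case sl: (slice T l) => [i c]; case: c sl => sl.
- by apply: (cross_const _ _ (or_intror erefl)); rewrite /is_crossing ?sl.
- by apply: (cross_const _ _ (or_intror erefl)); rewrite /is_crossing ?sl.
- by apply: esum_GG_eq => st'; apply: (min_same _ sl) => // b; apply: minins_K.
by apply: esum_GG_eq => st'; apply: (max_same _ sl) => // b; apply: maxins_K.
Qed.

Definition JJ st : B := esum (Gam (fun=> 1) (fun=> 1)) st.

Lemma GG_bottom u st : GG u 0 st = u 0%N * Gam (fun=> 1) (fun=> 1) st * tau (u 1%N).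
Proof.
rewrite /GG (walk_rcons hC) rev_rcons big_cons bm_xl mul1r /ins /= -mulrA; congr (_ * _).
have M1 : ((npts T).-1 = (npts T).-2.+1)%N by have := npts_gt1 T; lia.
rewrite /Gam /walk_path M1 trajectS rev_cons -cats1 !big_cat !big_seq1 /= -mulrA mul1r.
congr (_ * _); last by rewrite mulr1.
apply: eq_big_seq => x; rewrite mem_rev => xs; rewrite mul1r; congr (_ * _).
have xs' : x \in steps by rewrite /walk_path M1 trajectS inE xs orbT.
case: eqP => // xl; have := steps_uniq hC; rewrite /walk_path M1 trajectS /= => /andP[x0n _].
have xw := steps_walk hC xs'.
case: x xl xs xs' xw => [[l j] d] /= -> xs xs' xw.
case: d xs xs' xw => xs xs' xw; first by have := steps_down hC xs'.
by move: xs => /trajectP[m _]; rewrite -iterSr iterS => /esym /nxt_level0.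
Qed.

Lemma GG_top u l st : (forall x, x \in walk T -> x.1.1 <> l) -> GG u l st = Gam (fun=> 1) (fun=> 1) st.
Proof.
move=> wl; rewrite /GG (walk_rcons hC) rev_rcons big_cons bm_xl mul1r.
have insl x : x \in walk T -> ins u l x = 1.
  by move=> /wl xl; rewrite /ins; case: eqP.
rewrite insl ?mul1r; last by rewrite (walk_rcons hC) mem_rcons inE eqxx.
apply: eq_big_seq => x; rewrite mem_rev => /(steps_walk hC) /insl ->.
by rewrite mul1r.
Qed.

Lemma JJ_K st : rK * JJ st = JJ st * rK.
Proof.
have E l : (l <= size T)%N -> esum (GG (fun=> rK) 0) st = esum (GG (fun=> rK) l) st.
  elim: l => [_|l IH lT]; [reflexivity|exact: (etrans (IH (ltnW lT)) (ZK_step st lT))].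
have := E _ (leqnn _).
have -> : esum (GG (fun=> rK) (size T)) st = JJ st.
  congr tensor_sum; apply/funext => st'; apply: GG_top => x xw xl.
  by have := walk_valid hB xw; rewrite /valid xl width_size // andbF.
have -> : esum (GG (fun=> rK) 0) st = rK * JJ st * rKi.
  by rewrite -esum_mul; congr tensor_sum; apply/funext => st'; rewrite GG_bottom tau_K.
by move=> JE; rewrite -[in RHS]JE -[RHS]mulrA rKi_K mulr1.
Qed.

(** The top level has no strings, so the sum of insertions is 0 there. At the bottom it is the
    adjoint action E J - K J K^-1 E, and K commutes with J. *)
Lemma JJ_E st : rE * JJ st = JJ st * rE.
Proof.
have E l : (l <= size T)%N -> Z 0 st = Z l st.
  elim: l => [_|l IH lT]; [reflexivity|exact: (etrans (IH (ltnW lT)) (Z_step st lT))].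
have := E _ (leqnn _); rewrite {2}/Z width_size // big_geq // /Z /width take0 /=.
rewrite big_nat_recl // big_nat1.
have ZE u : esum (GG u 0) st = u 0%N * JJ st * tau (u 1%N).
  by rewrite -esum_mul; congr tensor_sum; apply/funext => st'; rewrite GG_bottom.
rewrite !ZE famE_eq (famE_gt (ltnSn 0)) (famE_lt (ltnSn 0)) famE_eq tau1 mulr1 tau_E mulrN.
by move/eqP; rewrite subr_eq0 => /eqP ->; rewrite mulrA JJ_K -[_ * rK * rKi]mulrA rK_Ki mulr1.
Qed.
End Insert.

(** * Matrix entries as sums over labelled paths *)

Fixpoint nsum (V : zmodType) (N : nat) (s : seq nat) (Phi : (nat -> nat) -> V) (m : nat -> nat) : V :=
  if s is k :: s' then \sum_(i < N) nsum N s' Phi (upd m k i) else Phi m.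

Lemma nsum_ext (V : zmodType) N s (Phi Phi' : (nat -> nat) -> V) m :
  (forall m', (forall k, k \notin s -> m' k = m k) -> Phi m' = Phi' m') -> nsum N s Phi m = nsum N s Phi' m.
Proof.
elim: s m => [|k s IH] m E /=; first exact: E.
apply: eq_bigr => i _; apply: IH => m' Em; apply: E => j; rewrite inE negb_or => /andP[jk js].
by rewrite Em // /upd (negPf jk).
Qed.

Lemma nsum_raddf (V W : zmodType) (f : V -> W) N s Phi m : f 0 = 0 -> (forall x y, f (x + y) = f x + f y) ->
  f (nsum N s Phi m) = nsum N s (fun m => f (Phi m)) m.
Proof.
move=> f0 fD; elim: s m => //= k s IH m.
by rewrite (big_morph f fD f0); apply: eq_bigr => i _; apply: IH.
Qed.

Lemma nsum_sum (V : zmodType) (I : Type) (r : seq I) N s (Phi : I -> (nat -> nat) -> V) m :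
  nsum N s (fun m => \sum_(i <- r) Phi i m) m = \sum_(i <- r) nsum N s (Phi i) m.
Proof.
elim: s m => //= k s IH m; rewrite exchange_big /=; apply: eq_bigr => i _; exact: IH.
Qed.

Section Graded.
Variable n : nat.
Local Notation B := 'M[Qh]_n.+1.
Local Notation C := 'M[B]_n.+1.
Local Notation lam := (n%:R : rat).
Local Notation evec := (evec n).
Local Notation rdiag := (rdiag n).

Definition gr (A : B) (d : int) := forall i j : 'I_n.+1, i%:Z != j%:Z + d -> A i j = 0.

Lemma gr_evec A d g : gr A d -> exists z, A *m evec g = z *: evec (g + d).
Proof.
move=> Ad; case gin : ((0 <= g) && (g <= n%:Z)); last first.
  exists 0; rewrite scale0r evec_out ?mulmx0 //; lia.
have lt_gn : (absz g < n.+1)%N by lia.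
have gE : g = (Ordinal lt_gn)%:Z by rewrite /=; lia.
set j := Ordinal lt_gn in gE; case gdin : ((0 <= g + d) && (g + d <= n%:Z)); last first.
  exists 0; rewrite scale0r; apply/matrixP => i k; rewrite ord1 gE mulmx_evec mxE.
  by apply: Ad; have := ltn_ord i; lia.
have lt_gd : (absz (g + d)%R < n.+1)%N by lia.
have [i0 i0E] : exists i0 : 'I_n.+1, i0%:Z = g + d by exists (Ordinal lt_gd) => /=; lia.
exists (A i0 j); apply/matrixP => i k; rewrite ord1 [in LHS]gE mulmx_evec !mxE -i0E eqz_nat.
case: eqP => [/val_inj ->|/eqP E]; first by rewrite mulr1.
by rewrite mulr0; apply: Ad; rewrite -gE -i0E eqz_nat.
Qed.

Lemma grM A A' d d' : gr A d -> gr A' d' -> gr (A * A') (d + d').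
Proof.
move=> Ad Ad' i j ij; rewrite mxE big1 // => k _.
case: (eqVneq k%:Z (j%:Z + d')) => [kj|/Ad' ->]; last by rewrite mulr0.
by rewrite Ad ?mul0r // kj; lia.
Qed.

Lemma gr_diag f : gr (rdiag f) 0.
Proof. by move=> i j; rewrite addr0 mxE eqz_nat => /negPf; rewrite -val_eqE /= => ->. Qed.

Lemma gr1 : gr 1 0. Proof. by rewrite -(rdiag1 n); apply: gr_diag. Qed.

Lemma gr_tau A d : gr A d -> gr (tau A) d.
Proof.
move=> Ad i j ij; rewrite mxE Ad ?mulr0 //=.
by have := ltn_ord i; have := ltn_ord j; lia.
Qed.

Lemma gr_orient b A d : gr A d -> gr (orient b A) d.
Proof. by case: b => //; apply: gr_tau. Qed.

Lemma grX A d k : gr A d -> gr (A ^+ k) (d * k%:Z).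
Proof.
move=> Ad; elim: k => [|k IH]; first by rewrite mulr0; apply: gr1.
by rewrite exprS intS mulrDr mulr1; apply: grM.
Qed.

Lemma gr_F k : gr (rF n ^+ k) k%:Z.
Proof. by rewrite -[k%:Z]mul1r; apply: grX => i j; rewrite mxE addrC -intS eqz_nat => /negPf ->. Qed.

Lemma gr_E k : gr (rE n ^+ k) (- k%:Z).
Proof.
rewrite -mulN1r; apply: grX => i j ij; rewrite mxE; case: eqP => // ji.
by move: ij; rewrite ji; lia.
Qed.

Lemma gr_prod (S : eqType) (s : seq S) (b : S -> B) (d : S -> int) : (forall x, x \in s -> gr (b x) (d x)) ->
  gr (\prod_(x <- rev s) b x) (\sum_(x <- s) d x).
Proof.
elim: s => [|x s IH] bd; first by rewrite !big_nil; apply: gr1.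
rewrite rev_cons -cats1 big_cat big_seq1 big_cons addrC; apply: grM; last by apply: bd; rewrite inE eqxx.
by apply: IH => y ys; apply: bd; rewrite inE ys orbT.
Qed.

(** The last clause handles negative labels: the formulas for the beads fail there, because F would
    raise e_{-1} = 0 to e_0, but a path that has gone below 0 already has weight zero. *)
Lemma path_eval (S : eqType) (s : seq S) (b : S -> B) (z : S -> Qh) (d L : S -> int) a :
  (forall s1 y s2, s = s1 ++ y :: s2 -> L y = a + \sum_(x <- s1) d x) -> 0 <= a ->
  (forall x, x \in s -> 0 <= L x -> b x *m evec (L x) = z x *: evec (L x + d x) /\ (L x + d x < 0 -> z x = 0)) ->
  (\prod_(x <- rev s) b x) *m evec a = (\prod_(x <- s) z x) *: evec (a + \sum_(x <- s) d x) /\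
  (a + \sum_(x <- s) d x < 0 -> \prod_(x <- s) z x = 0).
Proof.
move=> + a0; elim/last_ind: s => [|s y IH] Ls bz.
  rewrite !big_nil mul1mx scale1r addr0; split=> //; lia.
have [|x xs|v1 v2] := IH.
- by move=> s1 x s2 E; apply: (Ls s1 x (rcons s2 y)); rewrite E rcons_cat rcons_cons.
- by apply: bz; rewrite mem_rcons inE xs orbT.
have Ly : L y = a + \sum_(x <- s) d x by apply: (Ls s y [::]); rewrite cats1.
rewrite rev_rcons big_cons mulvA v1 -!cats1 !big_cat !big_seq1 /= -Ly -scalemxAr addrA -Ly.
have [L0|L0] := lerP 0 (L y).
  have [|-> E2] := bz y _ L0; first by rewrite mem_rcons inE eqxx.
  by rewrite scalerA; split=> // /E2 ->; rewrite mulr0.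
by rewrite -Ly in v2; rewrite v2 // mul0r !scale0r; split.
Qed.

(** Projections in the first factor make the Cartan part a finite sum of pure tensors. *)
Lemma rD_decomp s : rD n s = \sum_i tens (delta_mx i i) (rdiag (fun mu => eh (s * (lam - 2 * i%:R) * mu / 4))).
Proof.
apply/matrixP => p r; rewrite summxE (bigD1 p) //= [Y in _ + Y]big1 ?addr0; last first.
  by move=> i ip; rewrite !mxE eq_sym (negPf ip) scale0r.
rewrite !mxE eqxx /=; case: (eqVneq p r) => [->|pr]; first by rewrite scale1r.
by rewrite scale0r.
Qed.

Lemma delta_diag (i : 'I_n.+1) : delta_mx i i = rdiag (fun mu => (mu == lam - 2 * i%:R)%:R).
Proof.
apply/matrixP => p r; rewrite !mxE; case: (eqVneq p r) => [->|pr]; last first.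
  by case: (eqVneq p i) => //= pi; rewrite eq_sym -pi (negPf pr).
rewrite andbb; congr (nat_of_bool _)%:R; apply/eqP/eqP => [->//|/(addrI _)/oppr_inj].
by move/(mulfI (_ : 2 != 0)) => /(_ isT) /eqP; rewrite eqr_nat => /eqP/val_inj.
Qed.

Lemma diag_sum f : rdiag f = \sum_(i < n.+1) f (lam - 2 * i%:R) *: delta_mx i i.
Proof.
apply/matrixP => p r; rewrite summxE (bigD1 p) //= [Y in _ + Y]big1 ?addr0; last first.
  by move=> i ip; rewrite !mxE eq_sym (negPf ip) mulr0.
rewrite !mxE eqxx /= eq_sym; case: eqP => [->|_]; by rewrite ?mulr1 ?mulr0.
Qed.
End Graded.

Section Labels.
Variable T : diagram.
Hypotheses (hB : bottom_diagram T) (hC : one_component T).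
Local Notation steps := (walk_path T).
Local Notation evt := (event_at T).
Local Notation cs := (crossings T).
Local Notation pos := (positive T).

Definition crossing_pass k s := pass T k s (dw T k s).

Lemma evt_thepass k s : is_crossing T k -> evt (crossing_pass k s) = Some (AtCrossing k s (dw T k s)).
Proof. by move=> ck; rewrite /evt advance_pass. Qed.

Definition is_pass (x : position) := if evt x is Some (AtCrossing _ _ _) then true else false.

Lemma big_crossings (V : Type) (idx : V) (op : Monoid.com_law idx) (F : position -> V) :
  \big[op/idx]_(x <- steps | is_pass x) F x =
  \big[op/idx]_(k <- cs) op (F (crossing_pass k true)) (F (crossing_pass k false)).
Proof.
transitivity (\big[op/idx]_(x <- [seq crossing_pass k s | k <- cs, s <- [:: true; false]]) F x); last first.
  by rewrite big_allpairs_dep; apply: eq_bigr => k _; rewrite big_cons big_seq1.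
rewrite -big_filter; apply: perm_big; apply: uniq_perm.
- by rewrite filter_uniq // steps_uniq.
- apply: allpairs_uniq; rewrite ?cs_uniq // => -[k s] [k' s'] h h' /= E.
  have ck : is_crossing T k by have /allpairsP[p [+ _ [-> _]]] := h; rewrite csP.
  have ck' : is_crossing T k' by have /allpairsP[p [+ _ [-> _]]] := h'; rewrite csP.
  by have := congr1 evt E; rewrite !evt_thepass // => -[-> -> _].
move=> x; rewrite mem_filter; apply/andP/allpairsP => [[]|[[k s] [/= kc _ ->]]].
  rewrite /is_pass; case E: (evt x) => [[k s d| |]|] // _ xs.
  have [ck _ xE] := walk_evt_crossing hB hC (steps_walk hC xs) E.
  by exists (k, s); rewrite csP; split=> //=; case: (s).
by rewrite csP in kc; rewrite /is_pass evt_thepass // pass_steps.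
Qed.

Variable m : nat -> nat.

Definition label_step (x : position) : int :=
  if evt x is Some (AtCrossing k s _) then (if s == pos k then (m k)%:Z else - (m k)%:Z) else 0.

(** The index of the basis vector met at [y], before the step from [y], on the path that starts with
    e_a. *)
Definition label (a : int) (y : position) : int := a + \sum_(x <- take (index y steps) steps) label_step x.

Lemma lab_split a s1 y s2 : steps = s1 ++ y :: s2 -> label a y = a + \sum_(x <- s1) label_step x.
Proof.
move=> E; have us := steps_uniq hC; rewrite /label; move: us; rewrite E cat_uniq => /and3P[_ /norP[ys _] _].
by rewrite index_cat (negPf ys) /= eqxx addn0 take_size_cat.
Qed.

Lemma sum_dl : \sum_(x <- steps) label_step x = 0.
Proof.
rewrite (bigID is_pass) /= [Y in _ + Y]big1 ?addr0; last first.
  by move=> x; rewrite /is_pass /label_step; case: (evt x) => [[]|].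
rewrite big_crossings big_seq big1 // => k; rewrite csP => ck.
by rewrite /label_step !evt_thepass //; case: (pos k); rewrite /= ?addrN ?addNr.
Qed.

Lemma xl_steps : xl \notin steps.
Proof. by have := walk_uniq hC; rewrite (walk_rcons hC) rcons_uniq => /andP[]. Qed.

Lemma lab_nxt a x : x \in steps -> label a (next_position T x) = label a x + label_step x.
Proof.
move=> xs; have := xs; rewrite {1}/walk_path => /trajectP[i iM xE].
have us := steps_uniq hC; have sz : size steps = (npts T).-1 by rewrite size_traject.
have ix : index x steps = i.
  by rewrite xE -(nth_traject (next_position T) iM) -/steps index_uniq ?sz.
have inx : index (next_position T x) steps = i.+1.
  rewrite xE -iterS; case: (ltnP i.+1 (npts T).-1) => iM1.
    by rewrite -(nth_traject (next_position T) iM1) -/steps index_uniq ?sz.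
  have -> : i.+1 = (npts T).-1 by lia.
  by rewrite last_walk // memNindex ?xl_steps.
have iS : (i < size steps)%N by rewrite sz.
rewrite /label inx ix (take_nth x iS) -cats1 big_cat big_seq1 addrA; congr (_ + label_step _).
by rewrite -ix nth_index.
Qed.

(* The label of the edge of string s next to crossing k which carries the Cartan
   part of the R-matrix: the lower edge for R, the upper edge for its inverse. *)
Definition glab a k s : int :=
  label a (crossing_pass k s) + if dw T k s == pos k then label_step (crossing_pass k s) else 0.

Definition sgd (b : bool) : rat := if b then 1 else - 1.
End Labels.


(** * Reduction of the entries of the state sum to weights *)

Section Path.
Variables (T : diagram) (n : nat).
Hypotheses (hB : bottom_diagram T) (hC : one_component T).
Local Notation B := 'M[Qh]_n.+1.
Local Notation C := 'M[B]_n.+1.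
Local Notation lam := (n%:R : rat).
Local Notation evec := (evec n).
Local Notation rdiag := (rdiag n).
Local Notation steps := (walk_path T).
Local Notation evt := (event_at T).
Local Notation cs := (crossings T).
Local Notation pos := (positive T).
Local Notation thepass := (crossing_pass T).
Local Notation bm := (@bead_mx T n).
Local Notation Gam := (@bead_mx_prod T n (fun=> 1) (fun=> 1)).

Definition gst (m : nat -> nat) (st : nat -> B * B) :=
  forall k, is_crossing T k -> gr (st k).1 (m k)%:Z /\ gr (st k).2 (- (m k)%:Z).

Lemma gr_bm m st x : gst m st -> gr (bm st x) (label_step T m x).
Proof.
move=> gs; rewrite /bm /label_step; case E: (evt x) => [[k s d|[]|[]]|]; try exact: gr1; try exact: gr_diag.
have [ck _] := evt_crossing E; have [g1 g2] := gs _ ck.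
by case: ifP => _; apply: gr_orient.
Qed.

(** The sign is there because [tau] reverses weights ([tau_diag]) on strings going up. *)
Definition wt m a k s : rat := sgd (dw T k s) * (lam - 2 * (glab T m a k s)%:~R).

(* Multiplying the bead on string s at crossing k by a diagonal matrix, on the side of R
   on which the Cartan part stands. *)
Definition dmul k (f : rat -> Qh) (A : B) : B := if pos k then rdiag f * A else A * rdiag f.

(** All beads are homogeneous, so those before the given one send e_a to a multiple of one basis
    vector, whose index is the label; there the diagonal matrix acts by a scalar. *)
Lemma Gam_dmul m a k s f st st' : is_crossing T k -> gst m st -> 
  (forall x, x \in steps -> x != thepass k s -> bm st' x = bm st x) ->
  (let sel (st : nat -> B * B) := if s == pos k then (st k).1 else (st k).2 in sel st' = dmul k f (sel st)) ->
  Gam st' *m evec a = f (wt m a k s) *: (Gam st *m evec a).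
Proof.
move=> ck gs bE /= selE; have ys := pass_steps hB hC s ck; rewrite -/(thepass k s) in ys.
have us := steps_uniq hC.
case/splitPr: {-1}_ / ys (erefl steps) us bE => s1 s2 sE us bE.
have ysp := lab_split hC m a sE.
have GE st1 : Gam st1 = (\prod_(x <- rev s2) bm st1 x) * bm st1 (thepass k s) * (\prod_(x <- rev s1) bm st1 x).
  rewrite /bead_mx_prod sE rev_cat rev_cons -cats1 !big_cat big_seq1 /= mul1r mulr1.
  by congr (_ * _ * _); apply: eq_bigr => x _; rewrite mul1r mulr1.
move: us; rewrite cat_uniq /= => /and3P[_ /norP[y1 _] /andP[y2 _]].
rewrite !GE; set A := bm st _; set A' := bm st' _.
have -> : \prod_(x <- rev s2) bm st' x = \prod_(x <- rev s2) bm st x.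
  apply: eq_big_seq => x; rewrite mem_rev => xs; apply: bE; first by rewrite mem_cat inE xs !orbT.
  by apply: contraNneq y2 => <-.
have -> : \prod_(x <- rev s1) bm st' x = \prod_(x <- rev s1) bm st x.
  apply: eq_big_seq => x; rewrite mem_rev => xs; apply: bE; first by rewrite mem_cat xs.
  by apply: contraNneq y1 => <-.
set P := \prod_(x <- rev s2) _; set Q := \prod_(x <- rev s1) _.
have [z Qz] : exists z, Q *m evec a = z *: evec (label T m a (thepass k s)).
  by rewrite ysp; apply: gr_evec; apply: gr_prod => x _; apply: gr_bm.
have grA : gr A (label_step T m (thepass k s)) by apply: gr_bm.
have [z' Az] := gr_evec (label T m a (thepass k s)) grA.
rewrite !mulvA Qz -!scalemxAr [RHS]scalerA mulrC -scalerA; congr (_ *: _).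
suff -> : A' *m evec (label T m a (thepass k s)) = f (wt m a k s) *: (A *m evec (label T m a (thepass k s))).
  by rewrite -scalemxAr.
have bmE st1 : bm st1 (thepass k s) = orient (dw T k s) (if s == pos k then (st1 k).1 else (st1 k).2).
  by rewrite /bm evt_thepass.
move: Az; rewrite /A' /A !bmE selE /dmul /wt /glab; set sel := (if _ then _ else _).
set g := label T m a _; set d := label_step T m _.
case: (dw T k s); case: (pos k); rewrite /orient ?tauM ?tau_diag /= => Az; rewrite mulvA.
- by rewrite Az -scalemxAr rdiag_evec !scalerA mulrC mul1r.
- by rewrite rdiag_evec -scalemxAr addr0 mul1r.
- by rewrite rdiag_evec -scalemxAr addr0 mulN1r.
by rewrite Az -scalemxAr rdiag_evec !scalerA mulrC mulN1r.
Qed.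

Definition thc k (N : nat) : Qh := if pos k then th N else th' N.
Definition Df m a k : Qh := eh (sgd (pos k) * wt m a k (pos k) * wt m a k (~~ pos k) / 4).
Definition chi (i : 'I_n.+1) (mu : rat) : Qh := (mu == lam - 2 * i%:R)%:R.
Definition chf k (i : 'I_n.+1) (mu : rat) : Qh := eh (sgd (pos k) * (lam - 2 * i%:R) * mu / 4).

Lemma Ev_X k Phi : bil Phi -> Ev (X T n k) Phi =
  \sum_(j < n.+1) thc k j *: \sum_i Phi (dmul k (chi i) (rF n ^+ j)) (dmul k (chf k i) (rE n ^+ j)).
Proof.
move=> bP; have [l1 l2] := bP.
have XE : X T n k = \sum_(j < n.+1) \sum_i tens (thc k j *: dmul k (chi i) (rF n ^+ j)) (dmul k (chf k i) (rE n ^+ j)).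
  rewrite /X /rX /thc /dmul /rTh /chf; case: (pos k).
    rewrite mulr_sumr; apply: eq_bigr => j _; rewrite rD_decomp mulr_suml; apply: eq_bigr => i _.
    by rewrite tensM -scalerAr delta_diag.
  rewrite mulr_suml; apply: eq_bigr => j _; rewrite rD_decomp mulr_sumr; apply: eq_bigr => i _.
  by rewrite tensM -scalerAl delta_diag.
rewrite XE Ev_sum //; apply: eq_bigr => j _; rewrite Ev_sum // scaler_sumr; apply: eq_bigr => i _.
by rewrite Ev_tens // (linZ (l1 _)).
Qed.

Lemma dmul_gr k f A d : gr A d -> gr (dmul k f A) d.
Proof.
move=> Ad; rewrite /dmul; case: (pos k); [rewrite -[d]add0r|rewrite -[d]addr0]; apply: grM => //;
  exact: gr_diag.
Qed.

Lemma dmul_sum k (f : rat -> Qh) A : dmul k f A = \sum_(i < n.+1) f (lam - 2 * i%:R) *: dmul k (chi i) A.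
Proof.
rewrite /dmul diag_sum; case: (pos k); rewrite ?mulr_suml ?mulr_sumr; apply: eq_bigr => i _.
  by rewrite -scalerAl delta_diag.
by rewrite -scalerAr delta_diag.
Qed.

Lemma bm_upd_other st k w w' s x : is_crossing T k -> x \in steps -> x != thepass k s ->
  (if s == pos k then w.2 = w'.2 else w.1 = w'.1) -> bm (upd st k w) x = bm (upd st k w') x.
Proof. by move=> ck xs xp ww; apply: (bm_upd hB hC st ck xs xp). Qed.

(** Both halves of the Cartan part act by scalars depending on the labels; summing over the
    projections [chi i] replaces i by the label on the first string. *)
Lemma collapse m a k st al be : is_crossing T k ->
  (forall k', is_crossing T k' -> k' != k -> gr (st k').1 (m k')%:Z /\ gr (st k').2 (- (m k')%:Z)) ->
  gr al (m k)%:Z -> gr be (- (m k)%:Z) ->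
  \sum_i Gam (upd st k (dmul k (chi i) al, dmul k (chf k i) be)) *m evec a =
  Df m a k *: (Gam (upd st k (al, be)) *m evec a).
Proof.
move=> ck gs gal gbe.
have gst_upd al' be' : gr al' (m k)%:Z -> gr be' (- (m k)%:Z) -> gst m (upd st k (al', be')).
  by move=> h1 h2 k' ck'; rewrite /upd; case: (eqVneq k' k) => [->|kk] //; apply: gs.
have updk w : upd st k w k = w by rewrite /upd eqxx.
have step2 al' f : gr al' (m k)%:Z ->
    Gam (upd st k (al', dmul k f be)) *m evec a = f (wt m a k (~~ pos k)) *: (Gam (upd st k (al', be)) *m evec a).
  move=> h; apply: (Gam_dmul _ ck (gst_upd _ _ h gbe)) => [x xs xp|/=].
    by apply: (bm_upd_other _ ck xs xp); case: (pos k).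
  by rewrite !updk; case: (pos k).
have step1 f :
    Gam (upd st k (dmul k f al, be)) *m evec a = f (wt m a k (pos k)) *: (Gam (upd st k (al, be)) *m evec a).
  apply: (Gam_dmul _ ck (gst_upd _ _ gal gbe)) => [x xs xp|/=].
    by apply: (bm_upd_other _ ck xs xp); rewrite eqxx.
  by rewrite !updk eqxx.
have [l1 _] := Gam_slotbil (n := n) hB hC (fun=> 1) (fun=> 1) ck st.
rewrite (eq_bigr (fun i => (chf k i (wt m a k (~~ pos k)) *: Gam (upd st k (dmul k (chi i) al, be))) *m evec a)).
  rewrite -mulmx_suml; pose f mu := eh (sgd (pos k) * mu * wt m a k (~~ pos k) / 4).
  transitivity (Gam (upd st k (dmul k f al, be)) *m evec a); last by rewrite step1.
  congr (_ *m _); rewrite dmul_sum (lin_sum (l1 be)); apply: eq_bigr => i _.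
  by rewrite (linZ (l1 be)).
by move=> i _; rewrite step2 ?scalemxAl //; apply: dmul_gr.
Qed.

Definition stFE (cs' : seq nat) (m : nat -> nat) (st : nat -> B * B) (k : nat) : B * B :=
  if k \in cs' then (rF n ^+ m k, rE n ^+ m k) else st k.

Lemma path_sum cs' st m a : uniq cs' -> all (is_crossing T) cs' ->
  (forall k, is_crossing T k -> k \notin cs' -> gr (st k).1 (m k)%:Z /\ gr (st k).2 (- (m k)%:Z)) ->
  tensor_sum (X T n) cs' Gam st *m evec a =
  nsum n.+1 cs' (fun m' => (\prod_(k <- cs') (thc k (m' k) * Df m' a k)) *: (Gam (stFE cs' m' st) *m evec a)) m.
Proof.
elim: cs' st m => [|k cs' IH] st m.
  by move=> _ _ _ /=; rewrite big_nil scale1r; congr (Gam _ *m _); apply/funext.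
move=> /= /andP[kcs ucs] /andP[ck ccs] gs.
rewrite Ev_X; last by apply: (esum_slotbil _ kcs); apply: Gam_slotbil.
rewrite mulmx_suml; apply: eq_bigr => j _; rewrite -scalemxAl mulmx_suml.
pose w i := (dmul k (chi i) (rF n ^+ j), dmul k (chf k i) (rE n ^+ j)).
rewrite (eq_bigr (fun i => nsum n.+1 cs' (fun m' => (\prod_(k <- cs') (thc k (m' k) * Df m' a k)) *:
    (Gam (stFE cs' m' (upd st k (w i))) *m evec a)) (upd m k j))); last first.
  move=> i _; apply: IH => // k' ck' k'cs; rewrite /upd; case: (eqVneq k' k) => [_|kk].
    by split; apply: dmul_gr; [apply: gr_F|apply: gr_E].
  by apply: gs; rewrite // inE negb_or kk.
rewrite -nsum_sum (@nsum_raddf _ _ (fun x => thc k j *: x)) ?scaler0 //; last by move=> x y; rewrite scalerDr.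
apply: nsum_ext => m' Em.
have mk : m' k = j by rewrite Em // /upd eqxx.
rewrite big_cons -scaler_sumr scalerA mk.
have upE z : stFE cs' m' (upd st k z) = upd (stFE cs' m' st) k z.
  apply/funext => k'; rewrite /stFE /upd; case: (eqVneq k' k) => [->|//].
  by rewrite (negPf kcs).
have FEE : stFE (k :: cs') m' st = upd (stFE cs' m' st) k (rF n ^+ j, rE n ^+ j).
  apply/funext => k'; rewrite /stFE /upd inE; case: (eqVneq k' k) => [->|//].
  by rewrite mk.
rewrite (eq_bigr (fun i => Gam (upd (stFE cs' m' st) k (w i)) *m evec a)); last by move=> i _; rewrite upE.
rewrite (@collapse m') //.
- by rewrite FEE scalerA; congr (_ *: _); ring.
- move=> k' ck' kk; rewrite /stFE; case: ifP => [_|/negbT k'cs]; first by split; [apply: gr_F|apply: gr_E].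
  by rewrite Em // /upd (negPf kk); apply: gs; rewrite // inE negb_or kk.
- by rewrite mk; apply: gr_F.
by rewrite mk; apply: gr_E.
Qed.

(* The factor by which a step multiplies the basis vector labelled g. *)
Definition zf m (x : position) (g : int) : Qh :=
  match evt x with
  | Some (AtCrossing k s d) =>
      if s == pos k then
        if d then 1 else (-1) ^+ m k * eh ((m k)%:R * (lam - 2 * g%:~R) / 2 - (m k)%:R * ((m k)%:R - 1) / 2)
      else (\prod_(l < m k) Ec n (g%:~R - l%:R)) *
        if d then 1 else (-1) ^+ m k * eh (- ((m k)%:R * (lam - 2 * g%:~R) / 2) - (m k)%:R * ((m k)%:R + 1) / 2)
  | Some (AtMin true) => eh (- ((lam - 2 * g%:~R) / 2))
  | Some (AtMax true) => eh ((lam - 2 * g%:~R) / 2)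
  | _ => 1
  end.

Lemma rEX_evec N g : rE n ^+ N *m evec g = (\prod_(l < N) Ec n (g%:~R - l%:R)) *: evec (g - N%:Z).
Proof.
elim: N => [|N IH]; first by rewrite mul1mx big_ord0 scale1r subr0.
rewrite exprS mulvA IH -scalemxAr rE_evec scalerA big_ord_recr /=; congr (_ * Ec n _ *: evec _).
  by rewrite intrB.
by lia.
Qed.

Lemma tauX (A : B) N : tau (A ^+ N) = tau A ^+ N.
Proof. by elim: N => [|N IH]; rewrite ?tau1 // exprSr tauM IH -exprS. Qed.

Lemma tFX_evec N g : 0 <= g -> tau (rF n ^+ N) *m evec g =
  ((-1) ^+ N * eh (N%:R * (lam - 2 * g%:~R) / 2 - N%:R * (N%:R - 1) / 2)) *: evec (g + N%:Z).
Proof.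
move=> g0; rewrite tauX tau_F; elim: N => [|N IH].
  by rewrite mul1mx addr0 expr0 mul1r !mul0r subr0 eh0 scale1r.
rewrite exprS mulvA IH -scalemxAr mulNmx mulvA rdiag_evec -scalemxAr rF_evec; last by lia.
rewrite -scaleNr scalerA; congr (_ *: evec _); last by lia.
rewrite exprS mulN1r mulrN mulNr; congr (- _); rewrite -[LHS]mulrA -ehD; congr (_ * eh _).
by rewrite intrD -natr1; field.
Qed.

Lemma tEX_evec N g : tau (rE n ^+ N) *m evec g =
  ((\prod_(l < N) Ec n (g%:~R - l%:R)) *
   ((-1) ^+ N * eh (- (N%:R * (lam - 2 * g%:~R) / 2) - N%:R * (N%:R + 1) / 2))) *: evec (g - N%:Z).
Proof.
rewrite tauX tau_E; elim: N => [|N IH].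
  by rewrite mul1mx subr0 big_ord0 expr0 !mul1r !mul0r oppr0 subr0 eh0 scale1r.
rewrite exprS mulvA IH -scalemxAr mulNmx mulvA rE_evec -scalemxAr rdiag_evec.
rewrite -scaleNr !scalerA; congr (_ *: evec _); last by lia.
have -> : (g - N%:Z)%:~R = g%:~R - N%:R :> rat by rewrite intrB.
have -> : eh (- (N.+1%:R * (lam - 2 * g%:~R) / 2) - N.+1%:R * (N.+1%:R + 1) / 2) =
    eh (- (N%:R * (lam - 2 * g%:~R) / 2) - N%:R * (N%:R + 1) / 2) * eh (- ((lam - 2 * (g - N%:Z - 1)%:~R) / 2)).
  by rewrite -ehD; congr eh; rewrite !intrB -natr1 mulr1z; field.
by rewrite big_ord_recr /= exprS mulN1r; ring.
Qed.

Lemma Gam_path st m a : 0 <= a -> Gam (stFE cs m st) *m evec a =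
  (\prod_(x <- steps) zf m x (label T m a x)) *: evec a.
Proof.
move=> a0; have -> : Gam (stFE cs m st) = \prod_(x <- rev steps) bm (stFE cs m st) x.
  by apply: eq_bigr => x _; rewrite mul1r mulr1.
have [||x xs|-> _] := @path_eval n _ steps (bm (stFE cs m st)) (fun x => zf m x (label T m a x)) (label_step T m) (label T m a) a.
- exact: lab_split.
- exact: a0.
- set g := label T m a x => g0; rewrite /bm /zf /label_step; case E: (evt x) => [[k s d|[]|[]]|].
  + have [ck _] := evt_crossing E; rewrite /stFE csP ck; case: ifP => _ /=.
      split; last by lia.
      by case: d E => _; rewrite /orient ?rFX_evec ?scale1r // tFX_evec.
    split; first by case: d E => _; rewrite /orient ?mulr1 ?rEX_evec ?tEX_evec.
    move=> gN; have gl : (absz g < m k)%N by lia.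
    rewrite (bigD1 (Ordinal gl)) //= (_ : g%:~R - _ = 0) ?Ec0 ?mul0r //.
    have -> : g = (absz g)%:Z by lia.
    by rewrite absz_nat subrr.
  + by split; [rewrite addr0 rdiag_evec|lia].
  + by split; [rewrite addr0 mul1mx scale1r|lia].
  + by split; [rewrite addr0 rdiag_evec|lia].
  + by split; [rewrite addr0 mul1mx scale1r|lia].
  by split; [rewrite addr0 mul1mx scale1r|lia].
by rewrite sum_dl // addr0.
Qed.

Definition Wn m (a : int) : Qh :=
  (\prod_(k <- cs) (thc k (m k) * Df m a k)) * \prod_(x <- steps) zf m x (label T m a x).

Theorem path_theorem st a : 0 <= a -> tensor_sum (X T n) cs Gam st *m evec a =
  nsum n.+1 cs (fun m => Wn m a) (fun=> 0%N) *: evec a.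
Proof.
move=> a0; rewrite (@path_sum cs st (fun=> 0%N)).
- rewrite (@nsum_raddf _ _ (fun x : Qh => x *: evec a)) ?scale0r //; last by move=> x y; rewrite scalerDl.
  by apply: nsum_ext => m _; rewrite Gam_path // scalerA.
- exact: cs_uniq.
- by rewrite /crossings filter_all.
by move=> k ck; rewrite csP ck.
Qed.

(** Obtained from F^(n+1) = 0 and not from the formula: the product of the factors is the
    coefficient of e_a in the image of e_a under a product with a zero bead. *)
Lemma Wn_eq0 m a k : 0 <= a -> a <= n%:Z -> is_crossing T k -> (n < m k)%N -> Wn m a = 0.
Proof.
move=> a0 an ck nk; rewrite /Wn; suff -> : \prod_(x <- steps) zf m x (label T m a x) = 0 by rewrite mulr0.
have := Gam_path (fun=> (1, 1)) m a0.
have -> : Gam (stFE cs m (fun=> (1, 1))) = 0.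
  have [p [q [E _]]] := @prod_slot _ B _ _ _ (steps_uniq hC) (pass_steps hB hC (pos k) ck).
  rewrite /bead_mx_prod E mul1r mulr1 -/(thepass k (pos k)) /bead_mx evt_thepass // eqxx /stFE csP ck /= rFX_eq0 //.
  have -> : orient (dw T k (pos k)) 0 = 0 :> B by rewrite (lin0 (@orient_lin _ _)).
  by rewrite !(mulr0, mul0r).
rewrite mul0mx => /(congr1 (fun M : 'cV_n.+1 => M (inord (absz a)) 0)).
rewrite !mxE inordK; last by lia.
have -> : (absz a)%:Z == a by lia.
by rewrite mulr1 => <-.
Qed.
End Path.

(** * Joint faithfulness of the representations *)

Definition fps_tl (x : Qh) : Qh := Fps (fun n => x n.+1).

Fact fps0_zmod : zmod_morphism (fun x : Qh => x 0%N).
Proof. by []. Qed.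
Fact fps0_monoid : monoid_morphism (fun x : Qh => x 0%N).
Proof. by split=> // x y; rewrite fps_coef0M. Qed.
Definition fps0 (x : Qh) : rat := x 0%N.
Arguments fps0 : simpl never.
HB.instance Definition _ := GRing.isZmodMorphism.Build Qh rat fps0 fps0_zmod.
HB.instance Definition _ := GRing.isMonoidMorphism.Build Qh rat fps0 fps0_monoid.

Lemma poly_fps0_eq0 (p : {poly Qh}) : map_poly fps0 p = 0 -> exists p', p = (fps_h : Qh) *: p'.
Proof.
move=> p0; exists (map_poly fps_tl p); apply/polyP => i.
have tl0 : fps_tl 0 = 0 by apply: fpsP.
rewrite coefZ coef_map_id0 //; apply: fps_h_mul.
by have := congr1 (fun r : {poly rat} => r`_i) p0; rewrite coef_map coef0.
Qed.

Lemma poly_nat_eq0 (p : {poly rat}) K : (forall n, (K <= n)%N -> p.[n%:R] = 0) -> p = 0.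
Proof.
move=> pn; apply/eqP/negPn/negP => p0.
have := @max_poly_roots _ p [seq n%:R : rat | n <- iota K (size p)] p0.
rewrite size_map size_iota ltnn => H; suff : false by [].
apply: H; first by apply/allP => _ /mapP[n + ->]; rewrite mem_iota => /andP[Kn _]; apply/eqP/pn.
by rewrite map_inj_uniq ?iota_uniq // => a b /eqP; rewrite eqr_nat => /eqP.
Qed.

Section PBW.
Variable U : algType Qh.
Variables E F H : U.
Hypotheses (HE : H * E = E * H + E *+ 2) (HF : H * F = F * H - F *+ 2).
Variable Z : U.
Hypothesis EF : E * F = F * E + H + fps_h *: Z.

Local Notation pe p := (horner_alg H p).

Definition pbw_term a p c : U := F ^+ a * pe p * E ^+ c.

(** Normal forms are only needed modulo h: [pbwh] absorbs all corrections, so the computations are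
    those of the classical enveloping algebra of sl2. *)
Inductive pbw : U -> Prop :=
| pbw0 : pbw 0
| pbwD x y of pbw x & pbw y : pbw (x + y)
| pbwT a p c : pbw (pbw_term a p c)
| pbwh y : pbw (fps_h *: y).

Lemma HFX a : H * F ^+ a = F ^+ a * (H - (2 * a)%:R).
Proof.
elim: a => [|a IH]; first by rewrite muln0 subr0 mulr1 mul1r.
rewrite exprS mulrA HF mulrBl -[F * H * _]mulrA IH mulrA -exprS mulrnAl -exprS.
rewrite -[F ^+ a.+1 *+ 2]mulr_natr -mulrBr mulnS natrD; congr (_ * _).
by rewrite addrAC -addrA -opprD.
Qed.

Lemma E_pe p : E * pe p = pe (p \Po ('X - 2%:R)) * E.
Proof.
have EH : E * H = (H - 2) * E.
  by rewrite mulrBl HE mulr_natl addrK.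
elim/poly_ind: p => [|p c IH]; first by rewrite comp_poly0 !rmorph0 mulr0 mul0r.
rewrite comp_polyD comp_polyM comp_polyX comp_polyC !rmorphD !rmorphM /= !horner_algX !horner_algC.
rewrite mulrDr mulrDl mulrA IH -!mulrA -scalerAl -scalerAr mul1r mulr1; congr (_ + _).
by rewrite EH rmorphB /= horner_algX rmorph_nat.
Qed.

Lemma EFX a : exists y, E * F ^+ a = F ^+ a * E + F ^+ a.-1 * (a%:R * (H - a.-1%:R)) + fps_h *: y.
Proof.
elim: a => [|a [y IH]].
  by exists 0; rewrite mulr1 mul1r mul0r mulr0 scaler0 !addr0.
exists (Z * F ^+ a + F * y).
have FF : F * (F ^+ a.-1 * (a%:R * (H - a.-1%:R))) = F ^+ a * (a%:R * (H - a.-1%:R)).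
  by case: a {y IH} => [|a]; rewrite ?mul0r ?mulr0 // exprS -mulrA.
rewrite exprS mulrA EF !mulrDl -[F * E * _]mulrA IH HFX -scalerAl scalerDr.
rewrite mulrDr [F * (_ + _)]mulrDr FF -scalerAr [F * (F ^+ a * E)]mulrA -exprS.
have -> : F ^+ a * ((a.+1)%:R * (H - a%:R)) =
    F ^+ a * (a%:R * (H - a.-1%:R)) + F ^+ a * (H - (2 * a)%:R).
  rewrite -mulrDr; congr (_ * _); rewrite !mulr_natl !mulrnBl -!mulrnA addrACA -mulrSr.
  by congr (_ + _); rewrite -opprD -natrD; congr (- _%:R); case: a {y IH FF} => [|a] //=; nia.
rewrite -!addrA; congr (_ + _); congr (_ + _); rewrite addrCA; congr (_ + _).
by rewrite addrC.
Qed.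

Lemma peZ s p : pe (s *: p) = s *: pe p.
Proof. by rewrite -mul_polyC rmorphM /= horner_algC mulr_algl. Qed.

Lemma pbwZ s x : pbw x -> pbw (s *: x).
Proof.
elim=> {x} [|x y _ sx _ sy|a p c|y]; first by rewrite scaler0; apply: pbw0.
- by rewrite scalerDr; apply: pbwD.
- have -> : s *: pbw_term a p c = pbw_term a (s *: p) c.
    by rewrite /pbw_term peZ -scalerAr -scalerAl.
  exact: pbwT.
- by rewrite scalerA mulrC -scalerA; apply: pbwh.
Qed.

Lemma pbwF x : pbw x -> pbw (F * x).
Proof.
elim=> {x} [|x y _ sx _ sy|a p c|y]; first by rewrite mulr0; apply: pbw0.
- by rewrite mulrDr; apply: pbwD.
- by rewrite /pbw_term !mulrA -exprS; apply: (pbwT a.+1).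
- by rewrite -scalerAr; apply: pbwh.
Qed.

Lemma pbwH x : pbw x -> pbw (H * x).
Proof.
elim=> {x} [|x y _ sx _ sy|a p c|y]; first by rewrite mulr0; apply: pbw0.
- by rewrite mulrDr; apply: pbwD.
- rewrite /pbw_term !mulrA HFX -[F ^+ a * _ * _]mulrA.
  have -> : (H - (2 * a)%:R) * pe p = pe (('X - (2 * a)%:R) * p).
    by rewrite rmorphM rmorphB /= horner_algX rmorph_nat.
  exact: pbwT.
- by rewrite -scalerAr; apply: pbwh.
Qed.

Lemma pbwE x : pbw x -> pbw (E * x).
Proof.
elim=> {x} [|x y _ sx _ sy|a p c|y]; first by rewrite mulr0; apply: pbw0.
- by rewrite mulrDr; apply: pbwD.
- have [y yE] := EFX a.
  rewrite /pbw_term !mulrA yE !mulrDl; apply: pbwD; last first.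
    by rewrite -!scalerAl; apply: pbwh.
  apply: pbwD.
    by rewrite -[_ * E * _]mulrA E_pe mulrA -[_ * E * _]mulrA -exprS; apply: pbwT.
  have -> : F ^+ a.-1 * (a%:R * (H - a.-1%:R)) * pe p = F ^+ a.-1 * pe (a%:R * ('X - a.-1%:R) * p).
    by rewrite -mulrA !rmorphM rmorphB /= horner_algX !rmorph_nat.
  exact: pbwT.
- by rewrite -scalerAr; apply: pbwh.
Qed.

Lemma pbw1 : pbw 1.
Proof.
have -> : 1 = pbw_term 0 1 0 by rewrite /pbw_term rmorph1 !mulr1.
exact: pbwT.
Qed.

Definition pbw_sum N (p : nat -> nat -> {poly Qh}) : U :=
  \sum_(a < N) \sum_(c < N) pbw_term a (p a c) c.

Lemma pbw_termD a p q c : pbw_term a (p + q) c = pbw_term a p c + pbw_term a q c.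
Proof. by rewrite /pbw_term raddfD /= mulrDr mulrDl. Qed.

Lemma pbw_term0 a c : pbw_term a 0 c = 0.
Proof. by rewrite /pbw_term raddf0 mulr0 mul0r. Qed.

Lemma pbw_sum_widen N N' p : (N <= N')%N ->
  (forall a c, ~~ ((a < N) && (c < N))%N -> p a c = 0) -> pbw_sum N' p = pbw_sum N p.
Proof.
move=> NN p0; rewrite /pbw_sum -(subnKC NN) big_split_ord /= [X in _ + X]big1 ?addr0.
  apply: eq_bigr => a _; rewrite big_split_ord /= [X in _ + X]big1 ?addr0 // => c _.
  rewrite p0 ?pbw_term0 //=; lia.
by move=> a _; apply: big1 => c _; rewrite p0 ?pbw_term0 // ltnNge leq_addr.
Qed.

Lemma pbw_normal x : pbw x -> exists N p y,
  (forall a c, ~~ ((a < N) && (c < N))%N -> p a c = 0) /\ x = pbw_sum N p + fps_h *: y.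
Proof.
elim=> {x} [|x y _ [N [p [z [p0 ->]]]] _ [N' [p' [z' [p0' ->]]]]|a p c|y].
- by exists 0, (fun _ _ => 0), 0; split=> //; rewrite /pbw_sum big_ord0 scaler0 addr0.
- exists (maxn N N'), (fun a c => p a c + p' a c), (z + z'); split=> [a c ac|].
    rewrite p0 ?p0' ?addr0 //; apply: contra ac => /andP[aN cN].
      by rewrite !leq_max aN cN !orbT.
    by rewrite !leq_max aN cN.
  rewrite -(@pbw_sum_widen N (maxn N N')) ?leq_maxl // -(@pbw_sum_widen N' (maxn N N')) ?leq_maxr //.
  rewrite scalerDr addrACA; congr (_ + _); rewrite /pbw_sum -big_split; apply: eq_bigr => a _.
  by rewrite -big_split; apply: eq_bigr => c _; rewrite pbw_termD.
- pose N := (maxn a c).+1; have aN : (a < N)%N by rewrite ltnS leq_maxl.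
  have cN : (c < N)%N by rewrite ltnS leq_maxr.
  exists N, (fun a' c' => if (a' == a) && (c' == c) then p else 0), 0; split=> [a' c'|].
    by move=> ac; case: ifP => // /andP[/eqP aE /eqP cE]; move: ac; rewrite aE cE aN cN.
  rewrite scaler0 addr0 /pbw_sum (bigD1 (Ordinal aN)) //= [X in _ + X]big1 ?addr0.
    rewrite (bigD1 (Ordinal cN)) //= [X in _ + X]big1 ?addr0 ?eqxx //.
    by move=> i; rewrite -val_eqE /= => /negPf ->; rewrite pbw_term0.
  move=> i; rewrite -val_eqE /= => /negPf ->; apply: big1 => j _; exact: pbw_term0.
- by exists 0, (fun _ _ => 0), y; split=> //; rewrite /pbw_sum big_ord0 add0r.
Qed.
End PBW.

Lemma evecE n g (i : 'I_n.+1) : evec n g i 0 = (i%:Z == g)%:R.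
Proof. by rewrite mxE. Qed.

Section Faithful.
Variable U : algType Qh.
Variables E F H : U.
Variable f : forall n, U -> 'M[Qh]_n.+1.
Hypotheses (fB : forall n x y, f n (x - y) = f n x - f n y)
  (fM : forall n x y, f n (x * y) = f n x * f n y)
  (fZ : forall n s x, f n (s *: x) = s *: f n x) (f1 : forall n, f n 1 = 1).
Hypotheses (fE : forall n, f n E = rE n) (fF : forall n, f n F = rF n)
  (fH : forall n, f n H = rH n).
Let fD n := hom_add (fB n).
Local Notation pe p := (horner_alg H p).

Lemma hom_sum n (I : finType) (G : I -> U) : f n (\sum_i G i) = \sum_i f n (G i).
Proof.
have f0 : f n 0 = 0 by rewrite -(subrr 0) fB subrr.
by elim/big_rec2: _ => // i y x _ <-.
Qed.

Lemma hom_pe n p g : f n (pe p) *m evec n g = p.[fps_const (n%:R - 2 * g%:~R)] *: evec n g.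
Proof.
elim/poly_ind: p => [|p c IH].
  by rewrite rmorph0 -(subrr 1) fB subrr mul0mx horner0 scale0r.
rewrite rmorphD rmorphM /= horner_algX horner_algC fD fM fZ f1 fH mulmxDl mulvA.
rewrite rdiag_evec -scalemxAr IH -scalemxAl mul1mx !scalerA -scalerDl.
by rewrite hornerD hornerM hornerX hornerC [_ * p.[_]]mulrC.
Qed.

Lemma hom_FX n a g : 0 <= g -> f n (F ^+ a) *m evec n g = evec n (g + a%:Z).
Proof.
move=> g0; elim: a => [|a IH]; first by rewrite f1 mul1mx addr0.
by rewrite exprS fM mulvA IH fF rF_evec -?addrA ?[a%:Z + 1]addrC -?intS // addr_ge0.
Qed.

Lemma hom_EX n c g : f n (E ^+ c) *m evec n g =
  (\prod_(l < c) Ec n (g - l%:Z)%:~R) *: evec n (g - c%:Z).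
Proof.
elim: c => [|c IH]; first by rewrite f1 mul1mx big_ord0 subr0 scale1r.
rewrite exprS fM mulvA IH -scalemxAr fE rE_evec scalerA big_ord_recr /=.
by rewrite -addrA -opprD [c%:Z + 1]addrC -intS.
Qed.

(** The coefficients p(H) of the normal form of x are shown to vanish modulo h: they are polynomials
    which vanish at infinitely many integers n. *)
Lemma hom_faithful x : pbw E F H x -> (forall n, exists Y, f n x = (fps_h : Qh) *: Y) ->
  exists y, x = (fps_h : Qh) *: y.
Proof.
move=> /pbw_normal [N [p [y [p0 xE]]]] fx.
have fN n : exists Y, f n (pbw_sum E F H N p) = (fps_h : Qh) *: Y.
  have [Y fxY] := fx n; exists (Y - f n y).
  by rewrite scalerBr -fZ -fxY -fB xE addrK.
suff p_h c a : map_poly fps0 (p a c) = 0.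
  have [p' p'E] : exists p' : nat -> nat -> {poly Qh}, forall a c, p a c = (fps_h : Qh) *: p' a c.
    exists (fun a c => projT1 (cid (poly_fps0_eq0 (p_h c a)))) => a c.
    by case: cid.
  exists (pbw_sum E F H N p' + y); rewrite xE scalerDr; congr (_ + _).
  rewrite /pbw_sum scaler_sumr; apply: eq_bigr => a _; rewrite scaler_sumr; apply: eq_bigr => c _.
  by rewrite /pbw_term p'E peZ -scalerAr -scalerAl.
(* Look at the entry of index a of x e_c in V_n. The terms with c' > c kill e_c, those with c' < c
   are divisible by h by induction, and c' = c leaves a nonzero multiple of p(n); both indices exist
   since n >= a + c. *)
elim/ltn_ind: c a => c IH a; apply: (@poly_nat_eq0 _ (a + c)) => n ac.
case: (boolP ((a < N) && (c < N))%N) => [/andP[aN cN]|/p0 ->]; last by rewrite raddf0 horner0.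
have an : (a < n.+1)%N by lia.
pose phi (X : 'M[Qh]_n.+1) := fps0 ((X *m evec n c) (Ordinal an) 0).
have phi_h X : phi ((fps_h : Qh) *: X) = 0.
  by rewrite /phi -scalemxAl mxE rmorphM /= mul0r.
have phi_sum (I : finType) (G : I -> 'M[Qh]_n.+1) : phi (\sum_i G i) = \sum_i phi (G i).
  by rewrite /phi mulmx_suml summxE raddf_sum.
have [Y fNY] := fN n; have := phi_h Y; rewrite -fNY /pbw_sum hom_sum phi_sum.
rewrite (bigD1 (Ordinal aN)) //= hom_sum phi_sum (bigD1 (Ordinal cN)) //=.
have term a' c' : phi (f n (pbw_term E F H a' (p a' c') c')) =
  if c' == c then if a' == a then fps0 (\prod_(l < c) Ec n (c%:Z - l%:Z)%:~R) * (map_poly fps0 (p a c)).[n%:R] else 0 else 0.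
  case: (ltngtP c' c) => [lt_cc|gt_cc|->].
  - have [p' pE] := poly_fps0_eq0 (IH _ lt_cc a').
    by rewrite /pbw_term pE peZ -scalerAr -scalerAl fZ phi_h.
  - rewrite /phi /pbw_term fM mulvA hom_EX (bigD1 (Ordinal gt_cc)) //= subrr.
    by rewrite Ec0 mul0r scale0r mulmx0 mxE rmorph0.
  rewrite /phi /pbw_term !fM !mulvA hom_EX subrr -!scalemxAr hom_pe -scalemxAr hom_FX //.
  rewrite add0r scalerA mxE evecE eqz_nat /= [a' == a]eq_sym.
  case: eqP => [<-|_]; last by rewrite mulr0 rmorph0.
  rewrite mulr1 rmorphM /=; congr (_ * _).
  by rewrite mulr0 subr0 -[LHS](horner_map fps0).
rewrite term !eqxx [\sum_(i < N | i != Ordinal cN) _]big1 ?addr0; last first.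
  by move=> i; rewrite -val_eqE term /= => /negPf ->.
rewrite [\sum_(i < N | _) _]big1 ?addr0; last first.
  move=> i; rewrite -val_eqE /= => /negPf ia; rewrite hom_sum phi_sum big1 // => j _.
  by rewrite term ia; case: ifP.
move=> /eqP; rewrite mulf_eq0 => /orP[|/eqP //].
rewrite rmorph_prod prodf_seq_eq0 => /hasP[l _] /=; rewrite /Ec rmorphM /= /fps0 !qn_coef0.
rewrite mulf_eq0 intrB subr_eq0 => /orP[|].
  by rewrite eqr_nat; have := ltn_ord l; lia.
have -> : n%:R + 1 - (c%:Z%:~R - l%:Z%:~R) = (n.+1 - (c - l))%:R :> rat.
  have lc := ltn_ord l; rewrite natrB ?natrB -?natr1 //; lia.
by rewrite pnatr_eq0; have := ltn_ord l; lia.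
Qed.
End Faithful.

(** * Expansions in the central elements *)

HB.instance Definition _ := GRing.isZmodMorphism.Build free Uh toUh (class_zmod sl2_rel).
HB.instance Definition _ := GRing.isMonoidMorphism.Build free Uh toUh (class_monoid sl2_rel).
HB.instance Definition _ := GRing.isScalable.Build Qh free Uh *:%R toUh (@class_scalable _ _ sl2_rel).

Lemma toUh_rel x : sl2_rel x -> toUh x = 0.
Proof.
move=> xr; apply: (etrans (classP _) (raddf0 toUh)); rewrite subr0; apply/asboolP => n.
by exists x, 0; split; [exact: gen_ideal_rel|rewrite scaler0 addr0].
Qed.

Section AbstractRel.
Variables (U V : algType Qh) (f : {lrmorphism U -> V}).

Lemma rel_sub2 x y : f (x * y - y * x - y *+ 2) = 0 -> f x * f y = f y * f x + f y *+ 2.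
Proof. by rewrite !raddfB raddfMn /= !rmorphM => /eqP; rewrite subr_eq0 subr_eq addrC => /eqP. Qed.

Lemma rel_add2 x y : f (x * y - y * x + y *+ 2) = 0 -> f x * f y = f y * f x - f y *+ 2.
Proof.
rewrite raddfD raddfB raddfMn /= !rmorphM => /eqP; rewrite addr_eq0 subr_eq addrC => /eqP ->.
by [].
Qed.

Lemma rel_EF_h x y z t : f (x * y - y * x - (z + fps_h *: t)) = 0 ->
  f x * f y = f y * f x + f z + fps_h *: f t.
Proof.
have -> : f (x * y - y * x - (z + fps_h *: t)) = f x * f y - f y * f x - (f z + fps_h *: f t).
  by rewrite -!rmorphM -linearZ_LR -raddfD -!raddfB.
by move=> /eqP; rewrite subr_eq0 subr_eq addrC addrA => /eqP.
Qed.
End AbstractRel.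

Definition UH : Uh := toUh wH.

Lemma Uh_HE : UH * UE = UE * UH + UE *+ 2.
Proof. exact/(@rel_sub2 _ _ toUh)/toUh_rel/rel_HE. Qed.

Lemma Uh_HF : UH * UF = UF * UH - UF *+ 2.
Proof. exact/(@rel_add2 _ _ toUh)/toUh_rel/rel_HF. Qed.

Lemma scale_coef1 (A : lalgType rat) (s : Qh) (z : {fps A}) :
  s 0%N = 0 -> (s *: z) 1%N = s 1%N *: z 0%N.
Proof.
by move=> s0; rewrite fpsEZ (sum2 (fun i => s i *: z (1 - i)%N)) s0 scale0r add0r.
Qed.

Lemma sub_inv_coef1 (A : nzRingType) (x : {fps A}) :
  x 0%N = 1 -> (x - x^-1) 1%N = x 1%N *+ 2.
Proof. by move=> x0; have [_ V1] := inv_coef1 x0; rewrite fpsED fpsEN V1 opprK. Qed.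

Lemma wK_coef1 : wK 1%N = (2^-1 : rat) *: wH 0%N.
Proof.
apply: (etrans (fps_exp_coef1 _)); apply: (etrans (scale_coef1 _ _)).
  by rewrite fps_coef0M mul0r.
by rewrite hdivn mulrC coef_hM.
Qed.

(** Compare the coefficients of h in K - K^-1 and in v - v^-1, which are H and 1. *)
Lemma exquot_wK : exists t, exquot (wK - wK^-1) (v - v^-1)%:A = wH + fps_h *: t.
Proof.
move: (exquot_v wK_sub0); set z := exquot _ _; move: z => z zE.
have z0 : z 0%N = wH 0%N.
  have <- : ((v - v^-1) *: z) 1%N = z 0%N.
    by rewrite (scale_coef1 _ v_sub_coef0) v_subE br_coef1 scale1r.
  rewrite -mulr_algl zE (sub_inv_coef1 (fps_exp_coef0 _)) wK_coef1.
  by move: (wH 0%N) => w; rewrite -scaler_nat scalerA divff // scale1r.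
exists (Fps (fun n => z n.+1)); rewrite hscaleE; apply: fpsP => -[|k].
  by rewrite fpsED z0 addr0.
by rewrite fpsED add0r.
Qed.

Lemma Uh_EF : exists t, UE * UF = UF * UE + UH + fps_h *: t.
Proof.
have [t tE] := exquot_wK; exists (toUh t); apply: (@rel_EF_h _ _ toUh).
by rewrite -tE; apply: toUh_rel; apply: rel_EF.
Qed.

Lemma rep_UE n : rhoUh n UE = rE n. Proof. exact: (etrans (rhoUh_class _ _) (rho_letter _ _)). Qed.
Lemma rep_UF n : rhoUh n UF = rF n. Proof. exact: (etrans (rhoUh_class _ _) (rho_letter _ _)). Qed.
Lemma rep_UH n : rhoUh n UH = rH n. Proof. exact: (etrans (rhoUh_class _ _) (rho_letter _ _)). Qed.

Section AbstractWords.
Variables (U : algType Qh) (E F H t : U).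
Hypotheses (HE : H * E = E * H + E *+ 2) (HF : H * F = F * H - F *+ 2)
  (EF : E * F = F * E + H + fps_h *: t).
Variable f : {lrmorphism free -> U}.
Hypotheses (fE : f wE = E) (fF : f wF = F) (fH : f wH = H).

Lemma letter_monomial g w : monomial (mmul (fmu g) w) = letter g * monomial w.
Proof.
rewrite /monomial -rmorphM; congr fps_const.
by rewrite [RHS]malgM_def fgmulUU mulr1.
Qed.

Lemma pbw_word (w : word) : pbw E F H (f (monomial w)).
Proof.
rewrite -[w]fmK; elim: (w : seq gen) => [|g s IH].
  have -> : monomial (FMonom [::]) = 1 by rewrite -fmoneE.
  by rewrite rmorph1; apply: pbw1.
have -> : FMonom (g :: s) = mmul (fmu g) (FMonom s) by rewrite [RHS]fmmulE fmuE.
rewrite letter_monomial rmorphM /=; case: g.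
- by rewrite [f (letter GenH)]fH; apply: pbwH.
- by rewrite [f (letter GenE)]fE; apply: pbwE EF _ _ => //.
- by rewrite [f (letter GenF)]fF; apply: pbwF.
Qed.

(** Only the constant coefficient of x matters, which is a finite sum of words; the rest is a
    multiple of h. *)
Lemma pbw_free x : pbw E F H (f x).
Proof.
have fZ s y : f (s *: y) = s *: f y by exact: linearZ_LR.
have -> : x = fps_const (x 0%N) + (fps_h : Qh) *: Fps (fun n => x n.+1).
  by rewrite hscaleE; apply: fpsP => -[|n]; rewrite fpsED /= ?addr0 ?add0r.
rewrite (raddfD f) /= fZ; apply: pbwD; last exact: pbwh.
have term c (m : word) : pbw E F H (f (fps_const (<< c *g m >> : malgQ word))).
  have -> : fps_const (<< c *g m >> : malgQ word) = (fps_const c : Qh) *: monomial m.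
    by rewrite [RHS]hscale_const malgZU mulr1.
  by rewrite fZ; apply: pbwZ; apply: pbw_word.
have -> : x 0%N = \sum_(m <- msupp (x 0%N)) (<< (x 0%N)@_m *g m >> : malgQ word) by rewrite -monalgE.
rewrite !raddf_sum; elim/big_ind: _ => [|a b|m _]; [exact: pbw0|exact: pbwD|exact: term].
Qed.
End AbstractWords.

Lemma pbw_Uh (x : Uh) : pbw UE UF UH x.
Proof.
have [t EF] := Uh_EF; have [X ->] := class_surj x.
exact: (@pbw_free Uh UE UF UH t Uh_HE Uh_HF EF toUh).
Qed.

Lemma hscaleS (V : lmodType Qh) k (z : V) : fps_h *: (fps_h ^+ k *: z) = fps_h ^+ k.+1 *: z.
Proof. by rewrite scalerA exprS. Qed.

(** Division by one h at a time: as matrices over Q[[h]] have no h-torsion, the quotient satisfies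
    the hypothesis for k - 1. *)
Lemma rho_faithful k (x : Uh) : (forall n, exists Y, rhoUh n x = (fps_h : Qh) ^+ k *: Y) ->
  exists y, x = (fps_h : Qh) ^+ k *: y.
Proof.
elim: k x => [|k IH] x xh; first by exists x; rewrite scale1r.
have [y yE] : exists y, x = (fps_h : Qh) *: y.
  apply: (@hom_faithful Uh UE UF UH rhoUh rhoUhB rhoUhM rhoUhZ rhoUh1 rep_UE rep_UF rep_UH x (pbw_Uh x)) => n.
  by have [Y ->] := xh n; exists ((fps_h : Qh) ^+ k *: Y); rewrite scalerA exprS.
have [z zE] : exists z, y = (fps_h : Qh) ^+ k *: z.
  apply: IH => n; have [Y] := xh n; rewrite yE rhoUhZ => H; exists Y.
  apply/matrixP => i j; apply: (mulfI fps_h_neq0).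
  by have := congr1 (fun X : 'M_n.+1 => X i j) H; rewrite !mxE exprS mulrA.
by exists z; rewrite yE zE; apply: hscaleS.
Qed.

Lemma sigE n p : sig n p =
  \prod_(1 <= i < p.+1) (br (n%:R + 1 + i%:R) * br (n%:R + 1 - i%:R)).
Proof.
apply: eq_bigr => i _; rewrite brM.
have -> : (n%:R + 1 + i%:R + (n%:R + 1 - i%:R)) / 2 = n%:R + 1 :> rat by field.
have -> : - (n%:R + 1 + i%:R + (n%:R + 1 - i%:R)) / 2 = - (n%:R + 1) :> rat by field.
have -> : (n%:R + 1 + i%:R - (n%:R + 1 - i%:R)) / 2 = i%:R :> rat by field.
by have -> : - (n%:R + 1 + i%:R - (n%:R + 1 - i%:R)) / 2 = - i%:R :> rat by field.
Qed.

Lemma sig_gt n p : (n < p)%N -> sig n p = 0.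
Proof.
move=> np; rewrite sigE; apply/eqP; rewrite prodf_seq_eq0; apply/hasP; exists n.+1.
  by rewrite mem_index_iota.
by rewrite natr1 subrr br0 mulr0 eqxx.
Qed.

Lemma sig_neq0 n p : (p <= n)%N -> sig n p != 0.
Proof.
move=> pn; rewrite sigE prodf_seq_neq0; apply/allP => i; rewrite mem_index_iota => /andP[i0 ip] /=.
rewrite mulf_neq0 // br_neq0 //; first by rewrite natr1 -natrD pnatr_eq0.
by rewrite natr1 subr_eq0 eqr_nat; lia.
Qed.

Lemma sig_h n p : exists y, sig n p = fps_h ^+ p * y.
Proof.
rewrite sigE; elim: p => [|p [y IH]]; first by exists 1; rewrite big_nil mulr1.
rewrite big_nat_recr // IH /= !brE.
exists (y * (brh (n%:R + 1 + p.+1%:R) * (fps_h * brh (n%:R + 1 - p.+1%:R)))).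
by rewrite exprSr; ring.
Qed.

Lemma rhoUh_sum n (u : nat -> Uh) N : rhoUh n (\sum_(p < N) u p) = \sum_(p < N) rhoUh n (u p).
Proof. exact: (@hom_sum Uh rhoUh rhoUhB n _ (fun p : 'I_N => u p)). Qed.

Lemma rhoUh_partial n (a : nat -> Qh) N :
  rhoUh n (\sum_(p < N) a p *: sigma p) = (\sum_(p < N) a p * sig n p)%:A.
Proof.
rewrite (rhoUh_sum n (fun p => a p *: sigma p)) scaler_suml; apply: eq_bigr => p _.
by rewrite rhoUhZ rho_sigma scalerA.
Qed.

Lemma sum_sig n (a : nat -> Qh) N : (n < N)%N ->
  \sum_(p < N) a p * sig n p = \sum_(p < n.+1) a p * sig n p.
Proof.
move=> nN; rewrite -(subnKC nN) big_split_ord /= [X in _ + X]big1 ?addr0 // => p _.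
by rewrite sig_gt ?mulr0 //= ltn_addr.
Qed.

(** By [rho_faithful], convergence is tested on the V_n, provided that it is uniform in n; it is,
    because h^p divides [sig n p] for all n. *)
Lemma hsum_sigma (x : Uh) (c a : nat -> Qh) :
  (forall n, rhoUh n x = (c n)%:A) -> (forall n, c n = \sum_(p < n.+1) a p * sig n p) ->
  hsum (fun p => a p *: sigma p) x.
Proof.
move=> xc cE k; exists k => N kN; apply: rho_faithful => n.
rewrite rhoUhB xc rhoUh_partial -scalerBl cE.
have [y ->] : exists y, \sum_(p < N) a p * sig n p - \sum_(p < n.+1) a p * sig n p = fps_h ^+ k * y.
  case: (ltnP n N) => [nN|Nn]; first by exists 0; rewrite sum_sig // subrr mulr0.
  have [y yE] : exists y : nat -> Qh, forall p, sig n p = fps_h ^+ p * y p.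
    by exists (fun p => projT1 (cid (sig_h n p))) => p; case: cid.
  have Nn' : (N <= n.+1)%N by rewrite ltnW.
  rewrite -(subnKC Nn') big_split_ord /= opprD addrA subrr add0r.
  exists (- \sum_(i < n.+1 - N) a (N + i)%N * (fps_h ^+ (N + i - k) * y (N + i)%N)).
  rewrite mulrN mulr_sumr; congr (- _); apply: eq_bigr => i _; rewrite yE.
  by rewrite -[X in fps_h ^+ X](@subnKC k) ?exprD; [ring|rewrite (leq_trans kN) // leq_addr].
by exists y%:A; rewrite scalerA.
Qed.

Lemma hsum_rho n (x : Uh) (c a : nat -> Qh) :
  rhoUh n x = (c n)%:A -> hsum (fun p => a p *: sigma p) x ->
  c n = \sum_(p < n.+1) a p * sig n p.
Proof.
move=> xc xa; apply/eqP; rewrite eq_sym -subr_eq0; apply/eqP/fps_dvd_h_eq0 => k.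
have [N HN] := xa k; have [y yE] := HN (maxn N n.+1) (leq_maxl _ _).
have := congr1 (rhoUh n) yE; rewrite rhoUhB rhoUhZ rhoUh_partial xc.
rewrite sum_sig ?leq_maxr // -scalerBl => H.
exists (rhoUh n y 0 0); have := congr1 (fun X : 'M_n.+1 => X 0 0) H.
by rewrite !mxE eqxx mulr1.
Qed.

Lemma sigma_coef_uniq (c a b : nat -> Qh) :
  (forall n, c n = \sum_(p < n.+1) a p * sig n p) ->
  (forall n, c n = \sum_(p < n.+1) b p * sig n p) -> a = b.
Proof.
move=> ca cb; apply/funext; elim/ltn_ind => n IH; apply: (mulIf (sig_neq0 (leqnn n))).
have := etrans (esym (ca n)) (cb n); rewrite !big_ord_recr /=.
rewrite (eq_bigr (fun p : 'I_n => b p * sig n p)) => [/addrI //|p _].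
by rewrite IH.
Qed.

(** * Integrality by interpolation *)

Definition Lq : {pred Qh} := fun a => `[< laurent_q a >].

Lemma LqP a : reflect (laurent_q a) (a \in Lq).
Proof. exact: asboolP. Qed.

Definition zq (P : {poly int}) : Qh := (map_poly intr P).[q].
Lemma zqD P R : zq (P + R) = zq P + zq R. Proof. by rewrite /zq rmorphD hornerD. Qed.
Lemma zqN P : zq (- P) = - zq P. Proof. by rewrite /zq rmorphN hornerN. Qed.
Lemma zqM P R : zq (P * R) = zq P * zq R. Proof. by rewrite /zq rmorphM hornerM. Qed.
Lemma zqX n : zq 'X^n = eh n%:R. Proof. by rewrite /zq map_polyXn hornerXn qX. Qed.
Lemma zq1 : zq 1 = 1. Proof. by rewrite /zq rmorph1 hornerC. Qed.

Fact Lq_subring : subring_closed Lq.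
Proof.
split=> [|a b /LqP[P [n ->]] /LqP[R [m ->]]|a b /LqP[P [n ->]] /LqP[R [m ->]]]; apply/LqP.
- by exists 1, 0; rewrite -/(zq _) zq1 qXN oppr0 eh0 mulr1.
- exists ('X^m * P - 'X^n * R), (n + m)%N; rewrite -!/(zq _) zqD zqN !zqM !zqX !qXN natrD opprD.
  rewrite mulrBr !mulrA -!ehD; congr (eh _ * _ - eh _ * _); ring.
- exists (P * R), (n + m)%N; rewrite -!/(zq _) zqM !qXN natrD opprD ehD; ring.
Qed.
HB.instance Definition _ := GRing.isSubringClosed.Build Qh Lq Lq_subring.

Lemma Lq_eh (k : int) : eh k%:~R \in Lq.
Proof.
apply/LqP; case: k => k.
  by exists 'X^k, 0; rewrite -/(zq _) zqX qXN oppr0 eh0 mul1r.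
by exists 1, k.+1; rewrite -/(zq _) zq1 qXN mulr1 NegzE rmorphN.
Qed.

Lemma Lq_ehn (k : nat) : eh k%:R \in Lq. Proof. exact: (Lq_eh k). Qed.
Lemma Lq_ehN (k : nat) : eh (- k%:R) \in Lq.
Proof. by have := Lq_eh (- k%:Z); rewrite rmorphN. Qed.

Lemma Lq_fps0 a : a \in Lq -> exists z : int, a 0%N = z%:~R.
Proof.
move=> /LqP[P [n ->]]; exists P.[1].
rewrite fps_coef0M qXN eh_coef0 mul1r.
have q0 : fps0 q = 1 by rewrite /fps0 qE eh_coef0.
transitivity ((map_poly fps0 (map_poly intr P)).[fps0 q]); first by rewrite horner_map.
rewrite q0 -map_poly_comp -[1 in LHS](rmorph1 intr) -[RHS]horner_map; congr (_.[_]).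
by apply: eq_map_poly => z /=; rewrite rmorph_int.
Qed.

(** Nothing is asked of x itself, so congruences can be stated for the scalars c(n) before these are
    known to lie in Z[q,q^-1]. *)
Definition dvdL (s x : Qh) := exists2 u, u \in Lq & x = s * u.

Lemma dvdL_refl s : dvdL s s. Proof. by exists 1; rewrite ?rpred1 ?mulr1. Qed.
Lemma dvdL0 s : dvdL s 0. Proof. by exists 0; rewrite ?rpred0 ?mulr0. Qed.
Lemma dvdLD s x y : dvdL s x -> dvdL s y -> dvdL s (x + y).
Proof. by move=> [u uL ->] [w wL ->]; exists (u + w); rewrite ?rpredD // mulrDr. Qed.
Lemma dvdLN s x : dvdL s x -> dvdL s (- x).
Proof. by move=> [u uL ->]; exists (- u); rewrite ?rpredN // mulrN. Qed.
Lemma dvdLB s x y : dvdL s x -> dvdL s y -> dvdL s (x - y).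
Proof. by move=> sx /dvdLN; apply: dvdLD. Qed.
Lemma dvdL_mulr s x w : w \in Lq -> dvdL s x -> dvdL s (x * w).
Proof. by move=> wL [u uL ->]; exists (u * w); rewrite ?rpredM // mulrA. Qed.
Lemma dvdL_mull s x w : w \in Lq -> dvdL s x -> dvdL s (w * x).
Proof. by move=> wL; rewrite mulrC; apply: dvdL_mulr. Qed.
Lemma dvdL_trans s t x : dvdL s t -> dvdL t x -> dvdL s x.
Proof. by move=> [u uL ->] [w wL ->]; exists (u * w); rewrite ?rpredM // mulrA. Qed.
Lemma dvdL_mul s t x y : dvdL s x -> dvdL t y -> dvdL (s * t) (x * y).
Proof. by move=> [u uL ->] [w wL ->]; exists (u * w); rewrite ?rpredM // mulrACA. Qed.
Lemma dvdL_sum (I : Type) (r : seq I) (P : pred I) (F : I -> Qh) s :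
  (forall i, P i -> dvdL s (F i)) -> dvdL s (\sum_(i <- r | P i) F i).
Proof. by move=> sF; elim/big_rec: _ => [|i x /sF ? ?]; [exact: dvdL0|exact: dvdLD]. Qed.

Definition Pq (k : int) (n : nat) : Qh := \prod_(l < n) (eh (k%:~R + l%:R) - 1).
Definition qfac (n : nat) : Qh := Pq 1 n.

Lemma PqS k n : Pq k n.+1 = Pq k n * (eh (k%:~R + n%:R) - 1).
Proof. by rewrite /Pq big_ord_recr. Qed.

Lemma Pq_rec k n : Pq k n.+1 = (eh k%:~R - 1) * Pq (k + 1) n.
Proof.
rewrite /Pq big_ord_recl addr0; congr (_ * _); apply: eq_bigr => i _.
by rewrite lift0 intrD -addrA -natr1 [1 + _]addrC.
Qed.

Lemma qfacS n : qfac n.+1 = qfac n * (eh n.+1%:R - 1).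
Proof. by rewrite /qfac PqS nat1r. Qed.

Lemma Lq_eh1 (k : int) (l : nat) : eh (k%:~R + l%:R) - 1 \in Lq.
Proof.
have -> : k%:~R + l%:R = (k + l%:Z)%:~R :> rat by rewrite intrD.
by rewrite rpredB ?rpred1 ?Lq_eh.
Qed.

Lemma Lq_prod (I : Type) (r : seq I) (F : I -> Qh) :
  (forall i, F i \in Lq) -> \prod_(i <- r) F i \in Lq.
Proof. by move=> FL; elim/big_ind: _ => // [|x y xL yL]; [exact: rpred1|exact: rpredM]. Qed.

Lemma Pq_Lq k n : Pq k n \in Lq.
Proof. by apply: Lq_prod => l; apply: Lq_eh1. Qed.

(** Integrality of q-binomials with any integer upper entry. The product vanishes for k = 0, and
    passing from k to k + 1 changes it by a multiple of (q^(n+1) - 1) times a product of length n;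
    so one can move from 0 in both directions. *)
Lemma Pq_dvd n k : dvdL (qfac n) (Pq k n).
Proof.
elim: n k => [|n IH] k; first by exists 1; rewrite ?rpred1 // /qfac /Pq !big_ord0 mulr1.
have step i : Pq (i + 1) n.+1 - Pq i n.+1 = eh i%:~R * ((eh n.+1%:R - 1) * Pq (i + 1) n).
  rewrite PqS Pq_rec intrD -[n.+1%:R]natr1 -addrA [1%:~R + _]addrC -[1%:~R]/(1 : rat).
  by rewrite ehD; ring.
have dstep i : dvdL (qfac n.+1) (Pq (i + 1) n.+1 - Pq i n.+1).
  rewrite step qfacS; apply: dvdL_mull; first exact: Lq_eh.
  by rewrite [X in dvdL _ X]mulrC; apply: dvdL_mul; [exact: IH|exact: dvdL_refl].
elim/int_ind: k => [|k IHk|k IHk].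
- by rewrite Pq_rec eh0 subrr mul0r; apply: dvdL0.
- by have := dvdLD (dstep k%:Z) IHk; rewrite subrK [k%:Z + 1]addrC -intS.
- have := dvdLB IHk (dstep (- k.+1%:Z)).
  have -> : - k.+1%:Z + 1 = - k%:Z by lia.
  by rewrite opprB addrC subrK.
Qed.

(** The Laurent polynomials in q^l over Z[q,q^-1]. *)
Definition EP (f : int -> Qh) := exists (d : int) (P : {poly Qh}),
  P \is a polyOver Lq /\ forall l, f l = eh (d * l)%:~R * P.[eh l%:~R].

Lemma EP_ext f g : f =1 g -> EP f -> EP g.
Proof. by move=> fg [d [P [PL fE]]]; exists d, P; split=> // l; rewrite -fg. Qed.

Lemma EP_const c : c \in Lq -> EP (fun=> c).
Proof. by move=> cL; exists 0, c%:P; rewrite polyOverC; split=> // l; rewrite mul0r eh0 hornerC mul1r. Qed.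

Lemma EP_eh (d c : int) : EP (fun l => eh (d * l + c)%:~R).
Proof.
exists d, (eh c%:~R)%:P; rewrite polyOverC Lq_eh; split=> // l.
by rewrite hornerC intrD ehD.
Qed.

Lemma EP_mul f g : EP f -> EP g -> EP (fun l => f l * g l).
Proof.
move=> [d [P [PL fE]]] [d' [P' [PL' gE]]]; exists (d + d'), (P * P'); rewrite rpredM //; split=> // l.
by rewrite fE gE hornerM mulrDl intrD ehD; ring.
Qed.

Lemma EP_lower f d P (k : nat) : P \is a polyOver Lq -> (forall l, f l = eh (d * l)%:~R * P.[eh l%:~R]) ->
  P * 'X^k \is a polyOver Lq /\ forall l, f l = eh ((d - k%:Z) * l)%:~R * (P * 'X^k).[eh l%:~R].
Proof.
move=> PL fE; rewrite rpredM ?polyOverXn //; split=> // l.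
rewrite fE hornerM hornerXn -ehMn.
have -> : eh (d * l)%:~R = eh ((d - k%:Z) * l)%:~R * eh (l%:~R *+ k) :> Qh.
  by rewrite -ehD -mulr_natr !intrM intrB; congr eh; ring.
by ring.
Qed.

Lemma EP_add f g : EP f -> EP g -> EP (fun l => f l + g l).
Proof.
move=> [d [P [PL fE]]] [d' [P' [PL' gE]]].
wlog dd : f g d d' P P' PL PL' fE gE / d <= d'.
  move=> H; case/orP: (le_total d d') => dd; first exact: (H f g d d' P P').
  by apply: EP_ext (H g f d' d P' P PL' PL gE fE dd) => l; rewrite addrC.
have [PL'' gE'] := @EP_lower g d' P' (absz (d' - d)) PL' gE.
exists d, (P + P' * 'X^(absz (d' - d))); rewrite rpredD //; split=> // l.
rewrite fE gE' hornerD mulrDr; congr (_ + eh _%:~R * _); congr (_ * _); lia.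
Qed.

Lemma EP_sum (I : Type) (r : seq I) (F : I -> int -> Qh) :
  (forall i, EP (F i)) -> EP (fun l => \sum_(i <- r) F i l).
Proof.
move=> FE; elim: r => [|i r IH].
  by apply: EP_ext (EP_const (rpred0 _)) => l; rewrite big_nil.
by apply: EP_ext (EP_add (FE i) IH) => l; rewrite big_cons.
Qed.

Lemma EP_prod (I : Type) (r : seq I) (F : I -> int -> Qh) :
  (forall i, EP (F i)) -> EP (fun l => \prod_(i <- r) F i l).
Proof.
move=> FE; elim: r => [|i r IH].
  by apply: EP_ext (EP_const (rpred1 _)) => l; rewrite big_nil.
by apply: EP_ext (EP_mul (FE i) IH) => l; rewrite big_cons.
Qed.

Lemma EP_sub f g : EP f -> EP g -> EP (fun l => f l - g l).
Proof.
move=> fE gE; have := EP_add fE (EP_mul (EP_const (rpredN1 Lq)) gE).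
by apply: EP_ext => l; rewrite mulN1r.
Qed.

(** Induction on the degree: the leading term is removed by a q-difference, and the value at m - 1
    is recovered because q^d is a unit. *)
Lemma poly_back d (P : {poly Qh}) Q (m : int) : (size P <= d)%N -> P \is a polyOver Lq ->
  (forall l : int, m <= l -> dvdL Q P.[eh l%:~R]) -> dvdL Q P.[eh (m - 1)%:~R].
Proof.
elim: d P => [|d IH] P sP PL QP.
  by move: sP; rewrite leqn0 size_poly_eq0 => /eqP ->; rewrite horner0; apply: dvdL0.
(* P'(x) = P(q x) - q^d P(x). *)
pose P' := \poly_(i < d) (P`_i * (eh i%:R - eh d%:R)).
have P'E (l : int) : P'.[eh l%:~R] = P.[eh (l + 1)%:~R] - eh d%:R * P.[eh l%:~R].
  rewrite horner_poly (horner_coef_wide _ sP) (horner_coef_wide (eh l%:~R) sP).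
  rewrite mulr_sumr -sumrB big_ord_recr /=.
  have -> : P`_d * eh (l + 1)%:~R ^+ d - eh d%:R * (P`_d * eh l%:~R ^+ d) = 0.
    rewrite -!ehMn intrD mulrnDl ehD -[1%:~R *+ d]/(d%:R); ring.
  rewrite addr0; apply: eq_bigr => i _.
  by rewrite -!ehMn intrD mulrnDl ehD -[1%:~R *+ i]/(i%:R); ring.
have P'L : P' \is a polyOver Lq.
  apply: polyOver_poly => i _; rewrite rpredM ?rpredB ?Lq_ehn //; exact: (polyOverP PL).
have := IH P' (size_poly _ _) P'L; rewrite P'E subrK => H.
have : dvdL Q (P.[eh m%:~R] - eh d%:R * P.[eh (m - 1)%:~R]).
  apply: H => l ml; rewrite P'E; apply: dvdLB; first by apply: QP; lia.
  by apply: dvdL_mull; [exact: Lq_ehn|exact: QP].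
move=> /(dvdLB (QP m (lexx m))); rewrite opprB addrC subrK => /(dvdL_mull (Lq_ehN d)).
by rewrite mulrA -ehD addNr eh0 mul1r.
Qed.

Lemma EP_back f Q (m : int) : EP f -> (forall l : int, m <= l -> dvdL Q (f l)) -> dvdL Q (f (m - 1)).
Proof.
move=> [d [P [PL fE]]] Qf; rewrite fE; apply: dvdL_mull; first exact: Lq_eh.
apply: (poly_back (leqnn _)) => // l /Qf; rewrite fE => /(dvdL_mull (Lq_eh (- (d * l)))).
by rewrite mulrA -ehD -intrD addNr eh0 mul1r.
Qed.

Lemma poly_sub_factor (P : {poly Qh}) y : P \is a polyOver Lq -> y \in Lq ->
  exists2 P1, P1 \is a polyOver Lq & forall z, P.[z] = P.[y] + (z - y) * P1.[z].
Proof.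
move=> PL yL; exists (\sum_(i < size P) P`_i *: \sum_(j < i) y ^+ j *: 'X^(i.-1 - j)).
  apply: rpred_sum => i _; apply: polyOverZ; first exact: (polyOverP PL).
  by apply: rpred_sum => j _; apply: polyOverZ; [exact: rpredX|exact: polyOverXn].
move=> z; rewrite !(horner_coef P) horner_sum mulr_sumr -big_split; apply: eq_bigr => i _ /=.
rewrite hornerZ horner_sum mulrCA -mulrDr; congr (_ * _).
rewrite (eq_bigr (fun j : 'I_i => z ^+ (i.-1 - j) * y ^+ j)); last first.
  by move=> j _; rewrite hornerZ hornerXn mulrC.
by rewrite -subrXX addrC subrK.
Qed.

Local Notation ez k := (eh k%:~R).

Fixpoint vdm (ks : seq int) : Qh :=
  if ks is k :: ks' then vdm ks' * \prod_(k' <- ks') (ez k' - ez k) else 1.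

Lemma ez_sub_neq0 (a b : int) : a != b -> ez a - ez b != 0.
Proof.
move=> ab; have -> : ez a - ez b = ez b * (eh (a - b)%:~R - 1).
  by rewrite mulrBr mulr1 -ehD -intrD [b + _]addrC subrK.
rewrite mulf_neq0 ?eh_neq0 //; apply/eqP => /(congr1 (fun x : Qh => x 1%N)) /eqP.
rewrite fpsED fpsEN /= subr0 divr1 intr_eq0 subr_eq0; exact/negP.
Qed.

Lemma vdm_Lq ks : vdm ks \in Lq.
Proof.
elim: ks => [|k ks IH] /=; first exact: rpred1.
by rewrite rpredM // Lq_prod // => i; rewrite rpredB ?Lq_eh.
Qed.

(* Newton interpolation at the points q^k, k in ks, modulo s. *)
Lemma newton_mod (ks : seq int) (P : {poly Qh}) (z s Q : Qh) :
  uniq ks -> P \is a polyOver Lq -> z \in Lq -> s \in Lq -> dvdL (s * vdm ks) Q ->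
  (forall k, k \in ks -> dvdL Q P.[ez k]) ->
  exists A B, [/\ A \in Lq, B \in Lq & P.[z] = s * A + \prod_(k <- ks) (z - ez k) * B].
Proof.
elim: ks P Q => [|k ks IH] P Q /=.
  move=> _ PL zL sL _ _; exists 0, P.[z]; rewrite rpred0 rpred_horner //; split=> //.
  by rewrite mulr0 add0r big_nil mul1r.
move=> /andP[kks uks] PL zL sL sQ QP.
have [P1 P1L PE] := poly_sub_factor PL (Lq_eh k).
have QL (j : int) : ez j \in Lq := Lq_eh j.
have [A [B [AL BL P1E]]] : exists A B, [/\ A \in Lq, B \in Lq &
    P1.[z] = s * A + \prod_(k <- ks) (z - ez k) * B].
  (* P1(q^j) is the quotient of P(q^j) - P(q^k) by q^j - q^k; the Vandermonde product
     [vdm (k :: ks)] pays for this division with its factor at j and still leaves [s * vdm ks]. *)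
  apply: (IH P1 (s * vdm ks)) => // [|j jks]; first exact: dvdL_refl.
  have : dvdL Q ((ez j - ez k) * P1.[ez j]).
    have := dvdLB (QP j _) (QP k (mem_head _ _)); rewrite PE addrC addKr; apply.
    by rewrite inE jks orbT.
  move/(dvdL_trans sQ) => [u uL]; rewrite (big_rem j) //= => E.
  exists (\prod_(i <- rem j ks) (ez i - ez k) * u).
    by rewrite rpredM // Lq_prod // => i; rewrite rpredB.
  have jk : j != k by apply: contraNneq kks => <-.
  by apply: (mulfI (ez_sub_neq0 jk)); rewrite E; ring.
have VL : vdm (k :: ks) \in Lq by exact: vdm_Lq.
have [u uL uE] := dvdL_trans (dvdL_trans (dvdL_mulr VL (dvdL_refl s)) sQ) (QP k (mem_head _ _)).
exists (u + (z - ez k) * A), B; split=> //; first by rewrite rpredD // rpredM // rpredB.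
by rewrite PE uE P1E big_cons; ring.
Qed.

(** The admissible denominators: an error modulo (q)_M with M large remains integral after division
    by s. *)
Definition dvd_qfac s := exists N, forall M, (N <= M)%N -> dvdL s (qfac M).

Lemma qfac_addn N k : qfac (N + k) = qfac N * Pq N.+1 k.
Proof.
elim: k => [|k IH]; first by rewrite addn0 /Pq big_ord0 mulr1.
by rewrite addnS qfacS IH PqS mulrA -[N.+1%:~R]/(N.+1%:R : rat) -natrD addSn.
Qed.

Lemma qfac_dvd N M : (N <= M)%N -> dvdL (qfac N) (qfac M).
Proof. by move=> /subnKC <-; rewrite qfac_addn; exists (Pq N.+1 (M - N)); rewrite ?Pq_Lq. Qed.

Lemma dvd_qfac1 : dvd_qfac 1.
Proof. by exists 0 => M _; exists (qfac M); rewrite ?Pq_Lq ?mul1r. Qed.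

(** Up to a unit, q^a - q^b is q^k - 1 with k = |a - b|, which divides (q)_k and hence the product
    of any k consecutive factors of (q)_M. *)
Lemma dvd_qfac_mul s (a b : int) : a != b -> dvd_qfac s -> dvd_qfac (s * (ez a - ez b)).
Proof.
move=> ab [N sN]; pose k := absz (a - b); exists (N + k)%N => M NM.
apply: dvdL_trans (qfac_dvd NM); rewrite qfac_addn; apply: dvdL_mul; first exact: sN.
apply: dvdL_trans (Pq_dvd _ _); have [m kE] : exists m, k = m.+1 by exists k.-1; rewrite /k; lia.
rewrite kE qfacS mulrC; apply: dvdL_mulr; first exact: Pq_Lq.
rewrite -kE; case: (leP b a) => ba.
  exists (eh (- b)%:~R); rewrite ?Lq_eh // mulrBl -!ehD -!intrD subrr eh0; congr (eh _ - _).
  by have -> : a - b = k%:Z by rewrite /k; lia.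
exists (- eh (- a)%:~R); rewrite ?rpredN ?Lq_eh // mulrN mulrBl -!ehD -!intrD subrr eh0 opprB; congr (eh _ - _).
by have -> : b - a = k%:Z by rewrite /k; lia.
Qed.

Lemma dvd_qfac_prod s (ks : seq int) (F G : int -> int) :
  (forall k, k \in ks -> F k != G k) -> dvd_qfac s ->
  dvd_qfac (s * \prod_(k <- ks) (ez (F k) - ez (G k))).
Proof.
elim: ks s => [|k ks IH] s FG sD; first by rewrite big_nil mulr1.
rewrite big_cons mulrA; apply: IH => [j jks|]; first by apply: FG; rewrite inE jks orbT.
by apply: dvd_qfac_mul => //; apply: FG; rewrite mem_head.
Qed.

Lemma dvd_qfac_vdm s ks : uniq ks -> dvd_qfac s -> dvd_qfac (s * vdm ks).
Proof.
elim: ks s => [|k ks IH] s /=; first by rewrite mulr1.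
move=> /andP[kks uks] sD; rewrite mulrA.
apply: (@dvd_qfac_prod _ ks id (fun=> k)) => [j jks|]; last exact: IH.
by apply: contraNneq kks => <-.
Qed.

Lemma fps_coef1M (x y : Qh) : x 0%N = 0 -> (x * y) 1%N = x 1%N * y 0%N.
Proof.
by move=> x0; rewrite fpsEM (sum2 (fun i => x i * y (1 - i)%N)) x0 mul0r add0r.
Qed.

Definition sigz (l : int) (p : nat) : Qh :=
  \prod_(1 <= i < p.+1) (ez (l + 1) + ez (- (l + 1)) - eh i%:R - eh (- i%:R)).

Lemma sigzE n p : sigz n%:Z p = sig n p.
Proof. by apply: eq_bigr => i _; rewrite mulrNz intrD. Qed.

Lemma sigz_sym l p : sigz (- (l + 2)) p = sigz l p.
Proof.
apply: eq_bigr => i _; congr (_ - _ - _); rewrite addrC.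
have -> : - (- (l + 2) + 1) = l + 1 by lia.
by have -> : - (l + 2) + 1 = - (l + 1) by lia.
Qed.

Lemma sigz_EP p : EP (sigz^~ p).
Proof.
apply: EP_prod => i; apply: EP_sub; last exact/EP_const/Lq_ehN.
apply: EP_sub; last exact/EP_const/Lq_ehn.
apply: EP_add; first by apply: EP_ext (EP_eh 1 1) => l; rewrite mul1r.
by apply: EP_ext (EP_eh (- 1) (- 1)) => l; rewrite mulN1r opprD.
Qed.

(** The integers l with [sigz l p] = 0: these are 0, ..., p-1 and their mirror images under l |->
    -l-2. *)
Definition nodes (p : nat) : seq int :=
  flatten [seq [:: i%:Z; - (i%:Z + 2)] | i <- iota 0 p].

Lemma nodesP p k : reflect (exists2 i : nat, (i < p)%N & k = i%:Z \/ k = - (i%:Z + 2)) (k \in nodes p).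
Proof.
apply: (iffP flattenP) => [[s /mapP[i]]|[i ip kE]].
  by rewrite mem_iota add0n => ip -> ; rewrite !inE => /orP[] /eqP ->; exists i; auto.
exists [:: i%:Z; - (i%:Z + 2)]; first by apply/mapP; exists i; rewrite // mem_iota.
by rewrite !inE; case: kE => ->; rewrite eqxx ?orbT.
Qed.

Lemma nodesS p : nodes p.+1 = nodes p ++ [:: p%:Z; - (p%:Z + 2)].
Proof.
have -> : nodes p.+1 = flatten [seq [:: i%:Z; - (i%:Z + 2)] | i <- iota 0 p ++ [:: p]].
  by rewrite /nodes -(iotaD 0 p 1) addn1.
by rewrite map_cat flatten_cat.
Qed.

Lemma nodes_uniq p : uniq (nodes p).
Proof.
elim: p => // p IH; rewrite nodesS cat_uniq IH /= !inE orbF andbT.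
apply/andP; split; last by lia.
rewrite negb_or; apply/andP; split; apply/negP => /nodesP[i ip []]; lia.
Qed.

(** So the Newton basis for these nodes consists of the eigenvalues of the sigma_p, up to units. *)
Lemma prod_nodes (l : int) p :
  \prod_(k <- nodes p) (ez l - ez k) = ez (l - 1) ^+ p * sigz l p.
Proof.
elim: p => [|p IH]; first by rewrite /nodes /sigz !big_nil mulr1.
rewrite nodesS big_cat IH /= !big_cons big_nil mulr1 [sigz l p.+1]big_nat_recr // -/(sigz l p).
rewrite exprSr -!mulrA; congr (_ * _); rewrite [RHS]mulrCA; congr (_ * _).
have -> : eh (- p.+1%:R) = ez (- p.+1%:Z) by rewrite mulrNz.
rewrite !mulrBr mulrDr !mulrBl -[p.+1%:R]/(p.+1%:~R) -!ehD -!intrD.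
have -> : l - 1 + (l + 1) = l + l by lia.
have -> : l - 1 + - (l + 1) = p%:Z + - (p%:Z + 2) by lia.
have -> : l - 1 + p.+1%:Z = p%:Z + l by lia.
have -> : l - 1 + - p.+1%:Z = l + - (p%:Z + 2) by lia.
by ring.
Qed.

(** * From congruences to integral coefficients *)

Section Arithmetic.
(** In the application, [c n] is the scalar by which J_T acts on V_n, and [S a N l] is v^(-rl) times
    the sum of weights for the entry at e_a, with n replaced by an integer l and all exponents at
    most N. *)
Variables (c : nat -> Qh) (r : int) (S : nat -> nat -> int -> Qh).
Hypotheses (S_EP : forall a N, EP (S a N))
  (S_c : forall N a n, (a <= n)%N ->
    dvdL (qfac N) (eh (- ((r * n%:Z)%:~R / 2)) * c n - S a N n%:Z))
  (S_shift : forall N m, (0 < m)%N -> S 0 N (- m%:Z - 1) = ez (r * m%:Z) * S m N (m%:Z - 1))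
  (S_0 : forall N l, exists2 u, u \in Lq & S 0 N l = 1 + (ez l - 1) * u).

(** For l >= m both sums are congruent to v^(-rl) c(l); [EP_back] carries the congruence down to l =
    m - 1, where e_m is no longer in V_l. *)
Lemma S_back N m : (0 < m)%N -> dvdL (qfac N) (S m N (m%:Z - 1) - S 0 N (m%:Z - 1)).
Proof.
move=> m0; pose f l := S m N l - S 0 N l.
apply: (@EP_back f); first exact: EP_sub.
move=> l ml; have [n nE] : exists n, l = n%:Z by exists (absz l); lia.
rewrite /f nE; have mn : (m <= n)%N by lia.
have := dvdLB (S_c N (leq0n n)) (S_c N mn).
by rewrite opprB addrC addrA subrK.
Qed.

(** Take m = 1 and N = 2. Since (q)_2 vanishes to second order in h and [S 0 2 0] = 1, the shift
    identity reads 1 + (q^-2 - 1) u = q^r up to order h^2. The coefficient of h gives r = -2 u(0),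
    and u(0) is an integer as u is in Z[q,q^-1]. *)
Lemma r_even : exists r', r = 2 * r'.
Proof.
have [w _ wE] := S_back 2 (ltn0Sn 0).
have [u0 _ E0] := S_0 2 0; have [u uL E2] := S_0 2 (- 1 - 1).
have := S_shift 2 (ltn0Sn 0); rewrite E2.
move: wE; rewrite subrr E0 eh0 subrr mul0r addr0 mulr1 => /eqP; rewrite subr_eq => /eqP -> E.
have := congr1 (fun x : Qh => x 1%N) E.
have e0 (k : int) : (ez k - 1) 0%N = 0 by rewrite fpsED fpsEN eh_coef0 subrr.
have e1 (k : int) : ez k 1%N = k%:~R by rewrite /= divr1.
have q0 : (qfac 2) 0%N = 0 by rewrite /qfac Pq_rec fps_coef0M e0 mul0r.
have q1 : (qfac 2) 1%N = 0.
  rewrite /qfac Pq_rec fps_coef1M ?e0 // /Pq big_ord1 addr0 e0 mulr0 //.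
rewrite mulrDr mulr1 !fpsED [_ * (qfac 2 * w)]mulrC -mulrA.
rewrite (fps_coef1M _ (e0 _)) (fps_coef1M _ q0) q1 mul0r add0r fpsED fpsEN !e1.
rewrite /= subr0 add0r; have [z ->] := Lq_fps0 uL.
rewrite -intrM => /eqP; rewrite eqr_int => /eqP <-.
by exists (- z); ring.
Qed.

Lemma coef_step p (a : nat -> Qh) : (forall i, a i \in Lq) ->
  (forall n, (n < p)%N -> c n = \sum_(i < n.+1) a i * sig n i) ->
  exists2 b, b \in Lq & c p = \sum_(i < p) a i * sig p i + b * sig p p.
Proof.
move=> aL ca; have [r' rE] := r_even.
(* This is the nodal polynomial at q^p. With it as the modulus, both terms of Newton's formula at
   q^p are multiples of s, that is of [sig p p] up to a unit. *)
pose s := \prod_(k <- nodes p) (ez p%:Z - ez k).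
have [N sN] : dvd_qfac (s * vdm (nodes p)).
  apply: dvd_qfac_vdm; first exact: nodes_uniq.
  rewrite -[s]mul1r; apply: (@dvd_qfac_prod _ _ (fun=> p%:Z) id); last exact: dvd_qfac1.
  by move=> k /nodesP[i ip kE]; apply/eqP; lia.
have sQ := sN N (leqnn N).
(* g extends c to all integers modulo (q)_N, and f is what remains after subtracting the terms
   already known. *)
pose g l := ez (r' * l) * S 0 N l; pose f l := g l - \sum_(i < p) a i * sigz l i.
have g_c n : dvdL (qfac N) (c n - g n%:Z).
  have := dvdL_mull (Lq_eh (r' * n%:Z)) (S_c N (leq0n n)); rewrite mulrBr mulrA -ehD -/(g n%:Z).
  have -> : (r' * n%:Z)%:~R + - ((r * n%:Z)%:~R / 2) = 0 :> rat.
    by rewrite rE !intrM; field.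
  by rewrite eh0 mul1r.
have g_sym (i : nat) : dvdL (qfac N) (g (- (i%:Z + 2)) - g i%:Z).
  have := dvdL_mull (Lq_eh (r' * i%:Z)) (S_back N (ltn0Sn i)).
  have -> : i.+1%:Z - 1 = i%:Z by lia.
  rewrite mulrBr -/(g i%:Z); congr (dvdL _ (_ - _)).
  rewrite /g; have -> : - (i%:Z + 2) = - i.+1%:Z - 1 by lia.
  rewrite S_shift // mulrA -ehD -intrD; have -> : i.+1%:Z - 1 = i%:Z by lia.
  by congr (eh _%:~R * _); rewrite rE; lia.
have f_EP : EP f.
  apply: EP_sub; last by apply: EP_sum => i; apply: EP_mul; [exact: EP_const|exact: sigz_EP].
  by apply: EP_mul => //; apply: EP_ext (EP_eh r' 0) => l; rewrite addr0.
have f0 (i : nat) : (i < p)%N -> dvdL (qfac N) (f i%:Z).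
  move=> ip; have := dvdLN (g_c i); rewrite opprB ca // -(sum_sig _ ip) /f.
  by under eq_bigr do rewrite -sigzE.
have f_nodes k : k \in nodes p -> dvdL (qfac N) (f k).
  move=> /nodesP[i ip [] -> ]; first exact: f0.
  have := dvdLD (g_sym i) (f0 _ ip); rewrite /f addrA subrK.
  by under [in X in dvdL _ (_ - X) -> _]eq_bigr do rewrite -sigz_sym.
have fL := f_EP; case: fL => [d [P [PL fE]]].
have sL : s \in Lq by apply: Lq_prod => k; rewrite rpredB ?Lq_eh.
have P_nodes k : k \in nodes p -> dvdL (qfac N) P.[ez k].
  move=> /f_nodes; rewrite fE => /(dvdL_mull (Lq_eh (- (d * k)))).
  by rewrite mulrA -ehD -intrD addNr eh0 mul1r.
have [A [B [AL BL PE]]] := newton_mod (nodes_uniq p) PL (Lq_eh p%:Z) sL sQ P_nodes.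
have [u uL uE] := dvdL_trans (dvdL_trans (dvdL_mulr (vdm_Lq (nodes p)) (dvdL_refl s)) sQ) (g_c p).
have sE : s = ez (p%:Z - 1) ^+ p * sig p p by rewrite /s prod_nodes sigzE.
exists (ez (p%:Z - 1) ^+ p * (u + ez (d * p%:Z) * (A + B))).
  by rewrite !(rpredM, rpredD, rpredX) ?Lq_eh.
have -> : c p = (c p - g p%:Z) + f p%:Z + \sum_(i < p) a i * sigz p%:Z i by rewrite /f; ring.
rewrite uE fE PE -/s sE; under eq_bigr do rewrite sigzE.
by ring.
Qed.

Lemma prefix_uniq p (a b : nat -> Qh) :
  (forall n, (n < p)%N -> \sum_(i < n.+1) a i * sig n i = \sum_(i < n.+1) b i * sig n i) ->
  forall n, (n < p)%N -> a n = b n.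
Proof.
move=> ab; elim/ltn_ind => n IH np; apply: (mulIf (sig_neq0 (leqnn n))).
have := ab n np; rewrite !big_ord_recr /=.
rewrite (eq_bigr (fun p : 'I_n => b p * sig n p)) => [/addrI //|i _].
by rewrite IH // (ltn_trans _ np).
Qed.

Theorem cyclotomic_coefs : exists a : nat -> Qh, (forall p, a p \in Lq) /\
  forall n, c n = \sum_(p < n.+1) a p * sig n p.
Proof.
have pre p : exists a : nat -> Qh, (forall i, a i \in Lq) /\
    forall n, (n < p)%N -> c n = \sum_(i < n.+1) a i * sig n i.
  elim: p => [|p [a [aL ca]]]; first by exists (fun=> 0); split=> // i; exact: rpred0.
  have [b bL cb] := coef_step aL ca.
  exists (fun i => if i == p then b else a i); split=> [i|n]; first by case: ifP.
  rewrite ltnS leq_eqVlt => /orP[/eqP ->|np].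
    rewrite big_ord_recr /= eqxx cb; congr (_ + _); apply: eq_bigr => i _.
    by rewrite ltn_eqF.
  rewrite ca //; apply: eq_bigr => i _.
  by rewrite ltn_eqF // (leq_ltn_trans _ np) // -ltnS.
have [A AP] : exists A : nat -> nat -> Qh, forall p, (forall i, A p i \in Lq) /\
    forall n, (n < p)%N -> c n = \sum_(i < n.+1) A p i * sig n i.
  by exists (fun p => projT1 (cid (pre p))) => p; case: cid.
(* Prefixes of different lengths agree where both are defined, by uniqueness, so the diagonal choice
   is consistent. *)
exists (fun p => A p.+1 p); split=> [p|n]; first by case: (AP p.+1).
have [_ An] := AP n.+1; rewrite (An n) //; apply: eq_bigr => i _; congr (_ * _).
apply: (@prefix_uniq i.+1) => // j ji.
have [_ Ai] := AP i.+1; rewrite -Ai // -An // (leq_trans ji) //.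
Qed.
End Arithmetic.

(** * Weights of labelled paths *)

(** The Gaussian binomial coefficient of g over N, for any integer g. *)
Definition Gq (g : int) (N : nat) : Qh := s2val (cid2 (Pq_dvd N (g - N%:Z + 1))).

Lemma Gq_Lq g N : Gq g N \in Lq. Proof. exact: s2valP (cid2 (Pq_dvd N (g - N%:Z + 1))). Qed.
Lemma GqE g N : Pq (g - N%:Z + 1) N = qfac N * Gq g N.
Proof. exact: s2valP' (cid2 (Pq_dvd N (g - N%:Z + 1))). Qed.

Lemma prod_br (c : rat) N : \prod_(i < N) br (c + i%:R) =
  eh (- (N%:R * c / 2 + N%:R * (N%:R - 1) / 4)) * \prod_(i < N) (eh (c + i%:R) - 1).
Proof.
elim: N => [|N IH]; first by rewrite !big_ord0 !mul0r addr0 oppr0 eh0 mulr1.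
rewrite !big_ord_recr /= IH.
have -> : br (c + N%:R) = eh (- ((c + N%:R) / 2)) * (eh (c + N%:R) - 1).
  by rewrite /br mulrBr mulr1 -ehD; congr (eh _ - eh _); field.
by rewrite mulrACA -ehD; congr (eh _ * _); rewrite -natr1; field.
Qed.

Definition cB (b : bool) (N : nat) : Qh :=
  if b then eh (N%:R * (N%:R - 1) / 4) else (-1) ^+ N * eh (- (N%:R * (N%:R - 1) / 4)).

(** The coefficient theta_N of R or of its inverse times the factor of the bead E^N at label g, with
    n replaced by l ([BB_th]). The N factors {1} of theta_N have turned the second quantum integer
    of each [Ec] into {.}; 1/[N]! and the first ones make up a q-binomial. *)
Definition BB (b : bool) (N : nat) (l g : int) : Qh :=
  cB b N * (\prod_(i < N) (qn (g%:~R - i%:R) * br (l%:~R + 1 - g%:~R + i%:R))) / qf N.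

Lemma br_qf N : br 1 ^+ N * qf N = eh (- (N%:R * (N%:R + 1) / 4)) * qfac N.
Proof.
have -> : br 1 ^+ N * qf N = \prod_(i < N) br (1 + i%:R).
  elim: N => [|N IH]; first by rewrite expr0 qf0 mul1r big_ord0.
  by rewrite big_ord_recr /= -IH exprS qfS -(qnE (1 + N%:R)) nat1r; ring.
by rewrite prod_br; congr (eh _ * _); field.
Qed.

Lemma qn_prod (g : int) N : (\prod_(i < N) qn (g%:~R - i%:R)) / qf N =
  eh (- (N%:R * g%:~R / 2) + N%:R * N%:R / 2) * Gq g N.
Proof.
have uq := qf_unit N; apply: (mulIr uq); rewrite divrK //.
apply: (mulfI (expf_neq0 N (br_neq0 (oner_neq0 _)))).
have -> : br 1 ^+ N * \prod_(i < N) qn (g%:~R - i%:R) = \prod_(i < N) br ((g - N%:Z + 1)%:~R + i%:R).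
  rewrite -{1}[N]card_ord -prodr_const -big_split (reindex_inj rev_ord_inj) /=.
  apply: eq_bigr => i _; rewrite qnE natrB // -natr1; congr br.
  by rewrite intrD intrB; ring.
rewrite prod_br -/(Pq _ _) GqE.
have -> : br 1 ^+ N * (eh (- (N%:R * g%:~R / 2) + N%:R * N%:R / 2) * Gq g N * qf N) =
  eh (- (N%:R * g%:~R / 2) + N%:R * N%:R / 2) * Gq g N * (br 1 ^+ N * qf N) by ring.
rewrite br_qf.
have -> : eh (- (N%:R * (g - N%:Z + 1)%:~R / 2 + N%:R * (N%:R - 1) / 4)) =
  eh (- (N%:R * g%:~R / 2) + N%:R * N%:R / 2) * eh (- (N%:R * (N%:R + 1) / 4)).
  by rewrite -ehD; congr eh; rewrite intrD intrB; field.
by ring.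
Qed.

Lemma binr2 N : 'C(N, 2)%:R = N%:R * (N%:R - 1) / 2 :> rat.
Proof.
elim: N => [|N IH]; first by rewrite !mul0r.
by rewrite binS natrD IH bin1 -natr1; field.
Qed.

Lemma BB_nf b N l g : BB b N l g = (-1) ^+ (if b then 0%N else N) *
  eh (- (N%:R * l%:~R / 2) + (if b then 'C(N, 2)%:R else 0)) * (Gq g N * Pq (l + 1 - g) N).
Proof.
rewrite /BB big_split /= [cB b N * _]mulrA mulrAC -[cB b N * _ / _]mulrA qn_prod.
rewrite prod_br (_ : \prod_(i < N) _ = Pq (l + 1 - g) N); last first.
  by apply: eq_bigr => i _; rewrite intrB intrD.
have -> : cB b N = (-1) ^+ (if b then 0%N else N) * eh ((if b then 1 else -1) * (N%:R * (N%:R - 1) / 4)).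
  by rewrite /cB; case: b; rewrite ?expr0 ?mul1r ?mulN1r.
have -> : - (N%:R * l%:~R / 2) + (if b then 'C(N, 2)%:R else 0) =
   (if b then 1 else -1) * (N%:R * (N%:R - 1) / 4) + (- (N%:R * g%:~R / 2) + N%:R * N%:R / 2) +
   - (N%:R * (l%:~R + 1 - g%:~R) / 2 + N%:R * (N%:R - 1) / 4) :> rat.
  by rewrite binr2; case: b; field.
by rewrite !ehD; ring.
Qed.

(** Up to sign, each factor is [x] {y} on one side and [y] {x} on the other, with x = g - i and y =
    g + M - i. *)
Lemma BB_shift b N (M : nat) (g : int) : BB b N (- M%:Z - 1) g = BB b N (M%:Z - 1) (g + M%:Z).
Proof.
rewrite /BB; congr (_ * _ / _); apply: eq_bigr => i _; rewrite !(intrB, intrD) rmorphN /=.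
have -> : - M%:~R - 1%:~R + 1 - g%:~R + i%:R = - (g%:~R + M%:~R - i%:R) :> rat by rewrite mulr1z; ring.
have -> : M%:~R - 1%:~R + 1 - (g%:~R + M%:~R) + i%:R = - (g%:~R - i%:R) :> rat by rewrite mulr1z; ring.
by rewrite !brN -(qnE (g%:~R + M%:~R - i%:R)) -(qnE (g%:~R - i%:R)); ring.
Qed.

Lemma BB_th (b : bool) N n (g : int) : BB b N n%:Z g =
  (if b then th N else th' N) * \prod_(l < N) Ec n (g%:~R - l%:R).
Proof.
have -> : (if b then th N else th' N) = cB b N * br 1 ^+ N / qf N by rewrite /th /th' /cB; case: b.
rewrite /BB [RHS]mulrAC; congr (_ / _); rewrite -mulrA; congr (_ * _).
have -> : br 1 ^+ N = \prod_(i < N) br 1 by rewrite prodr_const card_ord.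
rewrite -big_split; apply: eq_bigr => i _ /=.
rewrite /Ec -(qnE (_ + i%:R)) (_ : n%:R + 1 - (g%:~R - i%:R) = n%:Z%:~R + 1 - g%:~R + i%:R); first by ring.
by rewrite -[n%:Z%:~R]/(n%:R : rat); ring.
Qed.

Section Weights.
Variable T : diagram.
Hypotheses (hB : bottom_diagram T) (hC : one_component T).
Local Notation steps := (walk_path T).
Local Notation evt := (event_at T).
Local Notation cs := (crossings T).
Local Notation pos := (positive T).
Local Notation thepass := (crossing_pass T).
Local Notation lab := (label T).
Local Notation isCr := (is_pass T).

(** From here to [W]: the weights [Wn] with n replaced by an integer l, the coefficients theta being
    moved from the crossings to the strings that carry E. *)
Definition wtz (l : int) m a k s : rat := sgd (dw T k s) * (l%:~R - 2 * (glab T m a k s)%:~R).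
Definition Dz l m a k : Qh := eh (sgd (pos k) * wtz l m a k (pos k) * wtz l m a k (~~ pos k) / 4).
Definition wz l (m : nat -> nat) (x : position) (g : int) : Qh :=
  match evt x with
  | Some (AtCrossing k s d) =>
      if s == pos k then
        if d then 1 else (-1) ^+ m k * eh ((m k)%:R * (l%:~R - 2 * g%:~R) / 2 - (m k)%:R * ((m k)%:R - 1) / 2)
      else BB (pos k) (m k) l g *
        if d then 1 else (-1) ^+ m k * eh (- ((m k)%:R * (l%:~R - 2 * g%:~R) / 2) - (m k)%:R * ((m k)%:R + 1) / 2)
  | Some (AtMin true) => eh (- ((l%:~R - 2 * g%:~R) / 2))
  | Some (AtMax true) => eh ((l%:~R - 2 * g%:~R) / 2)
  | _ => 1
  end.
Definition W l a m : Qh := (\prod_(k <- cs) Dz l m a k) * \prod_(x <- steps) wz l m x (lab m a x).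

Lemma W_Wn n a m : W n%:Z a m = Wn T n m a.
Proof.
rewrite /W /Wn big_split /= [\prod_(k <- cs) thc _ _ _ * _]mulrC -mulrA; congr (_ * _).
pose tf x := if evt x is Some (AtCrossing k s _) then (if s == pos k then 1 else thc T k (m k)) else 1.
rewrite (eq_bigr (fun x => tf x * zf T n m x (lab m a x))) => [|x _]; last first.
  rewrite /wz /zf /tf; case: (evt x) => [[k s d|b|b]|]; rewrite ?mul1r //.
  by case: ifP => _; rewrite ?mul1r // BB_th -mulrA.
rewrite big_split; congr (_ * _); rewrite (bigID isCr) /= [Y in _ * Y]big1 ?mulr1; last first.
  by move=> x; rewrite /is_pass /tf; case: (evt x) => [[]|].
rewrite big_crossings // big_seq [RHS]big_seq; apply: eq_bigr => k; rewrite csP => ck.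
by rewrite /tf !evt_thepass //; case: (pos k); rewrite /= ?mulr1 ?mul1r.
Qed.

Lemma lab_shift m M x : lab m M x = lab m 0 x + M.
Proof. by rewrite /label add0r addrC. Qed.

(** The weights depend on l and on the labels g only through l - 2g and [BB], both of which are
    invariant under the shift. *)
Lemma W_shift (M : nat) m : W (- M%:Z - 1) 0 m = W (M%:Z - 1) M m.
Proof.
have wE g : (- M%:Z - 1)%:~R - 2 * g%:~R = (M%:Z - 1)%:~R - 2 * (g + M%:Z)%:~R :> rat.
  by rewrite !(intrB, intrD) rmorphN /=; ring.
have wtE k s : wtz (- M%:Z - 1) m 0 k s = wtz (M%:Z - 1) m M k s.
  by rewrite /wtz wE; congr (_ * (_ - _ * _%:~R)); rewrite /glab [in RHS]lab_shift addrAC.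
rewrite /W; congr (_ * _); [apply: eq_bigr => k _|apply: eq_bigr => x _]; first by rewrite /Dz !wtE.
rewrite (lab_shift m M) /wz; case: (evt x) => [[k s d|b|b]|] //; rewrite ?wE //.
by rewrite BB_shift.
Qed.

(** The pieces of the normal form [wz_nf] of a step: [rr] and [Acr] give the power of v^l, due to
    the extrema and to the crossings respectively, [Cx] a power of q, [sx] a sign, and [Yz] the
    factors which are not monomials. *)
Definition rr (x : position) : int :=
  match evt x with Some (AtMax true) => 1 | Some (AtMin true) => - 1 | _ => 0 end.
Definition Acr (m : nat -> nat) (x : position) : int :=
  if evt x is Some (AtCrossing k s d) then
    if s == pos k then (if d then 0 else (m k)%:Z) else - (m k)%:Z - (if d then 0 else (m k)%:Z)
  else 0.
Definition Cx (m : nat -> nat) (x : position) (g : int) : int :=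
  match evt x with
  | Some (AtCrossing k s d) =>
      if s == pos k then (if d then 0 else - ((m k)%:Z * g) - 'C(m k, 2)%:Z)
      else (if pos k then 'C(m k, 2)%:Z else 0) + (if d then 0 else (m k)%:Z * g - 'C((m k).+1, 2)%:Z)
  | Some (AtMax true) => - g
  | Some (AtMin true) => g
  | _ => 0
  end.
Definition sx (m : nat -> nat) (x : position) : nat :=
  if evt x is Some (AtCrossing k s d) then
    if s == pos k then (if d then 0%N else m k)
    else ((if pos k then 0 else m k) + (if d then 0 else m k))%N
  else 0%N.
Definition Yz l (m : nat -> nat) (x : position) (g : int) : Qh :=
  if evt x is Some (AtCrossing k s d) then
    if s == pos k then 1 else Gq g (m k) * Pq (l + 1 - g) (m k)
  else 1.

Lemma wz_nf l m x g : wz l m x g =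
  (-1) ^+ sx m x * eh (l%:~R / 2 * (rr x + Acr m x)%:~R + (Cx m x g)%:~R) * Yz l m x g.
Proof.
have e0 : eh (l%:~R / 2 * (0 + 0)%:~R + 0%:~R) = 1 by rewrite -eh0; congr eh; ring.
rewrite /wz /sx /rr /Acr /Cx /Yz; case: (evt x) => [[k s d|[]|[]]|]; rewrite ?mulr1 ?expr0 ?mul1r ?e0 //.
- case: ifP => _.
    rewrite mulr1; case: d; rewrite ?expr0 ?mul1r ?e0 //; congr (_ * eh _).
    by rewrite add0r intrB rmorphN /= intrM -[('C(_, 2)%:Z)%:~R]/('C(_, 2)%:R : rat) binr2; field.
  rewrite BB_nf; set N := m k; case: d.
    rewrite addn0 subr0 addr0 add0r mulr1; congr (_ * eh _ * _).
    by case: (pos k); rewrite rmorphN /=; ring.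
  set e3 := (X in _ = _ * eh X * _).
  have -> : eh e3 = eh (- (N%:R * l%:~R / 2) + (if pos k then 'C(N, 2)%:R else 0)) *
      eh (- (N%:R * (l%:~R - 2 * g%:~R) / 2) - N%:R * (N%:R + 1) / 2).
    rewrite -ehD; congr eh; rewrite /e3 add0r !(intrD, intrB, intrM) !rmorphN /=.
    have -> : ('C(N.+1, 2)%:Z)%:~R = N%:R * (N%:R + 1) / 2 :> rat.
      by rewrite -[_%:~R]/('C(N.+1, 2)%:R : rat) binr2 -natr1; field.
    by case: (pos k); rewrite -[N%:Z%:~R]/(N%:R : rat) -?[('C(_, 2)%:Z)%:~R]/('C(_, 2)%:R : rat); field.
  by rewrite exprD; ring.
- by congr eh; field.
by congr eh; field.
Qed.

Definition sE k : int := crossing_sign T k.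

Lemma sE_sgd k : is_crossing T k -> (sE k)%:~R = sgd (pos k) * sgd (dw T k true) * sgd (dw T k false).
Proof.
move=> ck; rewrite /sE /crossing_sign !downwardE //; move: ck; rewrite /is_crossing /positive /sgd.
by case: (slice T k).2 => // _; case: (dw T k true); case: (dw T k false); rewrite ?(mulr1, mul1r, mulrN1, mulN1r, opprK).
Qed.

Definition gs m a k : int := glab T m a k true + glab T m a k false.
Definition gp m a k : int := glab T m a k true * glab T m a k false.

(** Expanding the product of the two weights, l^2/4 gets the sign of the crossing as coefficient;
    these signs add up to the framing. *)
Lemma Dz_nf l m a k : is_crossing T k -> Dz l m a k =
  eh (l%:~R ^+ 2 / 4 * (sE k)%:~R - l%:~R / 2 * (sE k * gs m a k)%:~R + (sE k * gp m a k)%:~R).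
Proof.
move=> ck; rewrite /Dz /wtz /gs /gp; congr eh; rewrite !(intrM, intrD) sE_sgd //.
by case: (pos k) => /=; field.
Qed.

Definition rT : int := \sum_(x <- steps) rr x.
Definition A2 m a : int := \sum_(x <- steps) Acr m x - \sum_(k <- cs) sE k * gs m a k.
Definition C2 m a : int := \sum_(x <- steps) Cx m x (lab m a x) + \sum_(k <- cs) sE k * gp m a k.
Definition s2 m : nat := \sum_(x <- steps) sx m x.
Definition Y2 l m a : Qh := \prod_(x <- steps) Yz l m x (lab m a x).

Lemma framing_cs : \sum_(k <- cs) sE k = framing T.
Proof.
rewrite /framing /crossings big_filter -[X in iota 0 X]subn0 -/(index_iota 0 _) big_mkord.
rewrite [RHS](bigID (fun k : 'I_(size T) => is_crossing T k)) /= [Y in _ = _ + Y]big1 ?addr0 // => k.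
by rewrite /is_crossing /crossing_sign; case: (slice T k).2.
Qed.

Lemma eh_prod (I : Type) (r : seq I) (F : I -> rat) : \prod_(i <- r) eh (F i) = eh (\sum_(i <- r) F i).
Proof. by elim: r => [|i r IH]; rewrite ?big_nil ?eh0 // !big_cons ehD IH. Qed.

Lemma W_nf l m a : framing T = 0 -> W l a m =
  (-1) ^+ s2 m * eh (l%:~R / 2 * (rT + A2 m a)%:~R + (C2 m a)%:~R) * Y2 l m a.
Proof.
move=> fr; rewrite /W.
rewrite (eq_big_seq (fun k => eh (l%:~R ^+ 2 / 4 * (sE k)%:~R - l%:~R / 2 * (sE k * gs m a k)%:~R + (sE k * gp m a k)%:~R)));
  last by move=> k; rewrite csP => ck; apply: Dz_nf.
rewrite (eq_bigr _ (fun x _ => wz_nf l m x (lab m a x))) !big_split /= !eh_prod.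
have -> : \prod_(x <- steps) (-1) ^+ sx m x = (-1) ^+ s2 m :> Qh.
  by rewrite /s2; elim: steps => [|x s IH]; rewrite ?big_nil ?expr0 // !big_cons exprD IH.
rewrite mulrA [eh _ * (_ * eh _)]mulrCA -ehD; congr (_ * eh _ * _); rewrite !big_split /= sumrN -!mulr_sumr.
have intrS (I : Type) (r : seq I) (F : I -> int) : \sum_(i <- r) (F i)%:~R = (\sum_(i <- r) F i)%:~R :> rat.
  by rewrite (big_morph (fun z : int => z%:~R : rat) (@intrD _) (mulr0z _)).
rewrite !intrS framing_cs fr mulr0 sub0r big_split /= -/rT /A2 /C2 !(intrD, intrB).
by ring.
Qed.
End Weights.

(** * Parity of the exponents and truncation of the sums *)

Definition par (z : int) : bool := odd (absz z).

Lemma parD x y : par (x + y) = par x (+) par y. Proof. by rewrite /par; lia. Qed.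
Lemma parN x : par (- x) = par x. Proof. by rewrite /par; lia. Qed.
Lemma par0 : par 0 = false. Proof. by []. Qed.
Lemma par_nat (k : nat) : par k%:Z = odd k. Proof. by []. Qed.

Lemma par_sum (I : eqType) (r : seq I) (F : I -> int) : par (\sum_(i <- r) F i) = \big[addb/false]_(i <- r) par (F i).
Proof. exact: (big_morph par parD). Qed.

Lemma telescope_addb (S : eqType) (f : S -> S) (phi c : S -> bool) M y :
  (forall x, x \in traject f y M -> phi (f x) = phi x (+) c x) ->
  \big[addb/false]_(x <- traject f y M) c x = phi y (+) phi (iter M f y).
Proof.
elim: M y => [|M IH] y H; first by rewrite big_nil addbb.
rewrite trajectS big_cons iterSr IH => [|x xs]; last by apply: H; rewrite trajectS inE xs orbT.
by rewrite H ?trajectS ?inE ?eqxx //; case: (phi y); case: (c y); case: (phi _).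
Qed.

Section NsumDvd.
Variable q0 : Qh.
Implicit Types (Phi : (nat -> nat) -> Qh) (m : nat -> nat).

Lemma nsum_dvd N s Phi m : (forall m', (forall k, k \notin s -> m' k = m k) -> dvdL q0 (Phi m')) ->
  dvdL q0 (nsum N s Phi m).
Proof.
elim: s m => [|k s IH] m H /=; first exact: H.
apply: dvdL_sum => i _; apply: IH => m' Em; apply: H => j; rewrite inE negb_or => /andP[jk js].
by rewrite Em // /upd (negPf jk).
Qed.

Lemma nsum_zero N s Phi m : uniq s -> (forall k, k \in s -> m k = 0%N) ->
  (forall m', (exists2 k, k \in s & m' k != 0%N) -> dvdL q0 (Phi m')) ->
  dvdL q0 (nsum N.+1 s Phi m - Phi m).
Proof.
elim: s m => [|k s IH] m /=; first by move=> *; rewrite subrr; apply: dvdL0.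
move=> /andP[ks us] m0 H; rewrite big_ord_recl /= addrAC; apply: dvdLD.
  have {2}-> : m = upd m k 0 by apply/funext => j; rewrite /upd; case: eqP => // ->; rewrite m0 ?inE ?eqxx.
  apply: IH => // [j js|m' [j js mj]].
    by rewrite /upd; case: eqP => // _; rewrite m0 // inE js orbT.
  by apply: H; exists j; rewrite ?inE ?js ?orbT.
apply: dvdL_sum => i _; apply: nsum_dvd => m' Em; apply: H; exists k; rewrite ?inE ?eqxx //.
by rewrite Em // /upd eqxx.
Qed.

Lemma nsum_widen N M s Phi m : uniq s -> (N <= M)%N ->
  (forall m', (exists2 k, k \in s & (N <= m' k)%N) -> dvdL q0 (Phi m')) ->
  dvdL q0 (nsum M s Phi m - nsum N s Phi m).
Proof.
move=> + NM; elim: s m => [|k s IH] m /=; first by move=> *; rewrite subrr; apply: dvdL0.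
move=> /andP[ks us] H; rewrite -(big_mkord xpredT (fun i => nsum M s Phi (upd m k i))).
rewrite -(big_mkord xpredT (fun i => nsum N s Phi (upd m k i))) (@big_cat_nat _ _ _ N) //= addrAC -sumrB.
apply: dvdLD.
  apply: dvdL_sum => i _; apply: IH => // m' [j js mj].
  by apply: H; exists j; rewrite ?inE ?js ?orbT.
rewrite big_seq; apply: dvdL_sum => i; rewrite mem_index_iota => /andP[Ni _].
apply: nsum_dvd => m' Em; apply: H; exists k; rewrite ?inE ?eqxx //.
by rewrite Em // /upd eqxx.
Qed.
End NsumDvd.

Lemma nsum_EP N s (Phi : int -> (nat -> nat) -> Qh) m : (forall m, EP (Phi^~ m)) ->
  EP (fun l => nsum N s (Phi l) m).
Proof. by move=> H; elim: s m => //= k s IH m; apply: EP_sum => i; apply: IH. Qed.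

Lemma Pq_dvd_factor (k : int) N (i : nat) : (i < N)%N -> dvdL (eh (k + i%:Z)%:~R - 1) (Pq k N).
Proof.
move=> iN; rewrite /Pq (bigD1 (Ordinal iN)) //=; exists (\prod_(j < N | j != Ordinal iN) (eh (k%:~R + j%:R) - 1)).
  by elim/big_ind: _ => [|x y|j _]; [exact: rpred1|exact: rpredM|exact: Lq_eh1].
by rewrite intrD.
Qed.

Lemma Gq_eq0 g N : 0 <= g -> g < N%:Z -> Gq g N = 0.
Proof.
move=> g0 gN; have P0 : Pq (g - N%:Z + 1) N = 0.
  have lt : (absz (N%:Z - g - 1)%R < N)%N by lia.
  have [u _ ->] := Pq_dvd_factor (g - N%:Z + 1) lt.
  have -> : g - N%:Z + 1 + (absz (N%:Z - g - 1)%R)%:Z = 0 by lia.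
  by rewrite eh0 subrr mul0r.
have qN : qfac N != 0.
  apply/prodf_neq0 => i _; rewrite subr_eq0; apply/eqP => /(congr1 (fun x : Qh => x 1%N)).
  rewrite fpsE1 /= expr1 divr1 => /eqP; rewrite -[1%:~R]/(1%:R : rat) -natrD pnatr_eq0; lia.
by have := GqE g N; rewrite P0 => /esym/eqP; rewrite mulf_eq0 (negPf qN) => /eqP.
Qed.

Section Arith.
Variable T : diagram.
Hypotheses (hB : bottom_diagram T) (hC : one_component T) (hF : framing T = 0).
Local Notation steps := (walk_path T).
Local Notation evt := (event_at T).
Local Notation nxt := (next_position T).
Local Notation cs := (crossings T).
Local Notation pos := (positive T).
Local Notation thepass := (crossing_pass T).
Local Notation lab := (label T).
Local Notation isCr := (is_pass T).
Local Notation dl := (label_step T).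

(** The checkerboard colour of the region on the right of the oriented string, that is the parity of
    the number of strings to the left of that region. It changes at crossings only. *)
Definition side (x : position) : bool := odd x.1.2 (+) ~~ x.2.

Lemma side_nxt x : x \in steps -> side (nxt x) = side x (+) isCr x.
Proof.
case: x => [[l j] []] xs; rewrite /side /is_pass /event_at /next_position ?advU.
  have := steps_down hC xs; case: l {xs} => // l _; rewrite /= /go_down.
  by case: (slice T l) => i [] //=; do 3?[case: ifP => //=]; lia.
by rewrite /= /go_up; case: (slice T l) => i [] //=; do 3?[case: ifP => //=]; lia.
Qed.

Lemma side_pass k : is_crossing T k -> side (thepass k true) (+) side (thepass k false).
Proof.
by move=> ck; rewrite /side /crossing_pass /pass /jl /ju; case: (dw T k true); case: (dw T k false); rewrite /=; lia.
Qed.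

Definition cc m a (x : position) : bool :=
  if evt x is Some (AtCrossing k _ _) then par (lab m a x) (+) (odd (m k) && ~~ side x) else false.

(** [cc] is the increment of [side x && par (lab m a x)] along the walk, which is zero at both ends
    since the outer region has colour false. *)
Lemma sum_cc m a : \big[addb/false]_(x <- steps) cc m a x = false.
Proof.
rewrite (@telescope_addb _ _ (fun x => side x && par (lab m a x))) => [|x xs]; first by rewrite last_walk.
rewrite side_nxt // lab_nxt // /cc /is_pass /label_step; case: (evt x) => [[k s d|b|b]|];
  rewrite ?addr0 ?addbF //.
by case: (side x); case: ifP => _; rewrite /par; lia.
Qed.

(** Crossing by crossing, the contribution to [A2] has the parity of the sum of [cc] over the two
    passes, because the colours at these passes are opposite ([side_pass]). *)
Lemma A2_even m a : A2 T m a = 2 * (A2 T m a %/ 2)%Z.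
Proof.
suff : par (A2 T m a) = false by rewrite /par; lia.
have -> : A2 T m a = \sum_(k <- cs) (Acr T m (thepass k true) + Acr T m (thepass k false) - sE T k * gs T m a k).
  rewrite sumrB /A2; congr (_ - _); rewrite (bigID isCr) /= [Y in _ + Y]big1 ?addr0 ?big_crossings // => x.
  by rewrite /is_pass /Acr; case: (evt x) => [[]|].
rewrite par_sum; have := sum_cc m a; rewrite (bigID isCr) /= [Y in _ (+) Y]big1 ?addbF => [|x]; last first.
  by rewrite /is_pass /cc; case: (evt x) => [[]|].
rewrite big_crossings // => E; rewrite -[RHS]E big_seq [RHS]big_seq; apply: eq_bigr => k; rewrite csP => ck.
have := side_pass ck; rewrite /cc /Acr /gs /glab /label_step !evt_thepass //.
have : sE T k = 1 \/ sE T k = -1.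
  by rewrite /sE /crossing_sign; move: ck; rewrite /is_crossing; case: (slice T k).2 => // _;
   case: ifP => _; [left|right|right|left].
set x := lab m a _; set y := lab m a _; move: x y => x y.
have parE := (parD, parN, par0, par_nat, mul1r, mulN1r).
case: (side _); case: (side _) => //; case=> ->; case: (pos k); case: (dw T k true); case: (dw T k false);
  rewrite /= ?parE; case: (par x); case: (par y); by case: (odd _).
Qed.

(** The factor v^(-rl) removes the only odd power of v^l: by [A2_even] the rest is a Laurent
    polynomial in q^l. *)
Definition term (a : int) (l : int) m : Qh := eh (- ((rT T * l)%:~R / 2)) * W T l a m.

Lemma termE a l m : term a l m =
  (-1) ^+ s2 T m * eh ((A2 T m a %/ 2)%Z * l + C2 T m a)%:~R * Y2 T l m a.
Proof.
rewrite /term W_nf // mulrA [eh _ * (_ * eh _)]mulrCA -ehD; congr (_ * eh _ * _).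
by rewrite {1}A2_even !(intrD, intrM); field.
Qed.

Lemma Y_Lq l m x g : Yz T l m x g \in Lq.
Proof.
rewrite /Yz; case: (evt x) => [[k s d|b|b]|]; rewrite ?rpred1 //; case: ifP; rewrite ?rpred1 //.
by rewrite rpredM ?Gq_Lq ?Pq_Lq.
Qed.

Lemma sign_Lq k : (-1) ^+ k \in Lq. Proof. by rewrite rpredX // rpredN rpred1. Qed.

Lemma term_EP a m : EP (fun l => term a l m).
Proof.
apply: (EP_ext (fun l => esym (termE a l m))); apply: EP_mul.
  by apply: EP_mul; [apply: EP_const; exact: sign_Lq|exact: EP_eh].
apply: EP_prod => x; rewrite /Yz; case: (evt x) => [[k s d|b|b]|]; try exact: EP_const (rpred1 _).
case: (s == pos k); first exact: EP_const (rpred1 _).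
apply: EP_mul; first exact/EP_const/Gq_Lq.
apply: EP_prod => i; apply: EP_sub; last exact: EP_const (rpred1 _).
have := EP_eh 1 (1 - lab m a x + i%:Z); apply: EP_ext => l.
by congr eh; rewrite !(intrD, intrB, intrM) mulr1z; ring.
Qed.

Definition Sf (a N : nat) (l : int) : Qh := nsum N.+1 cs (term a l) (fun=> 0%N).

Lemma Sf_EP a N : EP (Sf a N). Proof. exact/nsum_EP/term_EP. Qed.

Lemma Sf_shift N M : (0 < M)%N -> Sf 0 N (- M%:Z - 1) = eh (rT T * M%:Z)%:~R * Sf M N (M%:Z - 1).
Proof.
move=> _; rewrite /Sf (@nsum_raddf _ _ (fun x : Qh => eh (rT T * M%:Z)%:~R * x)) ?mulr0 //; last exact: mulrDr.
apply: nsum_ext => m _; rewrite /term W_shift // mulrA -ehD; congr (eh _ * _).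
by rewrite !(intrD, intrB, intrM) !rmorphN /= mulr1z; field.
Qed.

(** The label starts at 0 and returns to 0. From 0 it cannot go down, since a q-binomial vanishes
    there; if it moves at all, it later falls from some g > 0 to at most 0, and the factors of that
    step include q^l - 1. *)
Lemma Y_div l m : (exists2 k, k \in cs & m k != 0%N) -> dvdL (eh l%:~R - 1) (Y2 T l m 0).
Proof.
move=> [k0 k0c mk0].
(* After each initial part of the walk, the divisibility has been obtained, or the label is
   positive, or no exponent has been met yet other than zero. *)
have key s : prefix s steps -> let g := \sum_(x <- s) dl m x in
    [\/ dvdL (eh l%:~R - 1) (\prod_(x <- s) Yz T l m x (lab m 0 x)), 0 < g | g = 0 /\ {in s, forall x, dl m x = 0}].
  elim/last_ind: s => [|s x IH]; first by move=> _; constructor 3; rewrite big_nil.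
  move=> /prefixP[s' sE] g.
  have sE' : steps = s ++ x :: s' by rewrite sE cat_rcons.
  have ps : prefix s steps by apply/prefixP; exists (x :: s').
  have lx : lab m 0 x = \sum_(y <- s) dl m y by rewrite (lab_split hC m 0 sE') add0r.
  have gE : g = lab m 0 x + dl m x by rewrite /g -cats1 big_cat big_seq1 lx.
  have PE : \prod_(y <- rcons s x) Yz T l m y (lab m 0 y) =
      (\prod_(y <- s) Yz T l m y (lab m 0 y)) * Yz T l m x (lab m 0 x).
    by rewrite -cats1 big_cat big_seq1.
  have PL : \prod_(y <- s) Yz T l m y (lab m 0 y) \in Lq by apply: Lq_prod => y; apply: Y_Lq.
  rewrite PE gE; have [D|g0|[g0 dl0]] := IH ps.
  - by constructor 1; apply: dvdL_mulr => //; apply: Y_Lq.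
  - rewrite -lx in g0; case ex : (evt x) => [[k s0 d|b|b]|]; try by constructor 2; rewrite /label_step ex addr0.
    rewrite /label_step /Yz ex; case: ifP => _; first by constructor 2; lia.
    case: (ltrP 0 (lab m 0 x - (m k)%:Z)) => gm; first by constructor 2.
    constructor 1; apply: dvdL_mull => //; apply: dvdL_mull; first exact: Gq_Lq.
    have lt : (absz (lab m 0 x - 1)%R < m k)%N by lia.
    have := Pq_dvd_factor (l + 1 - lab m 0 x) lt.
    by have -> : l + 1 - lab m 0 x + (absz (lab m 0 x - 1)%R)%:Z = l by lia.
  rewrite -lx in g0.
  have stay : dl m x = 0 -> [\/ dvdL (eh l%:~R - 1) (\prod_(y <- s) Yz T l m y (lab m 0 y) * Yz T l m x (lab m 0 x)),
     0 < lab m 0 x + dl m x | lab m 0 x + dl m x = 0 /\ {in rcons s x, forall y, dl m y = 0}].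
    move=> dx; constructor 3; rewrite g0 dx; split=> // y; rewrite mem_rcons inE => /orP[/eqP ->|] //.
    exact: dl0.
  case: (eqVneq (dl m x) 0) => dx; first exact: stay.
  move: dx; rewrite {1}/label_step; case ex : (evt x) => [[k s0 d|b|b]|] //; case: ifP => s0k mk.
    by constructor 2; rewrite g0 /label_step ex s0k; lia.
  constructor 1; rewrite /Yz ex s0k g0 Gq_eq0 //; last by lia.
  by rewrite mul0r mulr0; apply: dvdL0.
have /= := key steps (prefix_refl _); rewrite sum_dl // => -[//|//|[_ H]].
rewrite csP in k0c; have := H _ (pass_steps hB hC true k0c).
by rewrite -/(thepass k0 true) /label_step evt_thepass //; case: ifP; lia.
Qed.

Lemma term_zero l : term 0 l (fun=> 0%N) = 1.
Proof.
have dl0 x : dl (fun=> 0%N) x = 0 by rewrite /label_step; case: (evt x) => [[k s d|b|b]|] //; case: ifP.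
have lab0 x : lab (fun=> 0%N) 0 x = 0 by rewrite /label add0r big1.
have gl0 k s : glab T (fun=> 0%N) 0 k s = 0 by rewrite /glab lab0 dl0; case: ifP.
have A0 : A2 T (fun=> 0%N) 0 = 0 - 0 + \sum_(x <- steps) Acr T (fun=> 0%N) x.
  rewrite /A2 [Y in _ - Y]big1 ?subr0 ?add0r // => k _; by rewrite /gs !gl0 mulr0.
have A00 : A2 T (fun=> 0%N) 0 = 0.
  rewrite A0 big1 // => x _; rewrite /Acr; case: (evt x) => [[k s d|b|b]|] //.
  by case: ifP; case: d.
have C0 : C2 T (fun=> 0%N) 0 = 0.
  rewrite /C2 !big1 // => [k _|x _]; first by rewrite /gp !gl0 mulr0.
  rewrite lab0 /Cx; case: (evt x) => [[k s d|[]|[]]|] //; rewrite ?oppr0 //.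
  by case: ifP => _; case: d; case: (pos k).
have S0 : s2 T (fun=> 0%N) = 0%N.
  rewrite /s2 big1 // => x _; rewrite /sx; case: (evt x) => [[k s d|b|b]|] //.
  by case: ifP => _; case: d; case: (pos k).
have G0 g : Gq g 0 = 1.
  by have := GqE g 0; rewrite /qfac /Pq !big_ord0 mul1r.
rewrite termE A00 C0 S0 expr0 mul1r div0z mul0r addr0 eh0 mul1r /Y2 big1 // => x _.
by rewrite /Yz; case: (evt x) => [[k s d|b|b]|] //; case: ifP => // _; rewrite G0 /Pq big_ord0 mulr1.
Qed.

Lemma Sf_0 N l : exists2 u, u \in Lq & Sf 0 N l = 1 + (eh l%:~R - 1) * u.
Proof.
have [|//|m' H|u uL uE] := @nsum_zero (eh l%:~R - 1) N cs (term 0 l) (fun=> 0%N); first exact: cs_uniq.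
  rewrite termE; apply: dvdL_mull; last exact: Y_div.
  by rewrite rpredM ?sign_Lq ?Lq_eh.
by exists u => //; rewrite -uE /Sf term_zero addrC subrK.
Qed.

(** The string that carries E contributes a product of [m k] consecutive factors, which is a
    multiple of (q)_N. *)
Lemma term_dvd N a l m : (exists2 k, k \in cs & (N <= m k)%N) -> dvdL (qfac N) (term a l m).
Proof.
move=> [k]; rewrite csP => ck Nm; rewrite termE; apply: dvdL_mull; first by rewrite rpredM ?sign_Lq ?Lq_eh.
rewrite /Y2 (big_rem (thepass k (~~ pos k))) /=; last exact: pass_steps.
apply: dvdL_mulr; first by apply: Lq_prod => x; apply: Y_Lq.
rewrite /Yz evt_thepass //; have -> : (~~ pos k == pos k) = false by case: (pos k).
apply: dvdL_mull; first exact: Gq_Lq.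
exact: dvdL_trans (qfac_dvd Nm) (Pq_dvd _ _).
Qed.

Lemma Sf_c N (a n : nat) : (a <= n)%N -> dvdL (qfac N)
  (eh (- ((rT T * n%:Z)%:~R / 2)) * nsum n.+1 cs (fun m => Wn T n m a) (fun=> 0%N) - Sf a N n%:Z).
Proof.
move=> an; rewrite (@nsum_raddf _ _ (fun x : Qh => eh (- ((rT T * n%:Z)%:~R / 2)) * x)) ?mulr0 //; last exact: mulrDr.
have -> : nsum n.+1 cs (fun m => eh (- ((rT T * n%:Z)%:~R / 2)) * Wn T n m a) (fun=> 0%N) =
    nsum n.+1 cs (term a n%:Z) (fun=> 0%N).
  by apply: nsum_ext => m _; rewrite /term W_Wn.
have E1 : nsum (maxn n N).+1 cs (term a n%:Z) (fun=> 0%N) = nsum n.+1 cs (term a n%:Z) (fun=> 0%N).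
  apply/eqP; rewrite -subr_eq0; apply/eqP.
  (* With modulus 0 the congruence is an equality: on V_n, exponents larger than n contribute
     exactly zero. *)
  have [|||u _ ->] := @nsum_widen 0 n.+1 (maxn n N).+1 cs (term a n%:Z) (fun=> 0%N).
  - exact: cs_uniq.
  - by rewrite ltnS leq_maxl.
  - move=> m [k]; rewrite csP => ck nm; rewrite /term W_Wn // (Wn_eq0 hB hC _ _ ck nm) ?mulr0 //.
    exact: dvdL0.
  by rewrite mul0r.
rewrite -E1; apply: nsum_widen; first exact: cs_uniq.
  by rewrite ltnS leq_maxr.
move=> m [k kc Nm]; apply: term_dvd; exists k => //; exact: ltnW.
Qed.
End Arith.

(** The eigenvalues of K are distinct, already in the coefficient of h, so Y is diagonal; E joins
    neighbouring basis vectors with nonzero entries, so the diagonal is constant. *)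
Lemma scalar_rep n (Y : 'M[Qh]_n.+1) : rK n * Y = Y * rK n -> rE n * Y = Y * rE n -> Y = (Y 0 0)%:A.
Proof.
move=> YK YE; have offdiag i j : i != j -> Y i j = 0.
  move=> ij; have := congr1 (fun Z : 'M[Qh]_n.+1 => Z i j) YK; rewrite /rK diag_mul mul_diag mulrC => /eqP.
  rewrite -subr_eq0 -mulrBr mulf_eq0 => /orP[/eqP //|/eqP E]; exfalso.
  have /eqP : eh ((n%:R - 2 * i%:R) / 2) 1%N = eh ((n%:R - 2 * j%:R) / 2) 1%N.
    by apply/eqP; rewrite -subr_eq0 -fpsEN -fpsED E.
  rewrite /= !expr1 !divr1 => /eqP h; have : (i%:R : rat) = j%:R by lra.
  by move/eqP; rewrite eqr_nat => /eqP/val_inj ji; rewrite ji eqxx in ij.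
have step (i : nat) (i1 : (i.+1 < n.+1)%N) : Y (inord i) (inord i) = Y (inord i.+1) (inord i.+1).
  have := congr1 (fun Z : 'M[Qh]_n.+1 => Z (inord i) (inord i.+1)) YE; rewrite !mxE.
  rewrite (bigD1 (inord i.+1)) //= [X in _ + X]big1 ?addr0 => [|k kj]; last by rewrite offdiag ?mulr0.
  rewrite (bigD1 (inord i)) //= [X in _ = _ + X]big1 ?addr0 => [|k kj]; last by rewrite offdiag ?mul0r // eq_sym.
  rewrite !mxE !inordK //; last by rewrite ltnW.
  rewrite eqxx mulrC => /(mulIf _) -> //; rewrite /Ec mulf_neq0 // ; apply/eqP => /(congr1 (fun x : Qh => x 0%N));
    rewrite qn_coef0 => /eqP; rewrite ?pnatr_eq0 // -[n%:R + 1]/(n%:R + 1%:R) -natrD -natrB ?pnatr_eq0; lia.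
have diag i : Y i i = Y 0 0.
  rewrite -(inord_val i); elim: (i : nat) (ltn_ord i) => [|k IH] kn.
    by congr (Y _ _); apply: val_inj; rewrite /= inordK.
  by rewrite -step // IH // ltnW.
apply/matrixP => i j; rewrite !mxE; case: eqP => [->|/eqP ij]; first by rewrite mulr1 diag.
by rewrite mulr0 offdiag.
Qed.

(** * The expansion of the invariant *)

Section Main.
Variable T : diagram.
Hypotheses (hB : bottom_diagram T) (hC : one_component T) (hF : framing T = 0).

Lemma J_scalar n : exists2 x : Qh, rhoUh n (J T) = x%:A &
  forall a : nat, (a <= n)%N -> x = nsum n.+1 (crossings T) (fun m => Wn T n m a) (fun=> 0%N).
Proof.
set st := conv n (fun=> (mone, mone)); pose Y := @JJ T n st.
have YE : Y = (Y 0 0)%:A by apply: scalar_rep; [apply: JJ_K|apply: JJ_E].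
exists (Y 0 0); first by rewrite rhoUh_J // -YE.
move=> a an.
have : Y *m evec n a%:Z = nsum n.+1 (crossings T) (fun m => Wn T n m a) (fun=> 0%N) *: evec n a%:Z.
  exact: path_theorem.
rewrite {1}YE -scalemxAl mul1mx => /(congr1 (fun M : 'cV_n.+1 => M (inord a) 0)).
by rewrite !mxE inordK // eqxx !mulr1.
Qed.

Theorem J_expansion : exists a : nat -> Qh, (forall p, a p \in Lq) /\
  hsum (fun p => a p *: sigma p) (J T).
Proof.
pose c n := nsum n.+1 (crossings T) (fun m => Wn T n m 0) (fun=> 0%N).
have cE n (a : nat) : (a <= n)%N -> c n = nsum n.+1 (crossings T) (fun m => Wn T n m a) (fun=> 0%N).
  by move=> an; have [x _ E] := J_scalar n; rewrite -(E a an) /c -(E 0%N).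
have Jc n : rhoUh n (J T) = (c n)%:A by have [x -> E] := J_scalar n; rewrite (E 0%N).
have [|||N l|a [aL ca]] := @cyclotomic_coefs c (rT T) (Sf T).
- by move=> a N; apply: Sf_EP.
- by move=> N a n an; rewrite (cE n a an); apply: Sf_c.
- by move=> N m m0; apply: Sf_shift.
- exact: Sf_0.
by exists a; split=> //; apply: hsum_sigma Jc ca.
Qed.
End Main.

Theorem theorem4p5 (T : diagram) (hT : bottom_knot T) :
  exists! a : nat -> {fps rat},
    (forall p : nat, laurent_q (a p)) /\ hsum (fun p : nat => a p *: sigma p) (J T).
Proof.
case: hT => hB hC hF; have [a [aL ha]] := J_expansion hB hC hF.
exists a; split; first by split=> // p; apply/LqP.
move=> b [_ hb]; pose c n := s2val (cid2 (J_scalar hB hC n)).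
have Jc n : rhoUh n (J T) = (c n)%:A := s2valP (cid2 (J_scalar hB hC n)).
by apply: (@sigma_coef_uniq c) => n; apply: hsum_rho (Jc n) _.
Qed.
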